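(* Let $s\ge 1/2$, let $\Omega\subseteq\mathbf R^{2d}$ be a neighborhood of the origin, and let $a\in\mathscr S_+'(\mathbf R^{2d})\cap C^\infty(\Omega)$ (i.e. $a$ is a tempered distribution which is positive with respect to the twisted convolution and whose restriction to $\Omega$ is smooth) be such that, for some $h>0$, $$\sup_{\beta\in\mathbf N^{2d}}\left(\sup_{X\in\Omega}\frac{|D^\beta a(X)|}{(\beta!)^s h^{|\beta|}}\right)<\infty .$$ Then $a\in\mathcal S_s(\mathbf R^{2d})$.
   Context: Let $D=-i\partial$. $\mathscr S(\mathbf R^{2d})$ is the space of Schwartz functions and $\mathscr S'(\mathbf R^{2d})$ the space of tempered distributions. $(\cdot,\cdot)$ is the sesquilinear duality extending the $L^2$ scalar product. For $X=(x,\xi)\in\mathbf R^{2d}$ and $Y=(y,\eta)\in\mathbf R^{2d}$, let $\sigma(X,Y)=\langle y,\xi\rangle-\langle x,\eta\rangle$. The twisted convolution is $(a\ast_\sigma b)(X)=(2/\pi)^{d/2}\int a(X-Y)b(Y)e^{2i\sigma(X,Y)}\,dY$, interpreted by duality when $a\in\mathscr S'(\mathbf R^{2d})$ and $b\in\mathscr S(\mathbf R^{2d})$. $\mathscr S_+'(\mathbf R^{2d})$ is the set of $a\in\mathscr S'(\mathbf R^{2d})$ such that $(a\ast_\sigma\varphi,\varphi)\ge0$ for every $\varphi\in\mathscr S(\mathbf R^{2d})$. The Gelfand-Shilov space $\mathcal S_s(\mathbf R^{n})$ is the set of $\varphi\in C^\infty(\mathbf R^n)$ for which there is $h>0$ with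 $\sup_{\alpha,\beta\in\mathbf N^n}\sup_{x\in\mathbf R^n}\frac{|x^\alpha D^\beta\varphi(x)|}{(\alpha!\beta!)^s h^{|\alpha+\beta|}}<\infty$. *)

(* Defs.v *)
From HB Require Import structures.
From mathcomp Require Import all_boot all_order all_algebra.
From mathcomp Require Import all_classical all_reals all_analysis.
From mathcomp Require Import complex.

Set Implicit Arguments.
Unset Strict Implicit.
Unset Printing Implicit Defensive.

Import Order.TTheory GRing.Theory Num.Theory.
Import numFieldNormedType.Exports.

Local Open Scope classical_set_scope.
Local Open Scope ring_scope.
Local Open Scope complex_scope.

(** The library has Lebesgue measure on R, binary product measures, and the
   product sigma-algebra on [n.-tuple R].  Lebesgue measure on [n.-tuple R] is
   built from these: it is the point mass for n = 0, and for n + 1 the image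
   of [lebesgue_measure \x lebesgue_tuple n] under [(x, t) |-> x :: t]. *)

Section lebesgue_tuple_step.
Context (R : realType) (n : nat).
Local Notation RR := (measurableTypeR R).
Local Notation T := (RR * n.-tuple RR)%type.
Variable m : {sigma_finite_measure set (n.-tuple RR) -> \bar R}.

Definition tuple_cons (p : T) : n.+1.-tuple RR := [tuple of p.1 :: p.2].

Lemma measurable_tuple_cons : measurable_fun [set: T] tuple_cons.
Proof. by apply: measurable_cons. Qed.

Let leb_x_m : {measure set T -> \bar R} := (lebesgue_measure \x m)%E.

Definition lebesgue_tuple_step : set (n.+1.-tuple RR) -> \bar R :=
  pushforward (lebesgue_measure \x m)%E tuple_cons.

Let mpreim A : measurable A -> measurable (tuple_cons @^-1` A).
Proof.
by move=> mA; rewrite -[X in measurable X]setTI; exact: measurable_tuple_cons.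
Qed.

Let step0 : lebesgue_tuple_step set0 = 0%E.
Proof. by rewrite /lebesgue_tuple_step /pushforward preimage_set0 measure0. Qed.

Let step_ge0 A : (0 <= lebesgue_tuple_step A)%E.
Proof. exact: (measure_ge0 leb_x_m). Qed.

Let step_sigma_additive : semi_sigma_additive lebesgue_tuple_step.
Proof.
move=> F mF tF mUF; rewrite /lebesgue_tuple_step /pushforward preimage_bigcup.
apply: (@measure_semi_sigma_additive _ _ _ leb_x_m).
- by move=> k; exact: mpreim.
- apply/trivIsetP => /= i j _ _ ij; rewrite -preimage_setI.
  by move/trivIsetP : tF => /(_ _ _ _ _ ij) ->//; rewrite preimage_set0.
- by rewrite -preimage_bigcup; exact: mpreim.
Qed.

HB.instance Definition _ := isMeasure.Build _ _ _ lebesgue_tuple_step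
  step0 step_ge0 step_sigma_additive.

Let step_sigma_finite : sigma_finite setT lebesgue_tuple_step.
Proof.
have /sigma_finiteP[F [FT ndF Foo]] := sigma_finiteT (@lebesgue_measure R).
have /sigma_finiteP[G [GT ndG Goo]] := sigma_finiteT m.
pose uncons (t : n.+1.-tuple RR) : T := (thead t, [tuple of behead t]).
have unconsK : uncons \o tuple_cons = id.
  by apply/funext => -[x t]; congr pair => //; exact/val_inj.
have muncons : measurable_fun setT uncons.
  by apply: measurable_fun_pair; [exact: measurable_tnth|exact: measurable_behead].
exists (fun k => uncons @^-1` (F k `*` G k)).
  apply/esym; rewrite -subTset => t _.
  have [i _ Fi] : (\bigcup_k F k) (uncons t).1 by rewrite -FT.
  have [j _ Gj] : (\bigcup_k G k) (uncons t).2 by rewrite -GT.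
  exists (maxn i j) => //; split.
    by move: Fi; exact/subsetPset/ndF/leq_maxl.
  by move: Gj; exact/subsetPset/ndG/leq_maxr.
move=> k; have [mF Fk] := Foo k; have [mG Gk] := Goo k; split.
  by rewrite -[X in measurable X]setTI; apply: muncons => //; exact: measurableX.
rewrite /lebesgue_tuple_step /pushforward -comp_preimage unconsK preimage_id.
by rewrite product_measure1E// lte_mul_pinfty// ge0_fin_numE.
Qed.

HB.instance Definition _ := Measure_isSigmaFinite.Build _ _ _
  lebesgue_tuple_step step_sigma_finite.

End lebesgue_tuple_step.

Fixpoint lebesgue_tuple (R : realType) (n : nat) :
    {sigma_finite_measure set (n.-tuple (measurableTypeR R)) -> \bar R} :=
  if n is k.+1 then lebesgue_tuple_step (lebesgue_tuple R k)
  else \d_([tuple] : 0.-tuple (measurableTypeR R)).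

Section distributions.
Variables (R : realType) (n : nat).
Local Notation C := R[i].
Local Notation V := 'rV[R]_n.
Implicit Types (f g phi psi : V -> C) (U K : set V) (u : (V -> C) -> C).
Implicit Types (alpha beta : {ffun 'I_n -> nat}).

Definition cintegral f : C :=
  let F (t : n.-tuple (measurableTypeR R)) := f (\row_i tnth t i) in
  (\int[lebesgue_tuple R n]_t complex.Re (F t)) +i*
  (\int[lebesgue_tuple R n]_t complex.Im (F t)).

Definition mi_size alpha : nat := (\sum_i alpha i)%N.
Definition mi_fact alpha : nat := (\prod_i (alpha i)`!)%N.
Definition mi_monom alpha (x : V) : R := \prod_i x ord0 i ^+ alpha i.

(** [D_j = -i d/dx_j] on complex-valued functions; the library derivative is
   taken on real and imaginary parts. *)
Definition pderiv (j : 'I_n) f : V -> C := fun x =>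
  (0 -i* 1) * ('D_(delta_mx 0 j) (fun y => complex.Re (f y)) x
               +i* 'D_(delta_mx 0 j) (fun y => complex.Im (f y)) x).

Definition pderivs (w : seq 'I_n) f : V -> C := foldr pderiv f w.

(** [D^beta]: [beta j] derivatives in each direction j, in a fixed order (which
   is irrelevant for smooth functions). *)
Definition mderiv beta f : V -> C :=
  pderivs (flatten [seq nseq (beta j) j | j <- enum 'I_n]) f.

(** C^oo on an open set [U]: partial derivatives of all orders, in any order of
   differentiation, exist and are continuous at each point of [U]. *)
Definition smooth_on U f : Prop := forall (w : seq 'I_n) (x : V), U x ->
  [/\ {for x, continuous (fun y => complex.Re (pderivs w f y))},
      {for x, continuous (fun y => complex.Im (pderivs w f y))}
    & forall j : 'I_n,
        derivable (fun y => complex.Re (pderivs w f y)) x (delta_mx 0 j) /\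
        derivable (fun y => complex.Im (pderivs w f y)) x (delta_mx 0 j)].

Definition schwartz_seminorm alpha beta phi : \bar R :=
  ereal_sup
    [set (Normc.normc ((mi_monom alpha x)%:C * mderiv beta phi x))%:E
      | x in [set: V]].

Definition schwartz phi : Prop := smooth_on setT phi /\
  forall alpha beta, (schwartz_seminorm alpha beta phi < +oo)%E.

(** A tempered distribution is given by its bilinear pairing
   [u phi = <u, phi>] with Schwartz functions; [u] is a total function and its
   values outside the Schwartz space carry no information.  Continuity is for
   the topology of the Schwartz space defined by the family of seminorms. *)
Definition tempered u : Prop :=
  (forall (c : C) phi psi, schwartz phi -> schwartz psi ->
     u (fun x => c * phi x + psi x) = c * u phi + u psi) /\
  (forall phi, schwartz phi -> forall e : R, 0 < e ->
     exists (N : nat) (delta : R), 0 < delta /\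
       forall psi, schwartz psi ->
         (forall alpha beta, (mi_size alpha <= N)%N -> (mi_size beta <= N)%N ->
            (schwartz_seminorm alpha beta (fun x => (psi x - phi x)%R)
               < delta%:E)%E) ->
         Normc.normc (u psi - u phi) < e).

(** The sesquilinear duality [(u, phi)], antilinear in [phi]. *)
Definition sesq u phi : C := u (fun x => (phi x)^*).

Definition test_fun U phi : Prop := smooth_on setT phi /\
  exists K, [/\ compact K, K `<=` U & forall x, ~ K x -> phi x = 0].

Definition coincides_on U u f : Prop :=
  forall phi, test_fun U phi -> u phi = cintegral (fun x => f x * phi x).

(** [u] is C^oo on [Omega], where it is the function [f].  For open [Omega] one
   may take [U = Omega]; in general smoothness on a set is smoothness on some
   open set containing it, so that derivatives make sense on all of [Omega]. *)
Definition smooth_repr_on (Omega : set V) u f : Prop :=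
  exists U, [/\ open U, Omega `<=` U, smooth_on U f & coincides_on U u f].

Definition gelfand_shilov (s : R) phi : Prop := smooth_on setT phi /\
  exists h : R, 0 < h /\
    (ereal_sup
       [set ereal_sup
          [set (Normc.normc ((mi_monom ab.1 x)%:C * mderiv ab.2 phi x) /
                ((mi_fact ab.1 * mi_fact ab.2)%:R `^ s *
                 h ^+ (mi_size ab.1 + mi_size ab.2)))%:E | x in [set: V]]
        | ab in [set: {ffun 'I_n -> nat} * {ffun 'I_n -> nat}]] < +oo)%E.

(** The tempered distribution [u] is (integration against) an element of the
   Gelfand-Shilov space. *)
Definition in_gelfand_shilov (s : R) u : Prop :=
  exists g, gelfand_shilov s g /\
    forall phi, schwartz phi -> u phi = cintegral (fun x => g x * phi x).

End distributions.

Section twisted_convolution.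
Variables (R : realType) (d : nat).
Local Notation C := R[i].
Local Notation V := 'rV[R]_(d + d).
Implicit Types (f g phi psi : V -> C) (a : (V -> C) -> C).

Definition dot (x y : 'rV[R]_d) : R := \sum_i x ord0 i * y ord0 i.

Definition symplectic (X Y : V) : R :=
  dot (lsubmx Y) (rsubmx X) - dot (lsubmx X) (rsubmx Y).

Definition expi (t : R) : C := cos t +i* sin t.

Definition tconv f g : V -> C := fun X =>
  ((2 / pi) `^ (d%:R / 2))%:C *
  cintegral (fun Y => f (X - Y) * g Y * expi (2 * symplectic X Y)).

(** For [a] in S' and [g] in S the twisted convolution is the distribution with
   [(a * g, psi) = (a, psi * g~)], [g~ X = (g (- X))^*], for [psi] in S: for
   integrable functions this is Fubini's theorem, since
   [symplectic X (X - Z) = symplectic Z X].  It is stated here for the bilinear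
   pairing [<a * g, psi> = (a * g, psi^* )]. *)
Definition tconv_dist a g : (V -> C) -> C := fun psi =>
  sesq a (tconv (fun X => (psi X)^*) (fun X => (g (- X))^*)).

Definition tempered_plus a : Prop := tempered a /\
  forall phi, schwartz phi -> 0 <= sesq (tconv_dist a phi) phi.

End twisted_convolution.

(* Main.v *)
Require Import Defs.
From HB Require Import structures.
From mathcomp Require Import all_boot all_order all_algebra.
From mathcomp Require Import all_classical all_reals all_analysis.
From mathcomp Require Import measurable_realfun complex ring lra.

Set Implicit Arguments.
Unset Strict Implicit.
Unset Printing Implicit Defensive.

Import Order.TTheory GRing.Theory Num.Theory.
Import numFieldNormedType.Exports.

Local Open Scope classical_set_scope.
Local Open Scope ring_scope.
Local Open Scope complex_scope.

(** Write [form phi psi = a (corr phi psi)], where [corr phi psi] is the twisted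
   correlation of two test functions. Positivity of [a] says that [form] is a
   positive semidefinite sesquilinear form, and [corr] is unchanged when both
   arguments undergo the same twisted translation, so the form is invariant under
   twisted translations.

   The distribution turns out to be determined by its restriction to a neighbourhood
   of the origin. There [a] is a continuous function [f], so on functions concentrated at
   the origin the form is, up to a small error, [f 0] times the product of the
   integrals ([local_form]). Hence the mollifiers are Cauchy for the seminorm of the
   form, and so are their twisted translates: the Hilbert space of the form contains
   a vector for every point [W] of the phase space. Such vectors are adjoined to the
   form as new indices of a kernel ([psd_limit], [limit_kernel]). The Gram numbers of
   the points are [twist g], where [g W] is the product of the points [0] and [W], and
   [g] agrees with [f] near the origin. The product of the point [0] with a test
   function is the value of [a] at the conjugate function ([form_moll]), and a test function concentrated
   near [W] is close to a multiple of the point [W] ([concentrated]); so a partition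
   of unity and Cauchy-Schwarz show that [a] is integration against [g]
   ([test_representation], [schwartz_representation]).

   It remains to bound [g], knowing that [twist g] is positive semidefinite and that
   the derivatives of [g] at the origin are those of [f]. A point vector may be
   differentiated in its position, since by invariance the convergence of its
   difference quotients is decided by second differences at the origin
   ([adjoin_derivatives]). This yields global smoothness of [g], and the Gram numbers
   of derivatives of point vectors are obtained from [g] by the operators [LL l] and
   [RR l], which differentiate the first and the second vector. Cauchy-Schwarz bounds
   these Gram numbers at every point by their values at the origin ([LRder_bound]).
   Now [RR l - LL l] is twice a partial derivative, and [RR l + LL l] is multiplication
   by twice a coordinate function [ell l]. So the same values at the origin control
   both the derivatives and the decay of [g]
   ([monomial_derivative_bound]).

   At the origin the coordinate functions vanish, and a word of [M] operators becomes
   a derivative of order [M] plus terms in which two operators have cancelled. Each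
   pair of cancelled operators is paid for by a factor at most the length of the word;
   the growth [(M!) ^ s] absorbs it because [M <= ((M + 1) * (M + 2)) ^ s] for
   [s >= 1/2] ([fact_gain], [opw_growth]). The bounds of Gelfand and Shilov follow
   ([gelfand_shilov_of_psd]). *)

(** * Modulus of complex numbers *)

Definition cmod (R : realType) (z : R[i]) : R := Normc.normc z.

Section modulus.
Context {R : realType}.
Implicit Types (x y z : R[i]) (t : R).

Lemma cext x y : complex.Re x = complex.Re y -> complex.Im x = complex.Im y -> x = y.
Proof. by case: x y => ? ? [] /= ? ? -> ->. Qed.

Lemma le_epsilon (a b : R) : (forall e : R, 0 < e -> a <= b + e) -> a <= b.
Proof. by move=> h; apply/ler_addgt0Pr. Qed.

Lemma cmod_ge0 z : 0 <= cmod z.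
Proof. by case: z => a b; rewrite /cmod /= sqrtr_ge0. Qed.

Lemma cmod_sqr z : cmod z ^+ 2 = complex.Re z ^+ 2 + complex.Im z ^+ 2.
Proof. by case: z => a b; rewrite /cmod /= sqr_sqrtr// addr_ge0// sqr_ge0. Qed.

Lemma cmod0 : cmod (0 : R[i]) = 0. Proof. exact: Normc.normc0. Qed.
Lemma cmod1 : cmod (1 : R[i]) = 1. Proof. exact: Normc.normc1. Qed.
Lemma cmod_eq0 z : cmod z = 0 -> z = 0. Proof. exact: Normc.eq0_normc. Qed.
Lemma cmodM x y : cmod (x * y) = cmod x * cmod y. Proof. exact: Normc.normcM. Qed.
Lemma cmodD x y : cmod (x + y) <= cmod x + cmod y. Proof. exact: le_normcD. Qed.
Lemma cmodN x : cmod (- x) = cmod x. Proof. exact: normcN. Qed.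
Lemma cmodB x y : cmod (x - y) <= cmod x + cmod y.
Proof. by rewrite -(cmodN y) cmodD. Qed.
Lemma cmodBC x y : cmod (x - y) = cmod (y - x).
Proof. by rewrite -opprB cmodN. Qed.
Lemma cmodJ x : cmod x^*%C = cmod x.
Proof. by case: x => a b; rewrite /cmod /= sqrrN. Qed.
Lemma cmodR t : cmod t%:C = `|t|.
Proof. by rewrite /cmod /= expr0n /= addr0 sqrtr_sqr. Qed.
Lemma cmod_Re z : `|complex.Re z| <= cmod z.
Proof.
by case: z => a b; rewrite /cmod /= -sqrtr_sqr ler_wsqrtr// lerDl sqr_ge0.
Qed.
Lemma cmod_Im z : `|complex.Im z| <= cmod z.
Proof.
by case: z => a b; rewrite /cmod /= -sqrtr_sqr ler_wsqrtr// lerDr sqr_ge0.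
Qed.
Lemma cmod_i : cmod ('i%C : R[i]) = 1.
Proof. by rewrite /cmod /= expr0n /= add0r expr1n sqrtr1. Qed.
Lemma cmod_le z : cmod z <= `|complex.Re z| + `|complex.Im z|.
Proof.
rewrite {1}(complexE z); apply: (le_trans (cmodD _ _)); rewrite cmodM !cmodR.
by rewrite cmod_i mul1r.
Qed.

Lemma conjR t : t%:C^*%C = t%:C.
Proof. by apply: cext => //=; rewrite oppr0. Qed.

Lemma conjM x y : (x * y)^*%C = x^*%C * y^*%C.
Proof. exact: rmorphM. Qed.
Lemma conjD x y : (x + y)^*%C = x^*%C + y^*%C.
Proof. exact: rmorphD. Qed.
Lemma conjN x : (- x)^*%C = - x^*%C.
Proof. exact: rmorphN. Qed.

Lemma conjN1 : (-1 : R[i])^*%C = -1.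
Proof. by apply: cext => //=; rewrite !oppr0. Qed.

Lemma cmod_sum (I : Type) (r : seq I) (P : pred I) (F : I -> R[i]) :
  cmod (\sum_(i <- r | P i) F i) <= \sum_(i <- r | P i) cmod (F i).
Proof.
elim/big_ind2 : _ => // [|x1 x2 y1 y2 h1 h2]; first by rewrite cmod0.
by apply: (le_trans (cmodD _ _)); rewrite lerD.
Qed.

Lemma cmod_tri x y z : cmod (x - z) <= cmod (x - y) + cmod (y - z).
Proof. have -> : x - z = (x - y) + (y - z) by ring. exact: cmodD. Qed.

Lemma mulcJ z : z * z^*%C = (cmod z ^+ 2)%:C.
Proof.
case: z => a b; apply/eqP; rewrite eq_complex cmod_sqr /=; apply/andP; split; apply/eqP; ring.
Qed.

Lemma ge0c z : (0 <= z) <-> complex.Im z = 0 /\ 0 <= complex.Re z.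
Proof. by rewrite lecE /=; split=> [/andP[/eqP ? ?]//|[-> ->]]; rewrite eqxx. Qed.

Lemma ReD x y : complex.Re (x + y) = complex.Re x + complex.Re y.
Proof. by case: x y => ? ? []. Qed.
Lemma ImD x y : complex.Im (x + y) = complex.Im x + complex.Im y.
Proof. by case: x y => ? ? []. Qed.
Lemma ReN x : complex.Re (- x) = - complex.Re x. Proof. by case: x. Qed.
Lemma ImN x : complex.Im (- x) = - complex.Im x. Proof. by case: x. Qed.
Lemma ReM x y : complex.Re (x * y) =
  complex.Re x * complex.Re y - complex.Im x * complex.Im y.
Proof. by case: x y => ? ? []. Qed.
Lemma ImM x y : complex.Im (x * y) =
  complex.Re x * complex.Im y + complex.Im x * complex.Re y.
Proof. by case: x y => ? ? []. Qed.


Lemma ReR t : complex.Re t%:C = t. Proof. by []. Qed.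
Lemma ImR t : complex.Im t%:C = 0. Proof. by []. Qed.
Lemma ReJ z : complex.Re z^*%C = complex.Re z. Proof. by case: z. Qed.
Lemma ImJ z : complex.Im z^*%C = - complex.Im z. Proof. by case: z. Qed.

Lemma expiD (t u : R) : expi (t + u) = expi t * expi u.
Proof. by apply: cext => /=; rewrite ?cosD ?sinD //; ring. Qed.
Lemma expi0 : expi (0 : R) = 1.
Proof. by rewrite /expi cos0 sin0. Qed.
Lemma expiJ t : (expi t)^*%C = expi (- t).
Proof. by apply: cext => /=; rewrite ?cosN ?sinN. Qed.
Lemma cmod_expi t : cmod (expi t) = 1.
Proof.
apply/eqP; rewrite -(@eqrXn2 _ 2)// ?cmod_ge0// expr1n cmod_sqr /=.
by rewrite cos2Dsin2.
Qed.
Lemma expiK t : expi t * expi (- t) = 1.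
Proof. by rewrite -expiD subrr expi0. Qed.

End modulus.

(** * Positive semidefinite kernels *)

Section kernels.
Context {R : realType}.
Local Notation C := R[i].

Definition kform I (K : I -> I -> C) (c c' : seq (C * I)) : C :=
  \sum_(p <- c) \sum_(q <- c') p.1 * (q.1)^*%C * K p.2 q.2.

Definition supported I (P : pred I) (c : seq (C * I)) : bool :=
  all (fun p => P p.2) c.

(** The predicate [P] restricts positivity to part of the index type, so that
   positivity of larger and larger parts can be proved by induction. *)
Definition psd I (P : pred I) (K : I -> I -> C) :=
  forall c, supported P c -> 0 <= kform K c c.

Definition lscale I (a : C) (c : seq (C * I)) := [seq (a * p.1, p.2) | p <- c].

Section form.
Variables (I : Type) (K : I -> I -> C).
Implicit Types (c : seq (C * I)) (a : C).

Lemma kform_catl c1 c2 c : kform K (c1 ++ c2) c = kform K c1 c + kform K c2 c.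
Proof. by rewrite /kform big_cat. Qed.

Lemma kform_catr c1 c2 c : kform K c (c1 ++ c2) = kform K c c1 + kform K c c2.
Proof.
rewrite /kform -big_split /=; apply: eq_bigr => p _; by rewrite big_cat.
Qed.

Lemma kform_scalel a c1 c : kform K (lscale a c1) c = a * kform K c1 c.
Proof.
rewrite /kform big_map mulr_sumr; apply: eq_bigr => p _ /=.
by rewrite mulr_sumr; apply: eq_bigr => q _; ring.
Qed.

Lemma kform_scaler a c1 c : kform K c (lscale a c1) = a^*%C * kform K c c1.
Proof.
rewrite /kform mulr_sumr; apply: eq_bigr => p _ /=.
rewrite big_map mulr_sumr; apply: eq_bigr => q _ /=.
by rewrite rmorphM /=; ring.
Qed.

Lemma kform1 a b i j : kform K [:: (a, i)] [:: (b, j)] = a * b^*%C * K i j.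
Proof. by rewrite /kform !big_seq1. Qed.

Variable (P : pred I).

Lemma supported_scale a c : supported P (lscale a c) = supported P c.
Proof. by rewrite /supported all_map. Qed.

Lemma supported_cat c1 c2 :
  supported P (c1 ++ c2) = supported P c1 && supported P c2.
Proof. by rewrite /supported all_cat. Qed.

Hypothesis Kpsd : psd P K.

Lemma psd_form_ge0 c1 c2 a b : supported P c1 -> supported P c2 ->
  0 <= a * a^*%C * kform K c1 c1 + a * b^*%C * kform K c1 c2
     + b * a^*%C * kform K c2 c1 + b * b^*%C * kform K c2 c2.
Proof.
move=> P1 P2; have := @Kpsd (lscale a c1 ++ lscale b c2).
rewrite supported_cat !supported_scale P1 P2 => /(_ isT).
rewrite kform_catl !kform_catr !kform_scalel !kform_scaler.
by congr (0 <= _); ring.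
Qed.

Lemma kform_herm c1 c2 : supported P c1 -> supported P c2 ->
  kform K c2 c1 = (kform K c1 c2)^*%C.
Proof.
move=> P1 P2.
have /ge0c[a0 _] := Kpsd P1; have /ge0c[d0 _] := Kpsd P2.
have /ge0c[+ _] := psd_form_ge0 1 1 P1 P2.
have /ge0c[+ _] := psd_form_ge0 1 'i%C P1 P2.
case: (kform K c1 c1) a0 => a a' /= ->.
case: (kform K c2 c2) d0 => b b' /= ->.
case: (kform K c1 c2) => u v; case: (kform K c2 c1) => w z /=.
move=> h1 h2; apply: cext => /=; lra.
Qed.

Lemma psd_cauchy_schwarz c1 c2 : supported P c1 -> supported P c2 ->
  cmod (kform K c1 c2) ^+ 2 <=
    complex.Re (kform K c1 c1) * complex.Re (kform K c2 c2).
Proof.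
move=> P1 P2.
have /ge0c[a0 a_ge0] := Kpsd P1; have /ge0c[d0 d_ge0] := Kpsd P2.
have hh := kform_herm P1 P2.
set A := complex.Re (kform K c1 c1) in a_ge0 *.
set D := complex.Re (kform K c2 c2) in d_ge0 *.
set b := kform K c1 c2 in hh *.
(* Positivity with the weight [D + e] in place of [D] covers the case [D = 0]. *)
have key (e : R) : 0 < e -> cmod b ^+ 2 <= A * (D + e).
  move=> e0; have De : 0 < D + e by lra.
  have := psd_form_ge0 (D + e)%:C (- b) P1 P2.
  have -> : kform K c1 c1 = A%:C by apply: cext.
  have -> : kform K c2 c2 = D%:C by apply: cext.
  rewrite hh conjR rmorphN /=.
  have -> : (D + e)%:C * (D + e)%:C * A%:C + (D + e)%:C * - b^*%C * b
      + - b * (D + e)%:C * b^*%C + - b * - b^*%C * D%:C =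
     (D + e)%:C * (D + e)%:C * A%:C - (D + e)%:C * (b * b^*%C) *+ 2
      + (b * b^*%C) * D%:C by rewrite mulr2n; ring.
  rewrite mulcJ; set n := _ ^+ 2.
  have n0 : 0 <= n by rewrite exprn_ge0// cmod_ge0.
  have -> : (D + e)%:C * (D + e)%:C * A%:C - (D + e)%:C * n%:C *+ 2 + n%:C * D%:C
    = ((D + e) * (D + e) * A - (D + e) * n *+ 2 + n * D)%:C.
    by rewrite !(rmorphM, rmorphD, rmorphN, rmorphMn).
  rewrite ler0c => h.
  have h2 : (D + e) * n <= (D + e) * (A * (D + e)) by nra.
  by move: h2; rewrite ler_pM2l.
apply: le_epsilon => e e0.
have [A0|A0] := eqVneq A 0.
  by have := key e e0; rewrite A0 !mul0r add0r => /le_trans; apply; exact: ltW.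
have A1 : 0 < A by rewrite lt_neqAle eq_sym A0.
have := key (e / A) (divr_gt0 e0 A1).
by rewrite mulrDr mulrCA divff// mulr1.
Qed.

Lemma psd_cs i j : P i -> P j ->
  cmod (K i j) ^+ 2 <= complex.Re (K i i) * complex.Re (K j j).
Proof.
move=> Pi Pj; have := @psd_cauchy_schwarz [:: (1, i)] [:: (1, j)].
rewrite /supported /= Pi Pj => /(_ isT isT).
by rewrite !kform1 conjc1 !mul1r.
Qed.

Lemma psd_herm i j : P i -> P j -> K j i = (K i j)^*%C.
Proof.
move=> Pi Pj; have := @kform_herm [:: (1, i)] [:: (1, j)].
rewrite /supported /= Pi Pj => /(_ isT isT).
by rewrite !kform1 conjc1 !mul1r.
Qed.

End form.

(** The indices [t] and [s] run independently along the same filter: for Gram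
   numbers of a net of vectors this makes convergence equivalent to the Cauchy
   property of the net. *)
Definition jlim T (F : set_system T) (h : T -> T -> C) (m : C) :=
  forall e : R, 0 < e -> exists A, F A /\
    forall t s, A t -> A s -> cmod (h t s - m) < e.

Section jlim.
Context {T : Type} {F : set_system T} {FF : ProperFilter F}.
Implicit Types (h k : T -> T -> C) (m : C).

Lemma jlim_cst m : jlim F (fun _ _ => m) m.
Proof.
by move=> e e0; exists setT; split; [exact: filterT|move=> *; rewrite subrr cmod0].
Qed.

Lemma jlimD h k m n : jlim F h m -> jlim F k n ->
  jlim F (fun t s => h t s + k t s) (m + n).
Proof.
move=> hm kn e e0; have e2 : 0 < e / 2 by lra.
have [A [FA hA]] := hm _ e2; have [B [FB hB]] := kn _ e2.
exists (A `&` B); split; first exact: filterI.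
move=> t s [At Bt] [As Bs]; have := hA _ _ At As; have := hB _ _ Bt Bs.
have -> : h t s + k t s - (m + n) = (h t s - m) + (k t s - n) by ring.
have := cmodD (h t s - m) (k t s - n); lra.
Qed.

Lemma jlimM h k m n : jlim F h m -> jlim F k n ->
  jlim F (fun t s => h t s * k t s) (m * n).
Proof.
move=> hm kn e e0.
have mp : 0 < cmod m + 1 by have := cmod_ge0 m; lra.
have np : 0 < cmod n + 1 by have := cmod_ge0 n; lra.
pose e1 := Num.min 1 (e / 2 / (cmod n + 1)).
pose e2 := e / 2 / (cmod m + 1).
have e10 : 0 < e1 by rewrite lt_min ltr01 !divr_gt0.
have e20 : 0 < e2 by rewrite !divr_gt0.
have [A [FA hA]] := hm _ e10; have [B [FB hB]] := kn _ e20.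
exists (A `&` B); split; first exact: filterI.
move=> t s [At Bt] [As Bs]; have {hA} := hA _ _ At As; have {hB} := hB _ _ Bt Bs.
set u := h t s; set v := k t s => vn; rewrite lt_min => /andP[u1 un].
have -> : u * v - m * n = u * (v - n) + (u - m) * n by ring.
apply: (le_lt_trans (cmodD _ _)); rewrite !cmodM.
have uu : cmod u <= cmod m + 1.
  have -> : u = m + (u - m) by ring.
  by apply: (le_trans (cmodD _ _)); lra.
have : cmod u * cmod (v - n) <= (cmod m + 1) * cmod (v - n).
  by rewrite ler_wpM2r// cmod_ge0.
have : (cmod m + 1) * cmod (v - n) < e / 2.
  by rewrite mulrC -ltr_pdivlMr.
have : cmod (u - m) * cmod n <= cmod (u - m) * (cmod n + 1).
  by rewrite ler_wpM2l ?cmod_ge0//; lra.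
have : cmod (u - m) * (cmod n + 1) < e / 2 by rewrite -ltr_pdivlMr.
lra.
Qed.

Lemma jlim_ext h k m : (forall t s, h t s = k t s) -> jlim F h m -> jlim F k m.
Proof.
move=> hk hm e e0; have [A [FA hA]] := hm _ e0; exists A; split => // t s At As.
by rewrite -hk; exact: hA.
Qed.

Lemma jlim_near h k m : (exists A, F A /\ forall t s, A t -> A s -> h t s = k t s) ->
  jlim F h m -> jlim F k m.
Proof.
move=> [B [FB hk]] hm e e0; have [A [FA hA]] := hm _ e0; exists (A `&` B).
split; first exact: filterI.
by move=> t s [At Bt] [As Bs]; rewrite -hk//; exact: hA.
Qed.

Lemma jlim_sum (J : Type) (r : seq J) (h : J -> T -> T -> C) (m : J -> C) (P : pred J) :
  (forall j, P j -> jlim F (h j) (m j)) -> all P r ->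
  jlim F (fun t s => \sum_(j <- r) h j t s) (\sum_(j <- r) m j).
Proof.
move=> hm; elim: r => [_|j r IH /= /andP[Pj Pr]].
  by rewrite big_nil; apply: jlim_ext (jlim_cst 0) => t s; rewrite big_nil.
rewrite big_cons; apply: jlim_ext (jlimD (hm j Pj) (IH Pr)) => t s.
by rewrite big_cons.
Qed.

Lemma jlim_unique h m n : jlim F h m -> jlim F h n -> m = n.
Proof.
move=> hm hn; apply/eqP; rewrite -subr_eq0; apply/eqP/cmod_eq0.
apply/le_anti; rewrite cmod_ge0 andbT; apply: le_epsilon => e e0; rewrite add0r.
have e2 : 0 < e / 2 by lra.
have [A [FA hA]] := hm _ e2; have [B [FB hB]] := hn _ e2.
have [t [At Bt]] := filter_ex (filterI FA FB).
have := hA _ _ At At; have := hB _ _ Bt Bt; have := cmod_tri m (h t t) n.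
rewrite (cmodBC m (h t t)); lra.
Qed.

Lemma jlim_ge0 h m : jlim F h m -> (forall t, 0 <= h t t) -> 0 <= m.
Proof.
move=> hm h0; apply/ge0c; split.
  apply/normr0_eq0/le_anti; rewrite normr_ge0 andbT.
  apply: le_epsilon => e e0; rewrite add0r.
  have [A [FA hA]] := hm _ e0; have [t At] := filter_ex FA.
  have /ge0c[Im0 _] := h0 t; have := hA _ _ At At; have := cmod_Im (h t t - m).
  by rewrite ImD ImN Im0 sub0r normrN; lra.
apply: le_epsilon => e e0.
have [A [FA hA]] := hm _ e0; have [t At] := filter_ex FA.
have /ge0c[_ Re0] := h0 t; have := hA _ _ At At; have := cmod_Re (h t t - m).
rewrite ReD ReN; have := ler_norm (complex.Re (h t t) - complex.Re m); lra.
Qed.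

Lemma real_cauchy_limit (u : T -> R) :
  (forall e : R, 0 < e -> exists A, F A /\ forall t s, A t -> A s -> `|u t - u s| < e) ->
  exists l, forall e : R, 0 < e -> exists A, F A /\ forall t, A t -> `|u t - l| < e.
Proof.
move=> cu.
have : cvg (u @ F).
  apply/cauchy_cvgP/cauchy_exP => e e0.
  have [A [FA hA]] := cu e e0; have [t At] := filter_ex FA.
  exists (u t); change (F [set s | ball (u t) e (u s)]).
  by apply: (filterS _ FA) => s As; exact: hA.
move=> /cvg_ex[l /= ul]; exists l => e e0.
exists [set t | `|u t - l| < e]; split => //.
have /cvgrPdist_lt/(_ _ e0) := ul.
by apply: filterS => t /=; rewrite distrC.
Qed.

Lemma jlim_cauchy h :
  (forall e : R, 0 < e -> exists A, F A /\
    forall t s t' s', A t -> A s -> A t' -> A s' -> cmod (h t s - h t' s') < e) ->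
  exists m, jlim F h m.
Proof.
move=> ch.
have [|l1 hl1] := @real_cauchy_limit (fun t => complex.Re (h t t)).
  move=> e /ch[A [FA hA]]; exists A; split => // t s At As.
  apply: le_lt_trans (hA _ _ _ _ At At As As).
  by have := cmod_Re (h t t - h s s); rewrite ReD ReN.
have [|l2 hl2] := @real_cauchy_limit (fun t => complex.Im (h t t)).
  move=> e /ch[A [FA hA]]; exists A; split => // t s At As.
  apply: le_lt_trans (hA _ _ _ _ At At As As).
  by have := cmod_Im (h t t - h s s); rewrite ImD ImN.
exists (l1 +i* l2) => e e0; have e3 : 0 < e / 3 by lra.
have [A [FA hA]] := ch _ e3; have [B [FB hB]] := hl1 _ e3.
have [D [FD hD]] := hl2 _ e3.
exists (A `&` (B `&` D)); split; first by do 2 apply: filterI => //.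
move=> t s [At [Bt Dt]] [As _].
have := hA _ _ _ _ At As At At; have := hB _ Bt; have := hD _ Dt.
have := cmod_tri (h t s) (h t t) (l1 +i* l2).
have := cmod_le (h t t - (l1 +i* l2)); rewrite ReD ImD ReN ImN /=.
lra.
Qed.

End jlim.

(** Vectors of the Hilbert space of a psd kernel need not be constructed: a net
   of finite combinations whose Gram numbers [kform (q t) (q s)] converge jointly
   is Cauchy, so its limit may be adjoined as a new index of the kernel. *)
Lemma psd_limit (I I' T : Type) (F : set_system T) (FF : ProperFilter F)
    (P : pred I) (K : I -> I -> C) (P' : pred I') (q : I' -> T -> seq (C * I)) :
  psd P K ->
  (forall a t, P' a -> supported P (q a t)) ->
  (forall a, P' a -> exists m, jlim F (fun t s => kform K (q a t) (q a s)) m) ->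
  exists K' : I' -> I' -> C, psd P' K' /\
    forall a b, P' a -> P' b ->
      jlim F (fun t s => kform K (q a t) (q b s)) (K' a b).
Proof.
move=> Kpsd Pq lim.
have bounded a : P' a -> exists M : R, 0 < M /\ exists A, F A /\ forall t, A t ->
    complex.Re (kform K (q a t) (q a t)) <= M ^+ 2.
  move=> /lim[m /(_ _ ltr01)[A [FA hA]]].
  exists (cmod m + 1); have m0 := cmod_ge0 m; split; first lra.
  exists A; split => // t At; have := hA _ _ At At.
  have := cmod_Re (kform K (q a t) (q a t)).
  have := cmodD (kform K (q a t) (q a t) - m) m; rewrite subrK.
  have := ler_norm (complex.Re (kform K (q a t) (q a t))).
  rewrite expr2; nra.
(* The squared seminorm of [q a t - q a t'] is a signed sum of four Gram numbers
   with the same limit. *)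
have small a (e : R) : P' a -> 0 < e -> exists A, F A /\ forall t t', A t -> A t' ->
    let c := q a t ++ lscale (-1) (q a t') in
    complex.Re (kform K c c) <= e ^+ 2.
  move=> /lim[m hm] e0.
  have e4 : 0 < e ^+ 2 / 4 by rewrite divr_gt0// exprn_gt0.
  have [A [FA hA]] := hm _ e4; exists A; split => // t t' At At' /=.
  rewrite kform_catl !kform_catr !kform_scalel !kform_scaler conjN1.
  set x1 := kform _ _ _; set x2 := kform _ _ _; set x3 := kform _ _ _.
  set x4 := kform _ _ _.
  have := hA _ _ At At; have := hA _ _ At At'; have := hA _ _ At' At.
  have := hA _ _ At' At'; rewrite -/x1 -/x2 -/x3 -/x4.
  have -> : x1 + -1 * x2 + (-1 * x3 + -1 * (-1 * x4)) =
    (x1 - m) - (x2 - m) + (- (x3 - m) + (x4 - m)) by ring.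
  set z := (x1 - m) - (x2 - m) + (- (x3 - m) + (x4 - m)).
  have : cmod z <= cmod (x1 - m) + cmod (x2 - m) + (cmod (x3 - m) + cmod (x4 - m)).
    apply: (le_trans (cmodD _ _)); apply: lerD; first exact: cmodB.
    by rewrite -(cmodN (x3 - m)); exact: cmodD.
  have := cmod_Re z; have := ler_norm (complex.Re z); lra.
have ex a b : P' a -> P' b ->
    exists m, jlim F (fun t s => kform K (q a t) (q b s)) m.
  move=> Pa Pb; apply: jlim_cauchy => e e0.
  have [M [M0 [A [FA hA]]]] := bounded _ Pa.
  have [N [N0 [B [FB hB]]]] := bounded _ Pb.
  have e3M : 0 < e / 3 / M by rewrite !divr_gt0.
  have e3N : 0 < e / 3 / N by rewrite !divr_gt0.
  have [A' [FA' hA']] := small _ _ Pa e3N.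
  have [B' [FB' hB']] := small _ _ Pb e3M.
  exists ((A `&` B) `&` (A' `&` B')).
  split; first by apply: filterI; apply: filterI.
  move=> t s t' s' [[At Bt] [At' Bt']] [[As Bs] [As' Bs']].
  move=> [[A2t B2t] [A2t' B2t']] [[A2s B2s] [A2s' B2s']].
  set c1 := q a t ++ lscale (-1) (q a t').
  set c2 := q b s ++ lscale (-1) (q b s').
  have -> : kform K (q a t) (q b s) - kform K (q a t') (q b s') =
     kform K c1 (q b s) + kform K (q a t') c2.
    rewrite kform_catl kform_catr !kform_scalel !kform_scaler conjN1; ring.
  have S1 : supported P c1 by rewrite supported_cat supported_scale !Pq.
  have S2 : supported P c2 by rewrite supported_cat supported_scale !Pq.
  apply: (le_lt_trans (cmodD _ _)).
  have cs (x y : R) (z : C) (u v : R) : cmod z ^+ 2 <= u * v -> 0 <= v ->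
     u <= x ^+ 2 -> v <= y ^+ 2 -> 0 < x -> 0 < y -> cmod z <= x * y.
    move=> h1 v0 h2 h3 x0 y0; rewrite -(@ler_pXn2r _ 2)// ?nnegrE ?cmod_ge0 //.
      by rewrite exprMn; apply: le_trans h1 _; apply: le_trans (ler_wpM2r v0 h2) _; rewrite ler_wpM2l// sqr_ge0.
    by rewrite ltW// mulr_gt0.
  have g0 c : supported P c -> 0 <= complex.Re (kform K c c).
    by move=> /Kpsd/ge0c[].
  have h1 : cmod (kform K c1 (q b s)) <= e / 3 / N * N.
    apply: (cs _ _ _ _ _ (psd_cauchy_schwarz Kpsd S1 (Pq _ s Pb))) => //.
    - by apply: g0; exact: Pq.
    - exact: hA'.
    - exact: hB.
  have h2 : cmod (kform K (q a t') c2) <= M * (e / 3 / M).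
    apply: (cs _ _ _ _ _ (psd_cauchy_schwarz Kpsd (Pq _ t' Pa) S2)) => //.
    - by apply: g0.
    - exact: hA.
    - exact: hB'.
  rewrite divfK ?gt_eqF// in h1; rewrite (mulrC M) divfK ?gt_eqF// in h2; lra.
have [K' hK'] : {K' : I' -> I' -> C & forall a b, P' a -> P' b ->
    jlim F (fun t s => kform K (q a t) (q b s)) (K' a b)}.
  have ex' (ab : I' * I') : {m : C | P' ab.1 -> P' ab.2 ->
      jlim F (fun t s => kform K (q ab.1 t) (q ab.2 s)) m}.
    apply: cid; have [Pa|Pa] := boolP (P' ab.1); last by exists 0.
    have [Pb|Pb] := boolP (P' ab.2); last by exists 0.
    by have [m hm] := ex _ _ Pa Pb; exists m.
  exists (fun a b => projT1 (ex' (a, b))) => a b Pa Pb.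
  exact: (projT2 (ex' (a, b))).
exists K'; split => // c Pc.
pose Q t := flatten [seq lscale p.1 (q p.2 t) | p <- c].
have QE t s : kform K (Q t) (Q s) = \sum_(p <- c) \sum_(r <- c)
    p.1 * (r.1)^*%C * kform K (q p.2 t) (q r.2 s).
  rewrite /Q; elim: {1 3}c => [|p c' IH] /=; first by rewrite big_nil /kform big_nil.
  rewrite kform_catl big_cons IH; congr (_ + _); rewrite kform_scalel.
  elim: c {Pc IH Q} => [|r c IH] /=; first by rewrite big_nil /kform big1 ?mulr0// => i _; rewrite big_nil.
  rewrite kform_catr big_cons mulrDr IH kform_scaler; congr (_ + _); ring.
apply: (@jlim_ge0 _ F _ (fun t s => kform K (Q t) (Q s))).
  apply: jlim_ext (fun t s => esym (QE t s)) _.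
  apply: (jlim_sum (P := fun p => P' p.2)) => // p Pp.
  apply: (jlim_sum (P := fun p => P' p.2)) => // r Pr.
  by apply: jlimM; [exact: jlim_cst|exact: hK'].
move=> t; apply: Kpsd; rewrite /Q.
elim: c Pc {Q QE} => //= p c IH /andP[Pp /IH Pc].
by rewrite supported_cat supported_scale Pq.
Qed.

End kernels.

(** * Partial derivatives of complex-valued functions *)

Lemma is_derive_ext {R : realType} {E : normedModType R} (f g : E -> R) x v
    (l m : R) :
  is_derive x v f l -> f = g -> l = m -> is_derive x v g m.
Proof. by move=> ? <- <-. Qed.

Section real_derivatives.
Context {R : realType} {n : nat}.
Local Notation V := 'rV[R]_n.
Implicit Types (h : V -> R) (x v : V) (l : R).

Lemma derive_dist {E : normedModType R} (h : E -> R) (x v : E) l :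
  is_derive x v h l <->
  forall e : R, 0 < e -> exists2 d : R, 0 < d &
    forall t : R, `|t| < d -> `|h (x + t *: v) - h x - t * l| <= e * `|t|.
Proof.
split=> [[hd hl] e e0|H].
  have := hd; rewrite /derivable => /cvg_ex[l' /= hl'].
  have ll : l' = l.
    rewrite -hl /derive; apply/esym/cvg_lim => //.
  rewrite ll in hl' => {ll l'}.
  have /cvgrPdist_le/(_ _ e0) := hl'.
  rewrite /prop_near1 /dnbhs /within /= => /nbhs_ballP[d /= d0 hd'].
  exists d => // t td; have [->|t0] := eqVneq t 0.
    by rewrite scale0r addr0 subrr mul0r subrr normr0 mulr0.
  have := hd' t; rewrite /ball /= sub0r normrN => /(_ td t0).
  rewrite distrC => hh.
  have -> : h (x + t *: v) - h x - t * l
      = t * (t^-1 *: (h (t *: v + x) - h x) - l).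
    rewrite /GRing.scale /= mulrBr mulrA divff// mul1r.
    by rewrite (addrC x).
  by rewrite normrM mulrC ler_pM2r ?normr_gt0.
suff hl : (fun t : R => t^-1 *: (h (t *: v + x) - h x)) @ 0^' --> l.
  by apply: DeriveDef; [apply/cvg_ex; exists l|exact/cvg_lim].
apply/cvgrPdist_le => e e0; have [d d0 hd] := H e e0.
rewrite /prop_near1 /dnbhs /within /=; apply/nbhs_ballP; exists d => //= t.
rewrite /ball /= sub0r normrN => td t0.
rewrite distrC -(@ler_pM2r _ `|t|) ?normr_gt0// -normrM.
have -> : (t^-1 *: (h (t *: v + x) - h x) - l) * t = h (x + t *: v) - h x - t * l.
  rewrite /GRing.scale /= mulrC mulrBr mulrA divff// mul1r.
  by rewrite (addrC x).
exact: hd.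
Qed.

Lemma is_derive_line h x v (r : R) l :
  is_derive (x + r *: v) v h l <-> is_derive r (1 : R) (fun t => h (x + t *: v)) l.
Proof.
have E : (fun t : R => t^-1 *: (h (t *: v + (x + r *: v)) - h (x + r *: v))) =
   (fun t : R => t^-1 *: (((fun t => h (x + t *: v)) \o shift r) (t *: (1 : R)) - h (x + r *: v))).
  apply/funext => t /=; congr (_ *: (h _ - _)).
  by rewrite (_ : t *: (1 : R) = t) ?scalerDl 1?addrCA // /GRing.scale /= mulr1.
split=> -[hd hl]; apply: DeriveDef.
- by move: hd; rewrite /derivable -E.
- by move: hl; rewrite /derive -E.
- by move: hd; rewrite /derivable -E.
- by move: hl; rewrite /derive -E.
Qed.

End real_derivatives.

Section partial.
Context {R : realType} {n : nat}.
Local Notation C := R[i].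
Local Notation V := 'rV[R]_n.
Implicit Types (F G : V -> C) (x y : V) (l m : C) (j : 'I_n) (U : set V).

Definition ev j : V := delta_mx 0 j.

Definition cdrv j F x l :=
  is_derive x (ev j) (fun y => complex.Re (F y)) (complex.Re l) /\
  is_derive x (ev j) (fun y => complex.Im (F y)) (complex.Im l).

Definition pd j F : V -> C := fun x =>
  'D_(ev j) (fun y => complex.Re (F y)) x +i*
  'D_(ev j) (fun y => complex.Im (F y)) x.

Definition ccont F x :=
  {for x, continuous (fun y => complex.Re (F y))} /\
  {for x, continuous (fun y => complex.Im (F y))}.

Lemma cdrv_pd j F x l : cdrv j F x l -> pd j F x = l.
Proof. by move=> [[_ h1] [_ h2]]; rewrite /pd h1 h2; case: l {h1 h2}. Qed.

Lemma cdrv_ex j F x l : cdrv j F x l -> cdrv j F x (pd j F x).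
Proof. by move=> h; rewrite (cdrv_pd h). Qed.

Lemma cdrv_dist j F x l : cdrv j F x l <->
  forall e : R, 0 < e -> exists2 d : R, 0 < d &
    forall t : R, `|t| < d -> cmod (F (x + t *: ev j) - F x - t%:C * l) <= e * `|t|.
Proof.
split=> [[/derive_dist h1 /derive_dist h2] e e0|H].
  have e2 : 0 < e / 2 by lra.
  have [d1 d10 hd1] := h1 _ e2; have [d2 d20 hd2] := h2 _ e2.
  exists (Num.min d1 d2); first by rewrite lt_min d10.
  move=> t; rewrite lt_min => /andP[/hd1 + /hd2].
  set z := _ - t%:C * l => H1 H2; apply: (le_trans (cmod_le _)).
  have -> : complex.Re z = complex.Re (F (x + t *: ev j)) - complex.Re (F x) - t * complex.Re l.
    by rewrite /z !(ReD, ReN, ReM) /= mul0r subr0.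
  have -> : complex.Im z = complex.Im (F (x + t *: ev j)) - complex.Im (F x) - t * complex.Im l.
    by rewrite /z !(ImD, ImN, ImM) /= mul0r addr0.
  lra.
split; apply/derive_dist => e /H[d d0 hd]; exists d => // t /hd.
- set z := _ - t%:C * l => H1.
  have <- : complex.Re z = complex.Re (F (x + t *: ev j)) - complex.Re (F x) - t * complex.Re l.
    by rewrite /z !(ReD, ReN, ReM) /= mul0r subr0.
  by apply: le_trans H1; exact: cmod_Re.
- set z := _ - t%:C * l => H1.
  have <- : complex.Im z = complex.Im (F (x + t *: ev j)) - complex.Im (F x) - t * complex.Im l.
    by rewrite /z !(ImD, ImN, ImM) /= mul0r addr0.
  by apply: le_trans H1; exact: cmod_Im.
Qed.

Lemma ccont_dist F x : ccont F x <->
  forall e : R, 0 < e -> exists2 d : R, 0 < d &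
    forall y, `|y - x| < d -> cmod (F y - F x) < e.
Proof.
split=> [[h1 h2] e e0|H].
  have e2 : 0 < e / 2 by lra.
  have /cvgrPdist_lt/(_ _ e2)/nbhs_ballP[d1 /= d10 hd1] := h1.
  have /cvgrPdist_lt/(_ _ e2)/nbhs_ballP[d2 /= d20 hd2] := h2.
  exists (Num.min d1 d2); first by rewrite lt_min d10.
  move=> y; rewrite lt_min => /andP[y1 y2].
  have {}hd1 : `|complex.Re (F x) - complex.Re (F y)| < e / 2.
    by apply: hd1; rewrite -ball_normE /ball_ /= distrC.
  have {}hd2 : `|complex.Im (F x) - complex.Im (F y)| < e / 2.
    by apply: hd2; rewrite -ball_normE /ball_ /= distrC.
  apply: (le_lt_trans (cmod_le _)); rewrite ReD ImD ReN ImN.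
  by rewrite distrC (distrC (complex.Im (F y))); lra.
have ball_hd (e d : R) (P : V -> Prop) : 0 < d -> (forall y, `|y - x| < d -> P y) ->
    \forall y \near x, P y.
  move=> d0 hP; apply/nbhs_ballP; exists d => //= y.
  by rewrite -ball_normE /ball_ /= distrC; exact: hP.
split.
- suff : complex.Re (F y) @[y --> x] --> complex.Re (F x) by [].
  apply/cvgrPdist_lt => [|e /H[d d0 hd]]; first exact: (nbhs_filter x).
  apply: (ball_hd e d) => // y /hd.
  apply: le_lt_trans; rewrite distrC.
  by have := cmod_Re (F y - F x); rewrite ReD ReN.
- suff : complex.Im (F y) @[y --> x] --> complex.Im (F x) by [].
  apply/cvgrPdist_lt => [|e /H[d d0 hd]]; first exact: (nbhs_filter x).
  apply: (ball_hd e d) => // y /hd.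
  apply: le_lt_trans; rewrite distrC.
  by have := cmod_Im (F y - F x); rewrite ImD ImN.
Qed.

Lemma cdrv_cst j x l : cdrv j (fun=> l) x 0.
Proof. by split; exact: is_derive_cst. Qed.

Lemma cdrvD j F G x l m : cdrv j F x l -> cdrv j G x m ->
  cdrv j (fun y => F y + G y) x (l + m).
Proof.
move=> [F1 F2] [G1 G2]; split.
- rewrite ReD; under eq_fun do rewrite ReD; exact: is_deriveD.
- rewrite ImD; under eq_fun do rewrite ImD; exact: is_deriveD.
Qed.

Lemma cdrvM j F G x l m : cdrv j F x l -> cdrv j G x m ->
  cdrv j (fun y => F y * G y) x (l * G x + F x * m).
Proof.
move=> [F1 F2] [G1 G2]; split.
- apply: is_derive_ext (is_deriveB (is_deriveM F1 G1) (is_deriveM F2 G2)) _ _.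
    by apply/funext => y; rewrite ReM.
  by rewrite ReD !ReM /GRing.scale /=; ring.
- apply: is_derive_ext (is_deriveD (is_deriveM F1 G2) (is_deriveM F2 G1)) _ _.
    by apply/funext => y; rewrite ImM.
  by rewrite ImD !ImM /GRing.scale /=; ring.
Qed.

Lemma cdrvZ j F x l m : cdrv j F x l -> cdrv j (fun y => m * F y) x (m * l).
Proof.
move=> /(cdrvM (cdrv_cst j x m)); by rewrite mul0r add0r.
Qed.

Lemma cdrvN j F x l : cdrv j F x l -> cdrv j (fun y => - F y) x (- l).
Proof.
move=> /(cdrvZ (-1)); rewrite mulN1r.
by under [X in cdrv j X]eq_fun do rewrite mulN1r.
Qed.

Lemma cdrvB j F G x l m : cdrv j F x l -> cdrv j G x m ->
  cdrv j (fun y => F y - G y) x (l - m).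
Proof. by move=> Fl /cdrvN; exact: cdrvD. Qed.

Lemma cdrvJ j F x l : cdrv j F x l -> cdrv j (fun y => (F y)^*%C) x l^*%C.
Proof.
move=> [F1 F2]; split.
- apply: is_derive_ext F1 _ _; last by rewrite ReJ.
  by apply/funext => y; rewrite ReJ.
- apply: is_derive_ext (is_deriveN F2) _ _; last by rewrite ImJ.
  by apply/funext => y; rewrite ImJ.
Qed.

Lemma cdrv_near j F G x l : (\forall y \near x, F y = G y) ->
  cdrv j F x l -> cdrv j G x l.
Proof.
move=> FG /cdrv_dist Fl; apply/cdrv_dist => e e0.
have [d d0 hd] := Fl _ e0.
have /nbhs_ballP[r /= r0 hr] := FG.
have e1 : 0 < `|ev j| + 1 by have := normr_ge0 (ev j); lra.
exists (Num.min d (r / (`|ev j| + 1))); first by rewrite lt_min d0 divr_gt0.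
move=> t; rewrite lt_min ltr_pdivlMr// => /andP[td tr].
rewrite -!hr; first exact: hd.
- exact: ballxx.
- rewrite -ball_normE /ball_ /= opprD addNKr normrN normrZ.
  have := normr_ge0 t; nra.
Qed.

Lemma cdrv_shift j F x w l : cdrv j F (x + w) l -> cdrv j (fun y => F (y + w)) x l.
Proof.
move=> /cdrv_dist Fl; apply/cdrv_dist => e /Fl[d d0 hd]; exists d => // t /hd.
by rewrite (addrAC x w).
Qed.

Lemma cdrv_line j F x (r : R) l : cdrv j F (x + r *: ev j) l ->
  is_derive r (1 : R) (fun t => complex.Re (F (x + t *: ev j))) (complex.Re l) /\
  is_derive r (1 : R) (fun t => complex.Im (F (x + t *: ev j))) (complex.Im l).
Proof. by move=> [/is_derive_line h1 /is_derive_line h2]. Qed.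

Lemma ccont_cst l x : ccont (fun=> l) x.
Proof. by split; exact: cst_continuous. Qed.

Lemma for_cont_ext (f g : V -> R) x : f =1 g ->
  {for x, continuous f} -> {for x, continuous g}.
Proof. by move=> /funext ->. Qed.

Lemma ccontD F G x : ccont F x -> ccont G x -> ccont (fun y => F y + G y) x.
Proof.
move=> [F1 F2] [G1 G2]; split.
- by apply: for_cont_ext (continuousD F1 G1) => y; rewrite ReD.
- by apply: for_cont_ext (continuousD F2 G2) => y; rewrite ImD.
Qed.

Lemma ccontM F G x : ccont F x -> ccont G x -> ccont (fun y => F y * G y) x.
Proof.
move=> [F1 F2] [G1 G2]; split.
- apply: for_cont_ext (continuousB (continuousM F1 G1) (continuousM F2 G2)) => y.
  by rewrite ReM.
- apply: for_cont_ext (continuousD (continuousM F1 G2) (continuousM F2 G1)) => y.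
  by rewrite ImM.
Qed.

Lemma ccontJ F x : ccont F x -> ccont (fun y => (F y)^*%C) x.
Proof.
move=> [F1 F2]; split.
- by apply: for_cont_ext F1 => y; rewrite ReJ.
- by apply: for_cont_ext (continuousN F2) => y; rewrite ImJ.
Qed.

Lemma ccont_near F G x : (\forall y \near x, F y = G y) -> ccont F x -> ccont G x.
Proof.
move=> FG /ccont_dist Fl; apply/ccont_dist => e e0.
have [d d0 hd] := Fl _ e0; have /nbhs_ballP[r /= r0 hr] := FG.
exists (Num.min d r); first by rewrite lt_min d0.
move=> y; rewrite lt_min => /andP[yd yr]; rewrite -!hr; first exact: hd.
- exact: ballxx.
- by rewrite -ball_normE /ball_ /= distrC.
Qed.

Lemma ccont_shift F x w : ccont F (x + w) -> ccont (fun y => F (y + w)) x.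
Proof.
move=> /ccont_dist Fc; apply/ccont_dist => e /Fc[d d0 hd]; exists d => // y yx.
by apply: hd; rewrite opprD addrACA subrr addr0.
Qed.

(** The class C^k, by recursion on partial derivatives: closure properties then go by
   induction on [k], for all functions at once. *)
Fixpoint ck U (k : nat) F : Prop :=
  (forall x, U x -> ccont F x) /\
  if k is k'.+1 then
    forall j, (forall x, U x -> exists l, cdrv j F x l) /\ ck U k' (pd j F)
  else True.

Lemma ck_cont U k F : ck U k F -> forall x, U x -> ccont F x.
Proof. by case: k => [|k] []. Qed.

Lemma ck_drv U k F j x : ck U k.+1 F -> U x -> cdrv j F x (pd j F x).
Proof. by move=> [_ /(_ j)[h _]] /h[l]; exact: cdrv_ex. Qed.

Lemma ck_pd U k F j : ck U k.+1 F -> ck U k (pd j F).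
Proof. by move=> [_ /(_ j)[]]. Qed.

Lemma ckW U k F : ck U k.+1 F -> ck U k F.
Proof.
elim: k F => [|k IH] F [h1 h2]; split => // j.
by have [h3 h4] := h2 j; split => //; apply: IH.
Qed.

Variable U : set V.
Hypothesis Uo : open U.

Lemma open_near x (P : V -> Prop) : U x -> (forall y, U y -> P y) ->
  \forall y \near x, P y.
Proof. by move=> Ux h; apply: filterS h _; exact: open_nbhs_nbhs. Qed.

Lemma ck_ext k F G : (forall x, U x -> F x = G x) -> ck U k F -> ck U k G.
Proof.
elim: k F G => [|k IH] F G FG [h1 h2]; split => //.
- by move=> x Ux; apply: ccont_near (h1 x Ux); exact: open_near.
- by move=> x Ux; apply: ccont_near (h1 x Ux); exact: open_near.
move=> j; have [h3 h4] := h2 j.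
have h5 x : U x -> exists l, cdrv j G x l.
  by move=> Ux; have [l hl] := h3 x Ux; exists l; apply: cdrv_near hl; exact: open_near.
split => //; apply: (IH (pd j F)) => // x Ux; have [l hl] := h3 x Ux.
rewrite (cdrv_pd hl); apply/esym/cdrv_pd; apply: cdrv_near hl; exact: open_near.
Qed.

Lemma ck_intro k F : (forall x, U x -> ccont F x) ->
  (forall j, exists F', (forall x, U x -> cdrv j F x (F' x)) /\ ck U k F') ->
  ck U k.+1 F.
Proof.
move=> h1 h2; split => // j; have [F' [h3 h4]] := h2 j; split.
  by move=> x /h3; exists (F' x).
by apply: ck_ext h4 => x /h3 /cdrv_pd.
Qed.

Lemma ck_cst k l : ck U k (fun=> l).
Proof.
elim: k l => [|k IH] l; first by split => // *; exact: ccont_cst.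
apply: ck_intro => [*|j]; first exact: ccont_cst.
by exists (fun=> 0); split => // x _; exact: cdrv_cst.
Qed.

Lemma ckD k F G : ck U k F -> ck U k G -> ck U k (fun y => F y + G y).
Proof.
elim: k F G => [|k IH] F G Fk Gk; have Fc := ck_cont Fk; have Gc := ck_cont Gk.
  by split => // x Ux; apply: ccontD; auto.
apply: ck_intro => [x Ux|j]; first by apply: ccontD; auto.
exists (fun y => pd j F y + pd j G y); split.
  by move=> x Ux; exact: cdrvD (ck_drv j Fk Ux) (ck_drv j Gk Ux).
by apply: IH; exact: ck_pd.
Qed.

Lemma ckM k F G : ck U k F -> ck U k G -> ck U k (fun y => F y * G y).
Proof.
elim: k F G => [|k IH] F G Fk Gk; have Fc := ck_cont Fk; have Gc := ck_cont Gk.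
  by split => // x Ux; apply: ccontM; auto.
apply: ck_intro => [x Ux|j]; first by apply: ccontM; auto.
exists (fun y => pd j F y * G y + F y * pd j G y); split.
  by move=> x Ux; exact: cdrvM (ck_drv j Fk Ux) (ck_drv j Gk Ux).
by apply: ckD; apply: IH; [exact: ck_pd|exact: ckW|exact: ckW|exact: ck_pd].
Qed.

Lemma ckZ k l F : ck U k F -> ck U k (fun y => l * F y).
Proof. by move=> ?; apply: ckM => //; exact: ck_cst. Qed.

Lemma ckN k F : ck U k F -> ck U k (fun y => - F y).
Proof.
move=> /(ckZ (-1)); apply: ck_ext => x _; exact: mulN1r.
Qed.

Lemma ckJ k F : ck U k F -> ck U k (fun y => (F y)^*%C).
Proof.
elim: k F => [|k IH] F Fk; have Fc := ck_cont Fk.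
  by split => // x Ux; apply: ccontJ; auto.
apply: ck_intro => [x Ux|j]; first by apply: ccontJ; auto.
exists (fun y => (pd j F y)^*%C); split.
  by move=> x Ux; exact: cdrvJ (ck_drv j Fk Ux).
by apply: IH; exact: ck_pd.
Qed.

Lemma ck_prod k (I : Type) (r : seq I) (F : I -> V -> C) :
  (forall i, ck U k (F i)) -> ck U k (fun y => \prod_(i <- r) F i y).
Proof.
move=> h; elim: r => [|i r IH].
  by apply: ck_ext (ck_cst k 1) => x _; rewrite big_nil.
by apply: ck_ext (ckM (h i) IH) => x _; rewrite big_cons.
Qed.

Definition smooth F := forall k, ck U k F.

Lemma smooth_pd j F : smooth F -> smooth (pd j F).
Proof. by move=> h k; exact: ck_pd (h k.+1). Qed.

Lemma smooth_drv j F x : smooth F -> U x -> cdrv j F x (pd j F x).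
Proof. by move=> h; exact: ck_drv (h 1%N). Qed.

Lemma smooth_cont F x : smooth F -> U x -> ccont F x.
Proof. by move=> h; exact: ck_cont (h 0%N) _. Qed.

Lemma smoothZ l F : smooth F -> smooth (fun y => l * F y).
Proof. by move=> h k; exact: ckZ. Qed.

Lemma pderivE j F : pderiv j F = (fun x => (0 -i* 1) * pd j F x).
Proof. by []. Qed.

Lemma smooth_onP F : smooth_on U F <-> smooth F.
Proof.
split.
  move=> Fs k; elim: k F Fs => [|k IH] F Fs.
    by split => // x Ux; have [h1 h2 _] := Fs [::] x Ux.
  split; first by move=> x Ux; have [h1 h2 _] := Fs [::] x Ux.
  move=> j; split.
    move=> x Ux; have [_ _ /(_ j)[h1 h2]] := Fs [::] x Ux.
    by exists (pd j F x); split; exact: derivableP.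
  have : ck U k (pderiv j F).
    by apply: IH => w x Ux; have := Fs (rcons w j) x Ux; rewrite /pderivs foldr_rcons.
  move=> /(ckZ (0 +i* 1)); apply: ck_ext => x _.
  by rewrite pderivE; apply: cext; rewrite !(ReM, ImM) /=; ring.
move=> Fs w; elim/last_ind: w F Fs => [|w j IH] F Fs x Ux.
  have [h1 h2] := smooth_cont Fs Ux; split => //= j.
  by have [[d1 _] [d2 _]] := smooth_drv j Fs Ux; split.
rewrite /pderivs foldr_rcons; apply: IH Ux.
by rewrite pderivE; apply: smoothZ; exact: smooth_pd.
Qed.

Definition pds (w : seq 'I_n) F : V -> C := foldr pd F w.

Lemma smooth_pds w F : smooth F -> smooth (pds w F).
Proof. by elim: w => //= j w IH h; apply/smooth_pd/IH. Qed.

Lemma pd_ext j F G x : (forall y, U y -> F y = G y) -> U x ->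
  pd j F x = pd j G x.
Proof.
move=> FG Ux; have e1 : \forall y \near x, F y = G y by exact: open_near.
rewrite /pd; congr (_ +i* _); apply: near_eq_derive;
  by near=> y; congr (complex.Re _) || congr (complex.Im _); near: y.
Unshelve. all: by end_near. Qed.

Lemma pds_ext w F G x : (forall y, U y -> F y = G y) -> U x ->
  pds w F x = pds w G x.
Proof. by move=> FG; elim: w x => [|j w IH] x Ux /=; [exact: FG|exact: pd_ext]. Qed.

Lemma pderivs_pds w F x : smooth F -> U x ->
  pderivs w F x = (0 -i* 1) ^+ size w * pds w F x.
Proof.
move=> Fs; elim: w x => [|j w IH] x Ux /=; first by rewrite expr0 mul1r.
rewrite pderivE (pd_ext j IH Ux).
rewrite (cdrv_pd (cdrvZ _ (smooth_drv j (smooth_pds w Fs) Ux))).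
by rewrite exprS mulrA.
Qed.

Lemma cmod_pderivs w F x : smooth F -> U x -> cmod (pderivs w F x) = cmod (pds w F x).
Proof.
move=> Fs Ux; rewrite pderivs_pds// cmodM.
suff -> : cmod ((0 -i* 1 : C) ^+ size w) = 1 by rewrite mul1r.
elim: (size w) => [|k IH]; first by rewrite expr0 cmod1.
rewrite exprS cmodM IH mulr1 /cmod /=.
by rewrite expr0n /= add0r sqrrN expr1n sqrtr1.
Qed.

End partial.

(** * Mean value estimates *)

Section mean_value.
Context {R : realType}.

Lemma mvt_sym (f f' : R -> R) (r : R) :
  (forall x : R, `|x| < r -> is_derive x (1 : R) f (f' x)) ->
  forall t : R, `|t| < r ->
  exists c, `|c| <= `|t| /\ f t - f 0 = f' c * t.
Proof.
move=> df t tr.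
have seg (a b : R) : a < b -> `|a| < r -> `|b| < r ->
    exists2 c, c \in `]a, b[ & f b - f a = f' c * (b - a).
  move=> ab ar br.
  have inr (x : R) : x \in `[a, b] -> `|x| < r.
    rewrite in_itv /= => /andP[ax xb]; rewrite ltr_norml.
    move: ar br; rewrite !ltr_norml => /andP[? ?] /andP[? ?]; apply/andP; split; lra.
  apply: MVT => //.
    by move=> x /subset_itv_oo_cc /inr; exact: df.
  apply: derivable_within_continuous => x /inr xr.
  by have [] := df x xr.
have r0 : `|0 : R| < r by rewrite normr0; apply: le_lt_trans tr.
have [->|t0] := eqVneq t 0; first by exists 0; rewrite subrr mulr0.
have [tp|tn|] := ltgtP 0 t; last by move=> /esym/eqP; rewrite (negbTE t0).
  have [c + ->] := seg 0 t tp r0 tr; rewrite in_itv /= => /andP[c0 ct].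
  by exists c; rewrite subr0 !gtr0_norm// ltW.
have [c + E] := seg t 0 tn tr r0; rewrite in_itv /= => /andP[tc c0].
exists c; split; first by rewrite !ltr0_norm// lerN2 ltW.
by move: E; rewrite sub0r; lra.
Qed.

(** The mean value theorem in each variable in turn expresses the second difference
   as [t * s * f12 c b] at a nearby point. The error is relative to [t * s], with the
   two increments independent of each other: joint limits need this uniformity. *)
Lemma second_difference (f f1 f12 : R -> R -> R) (r : R) : 0 < r ->
  (forall t s : R, `|t| < r -> `|s| < r -> is_derive t (1 : R) (f^~ s) (f1 t s)) ->
  (forall t s : R, `|t| < r -> `|s| < r -> is_derive s (1 : R) (f1 t) (f12 t s)) ->
  (forall e : R, 0 < e -> exists2 d : R, 0 < d &
     forall t s : R, `|t| < d -> `|s| < d -> `|f12 t s - f12 0 0| <= e) ->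
  forall e : R, 0 < e -> exists2 d : R, 0 < d &
    forall t s : R, `|t| < d -> `|s| < d ->
      `|f t s - f t 0 - f 0 s + f 0 0 - t * s * f12 0 0| <= e * (`|t| * `|s|).
Proof.
move=> r0 d1 d2 c12 e e0; have [d d0 hd] := c12 e e0.
exists (Num.min d r); first by rewrite lt_min d0.
move=> t s; rewrite !lt_min => /andP[td tr] /andP[sd sr].
have r00 : `|0 : R| < r by rewrite normr0.
have [|c [ct cE]] := @mvt_sym (fun x => f x s - f x 0) (fun x => f1 x s - f1 x 0) r _ t tr.
  by move=> x xr; apply: is_deriveB; exact: d1.
have cr : `|c| < r by apply: le_lt_trans tr.
have [|b [bs bE]] := @mvt_sym (f1 c) (f12 c) r _ s sr.
  by move=> x xr; exact: d2.
have -> : f t s - f t 0 - f 0 s + f 0 0 - t * s * f12 0 0 =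
   (f12 c b - f12 0 0) * (t * s).
  have -> : f t s - f t 0 - f 0 s + f 0 0 = f t s - f t 0 - (f 0 s - f 0 0) by ring.
  by rewrite cE bE; ring.
rewrite !normrM ler_wpM2r ?mulr_ge0//.
by apply: hd; [apply: le_lt_trans td|apply: le_lt_trans sd].
Qed.

End mean_value.

Section vectors.
Context {R : realType} {n : nat}.
Local Notation C := R[i].
Local Notation V := 'rV[R]_n.
Implicit Types (F G : V -> C) (x y : V) (l m : C) (i j : 'I_n) (U : set V).

Lemma coord_le_norm x i : `|x ord0 i| <= `|x|.
Proof.
rewrite [leRHS](mx_normrE x).
exact: (le_bigmax (0 : R) (fun ij : 'I_1 * 'I_n => `|x ij.1 ij.2|) (ord0, i)).
Qed.

Lemma norm_le x (M : R) : 0 <= M -> (forall i, `|x ord0 i| <= M) -> `|x| <= M.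
Proof.
move=> M0 h; rewrite [leLHS](mx_normrE x); apply: bigmax_le => // -[a i] _ /=.
by rewrite (ord1 a).
Qed.

Lemma norm_ev i : `|ev i : V| = 1.
Proof.
apply/le_anti/andP; split.
  apply: norm_le => // j; rewrite mxE eqxx /=; case: (_ == _) => /=.
    by rewrite normr1.
  by rewrite normr0.
by have := coord_le_norm (ev i) i; rewrite mxE !eqxx normr1.
Qed.

Lemma lipschitz_of_bounded_partials F (M : R) :
  (forall j x, exists l, cdrv j F x l /\ cmod l <= M) ->
  forall x y, cmod (F x - F y) <= 2 * M * n%:R * `|x - y|.
Proof.
move=> dF x y.
have [l' hl'] : exists l' : 'I_n -> V -> C, forall j x, cdrv j F x (l' j x) /\ cmod (l' j x) <= M.
  exists (fun j => pd j F) => j z; have [l [h1 h2]] := dF j z.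
  by rewrite (cdrv_pd h1).
have step j z (t : R) : cmod (F (z + t *: ev j) - F z) <= 2 * M * `|t|.
  have dline (r : R) := cdrv_line (hl' j (z + r *: ev j)).1.
  have [c [_ cE]] := @mvt_sym R _ _ (`|t| + 1) (fun r _ => (dline r).1) t ltac:(lra).
  have [b [_ bE]] := @mvt_sym R _ _ (`|t| + 1) (fun r _ => (dline r).2) t ltac:(lra).
  apply: (le_trans (cmod_le _)); rewrite ReD ReN ImD ImN.
  rewrite scale0r addr0 in cE bE; rewrite cE bE !normrM.
  have := (hl' j (z + c *: ev j)).2; have := (hl' j (z + b *: ev j)).2.
  have := cmod_Re (l' j (z + c *: ev j)); have := cmod_Im (l' j (z + b *: ev j)).
  have := normr_ge0 t; nra.
have path (r : seq 'I_n) (c : 'I_n -> R) z :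
    cmod (F (z + \sum_(j <- r) c j *: ev j) - F z) <= \sum_(j <- r) 2 * M * `|c j|.
  elim: r z => [|j r IH] z; first by rewrite !big_nil addr0 subrr cmod0.
  rewrite !big_cons addrA.
  apply: (le_trans (cmod_tri _ (F (z + c j *: ev j)) _)).
  by rewrite [leLHS]addrC; apply: lerD.
have := path (index_enum 'I_n) (fun j => (x - y) ord0 j) y.
have -> : \sum_(j <- index_enum 'I_n) (x - y) ord0 j *: ev j = x - y.
  exact: (esym (row_sum_delta (x - y))).
rewrite (addrC y) subrK => /le_trans; apply.
have M0 : n = 0%N \/ 0 <= M.
  have [n0|n0] := posnP n; [by left|right].
  by have [l [_ h]] := dF (Ordinal n0) 0; apply: le_trans h; exact: cmod_ge0.
case: M0 => [n0|M0].
  rewrite big1 => [|j _]; last by exfalso; case: j => m; rewrite n0.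
  by rewrite (_ : n%:R = 0 :> R) ?n0// mulr0 mul0r.
have -> : 2 * M * n%:R * `|x - y| = \sum_(j : 'I_n) 2 * M * `|x - y|.
  by rewrite sumr_const card_ord -[RHS]mulr_natr; ring.
by apply: ler_sum => j _; rewrite ler_wpM2l ?mulr_ge0// coord_le_norm.
Qed.

Variable U : set V.
Hypothesis Uo : open U.

Lemma open_box x : U x -> exists2 r : R, 0 < r & forall y, `|y - x| < r -> U y.
Proof.
move=> Ux; have /nbhs_ballP[r /= r0 hr] : nbhs x U by exact: open_nbhs_nbhs.
by exists r => // y yx; apply: hr; rewrite -ball_normE /ball_ /= distrC.
Qed.

Lemma csecond_difference F i j x : smooth U F -> U x ->
  forall e : R, 0 < e -> exists2 d : R, 0 < d &
    forall t s : R, `|t| < d -> `|s| < d ->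
      cmod (F (x + t *: ev i + s *: ev j) - F (x + t *: ev i) - F (x + s *: ev j)
          + F x - (t * s)%:C * pd j (pd i F) x) <= e * (`|t| * `|s|).
Proof.
move=> Fs Ux e e0.
have [r r0 hr] := open_box Ux.
have e2 : 0 < e / 2 by lra.
have inU (t s : R) : `|t| < r / 2 -> `|s| < r / 2 -> U (x + t *: ev i + s *: ev j).
  move=> tr sr; apply: hr; rewrite addrC !addrA addNr add0r.
  apply: (le_lt_trans (ler_normD _ _)); rewrite !normrZ !norm_ev; lra.
have d1 (t s : R) : `|t| < r / 2 -> `|s| < r / 2 ->
    cdrv i F (x + s *: ev j + t *: ev i) (pd i F (x + t *: ev i + s *: ev j)).
  by move=> tr sr; rewrite addrAC; apply: smooth_drv Fs _; exact: inU.
have d2 (t s : R) : `|t| < r / 2 -> `|s| < r / 2 ->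
    cdrv j (pd i F) (x + t *: ev i + s *: ev j) (pd j (pd i F) (x + t *: ev i + s *: ev j)).
  by move=> tr sr; apply: smooth_drv (smooth_pd i Fs) _; exact: inU.
have x00 : x + 0 *: ev i + 0 *: ev j = x by rewrite !scale0r !addr0.
have /ccont_dist cc : ccont (pd j (pd i F)) x.
  by apply: smooth_cont Ux; do 2 apply: smooth_pd.
have cc' (e' : R) : 0 < e' -> exists2 d : R, 0 < d & forall t s : R,
    `|t| < d -> `|s| < d -> cmod (pd j (pd i F) (x + t *: ev i + s *: ev j)
       - pd j (pd i F) (x + 0 *: ev i + 0 *: ev j)) <= e'.
  move=> /cc[d d0 hd]; exists (d / 2); first lra.
  move=> t s td sd; rewrite x00; apply/ltW/hd.
  rewrite addrC !addrA addNr add0r.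
  apply: (le_lt_trans (ler_normD _ _)); rewrite !normrZ !norm_ev; lra.
have [|||da da0 hda] := @second_difference R
    (fun t s => complex.Re (F (x + t *: ev i + s *: ev j)))
    (fun t s => complex.Re (pd i F (x + t *: ev i + s *: ev j)))
    (fun t s => complex.Re (pd j (pd i F) (x + t *: ev i + s *: ev j)))
    (r / 2) ltac:(lra) _ _ _ _ e2.
- move=> t s tr sr; have [h _] := cdrv_line (d1 t s tr sr).
  by apply: is_derive_ext h _ _ => //; apply/funext => t'; rewrite addrAC.
- move=> t s tr sr; exact: (cdrv_line (d2 t s tr sr)).1.
- move=> e' /cc'[d d0 hd]; exists d => // t s td sd.
  by apply: le_trans (hd t s td sd); rewrite -ReN -ReD; exact: cmod_Re.
have [|||db db0 hdb] := @second_difference R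
    (fun t s => complex.Im (F (x + t *: ev i + s *: ev j)))
    (fun t s => complex.Im (pd i F (x + t *: ev i + s *: ev j)))
    (fun t s => complex.Im (pd j (pd i F) (x + t *: ev i + s *: ev j)))
    (r / 2) ltac:(lra) _ _ _ _ e2.
- move=> t s tr sr; have [_ h] := cdrv_line (d1 t s tr sr).
  by apply: is_derive_ext h _ _ => //; apply/funext => t'; rewrite addrAC.
- move=> t s tr sr; exact: (cdrv_line (d2 t s tr sr)).2.
- move=> e' /cc'[d d0 hd]; exists d => // t s td sd.
  by apply: le_trans (hd t s td sd); rewrite -ImN -ImD; exact: cmod_Im.
exists (Num.min da db); first by rewrite lt_min da0.
move=> t s; rewrite !lt_min => /andP[ta tb] /andP[sa sb].
have := hda t s ta sa; have := hdb t s tb sb.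
rewrite !(scale0r, addr0).
move: (pd j (pd i F) x) => P h1 h2.
apply: (le_trans (cmod_le _)); rewrite !(ReD, ReN, ImD, ImN, ReM, ImM, ReR, ImR).
rewrite !mul0r subr0 addr0; set p := e * _.
have -> : p = e / 2 * (`|t| * `|s|) + e / 2 * (`|t| * `|s|) by rewrite /p; field.
by rewrite addrC; apply: lerD.
Qed.

(** Both mixed derivatives are the limit of the same second difference quotient. *)
Lemma pd_comm F i j x : smooth U F -> U x -> pd j (pd i F) x = pd i (pd j F) x.
Proof.
move=> Fs Ux; apply/eqP; rewrite -subr_eq0; apply/eqP/cmod_eq0/le_anti.
rewrite cmod_ge0 andbT; apply: le_epsilon => e e0; rewrite add0r.
have e2 : 0 < e / 2 by lra.
have [d1 d10 h1] := csecond_difference i j Fs Ux e2.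
have [d2 d20 h2] := csecond_difference j i Fs Ux e2.
pose t : R := Num.min d1 d2 / 2.
have t0 : 0 < t by rewrite divr_gt0// lt_min d10.
have td : t < Num.min d1 d2 by rewrite /t; move: t0; rewrite /t; lra.
have := td; rewrite lt_min => /andP[t1 t2].
have {}h1 := h1 t t; have {}h2 := h2 t t.
rewrite (gtr0_norm t0) in h1 h2; have := h1 t1 t1; have := h2 t2 t2.
rewrite (addrAC x (t *: ev j)).
move: (F _) (F _) (F _) (F _) (pd i _ _) (pd j _ _) => a1 a2 a3 a4 P Q h3 h4.
set z1 := _ - _ * P in h3; set z2 := _ - _ * Q in h4.
have : cmod (z1 - z2) <= e * (t * t).
  apply: (le_trans (cmodB _ _)).
  have -> : e * (t * t) = e / 2 * (t * t) + e / 2 * (t * t) by field.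
  exact: lerD.
have -> : z1 - z2 = (t * t)%:C * (Q - P) by rewrite /z1 /z2; ring.
have tt0 : 0 < t * t by exact: mulr_gt0.
by rewrite cmodM cmodR (gtr0_norm tt0) [leRHS]mulrC (ler_pM2l tt0).
Qed.

Lemma pds_move F j (u v : seq 'I_n) x : smooth U F -> U x ->
  pds (u ++ j :: v) F x = pds (j :: u ++ v) F x.
Proof.
move=> Fs; elim: u x => // i u IH x Ux /=.
rewrite (pd_ext Uo i (G := pds (j :: u ++ v) F) IH Ux) /=.
by apply: pd_comm Ux; exact: smooth_pds.
Qed.

(** Words of directions matter only up to permutation: this is Schwarz's theorem,
   applied to adjacent letters. *)
Lemma pds_perm F (u v : seq 'I_n) x : smooth U F -> perm_eq u v -> U x ->
  pds u F x = pds v F x.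
Proof.
move=> Fs; elim: u v x => [|j u IH] v x.
  by rewrite perm_sym => /perm_nilP ->.
move=> uv Ux.
have jv : j \in v by rewrite -(perm_mem uv) mem_head.
have [v1 [v2 vE]] : exists v1 v2, v = v1 ++ j :: v2.
  by case/splitPr: jv => v1 v2; exists v1, v2.
rewrite vE pds_move//= in uv *.
apply: (pd_ext Uo _ _ Ux) => y Uy; apply: IH => //.
by move: uv; rewrite -[j :: v2]cat1s perm_sym perm_catCA perm_cons perm_sym.
Qed.

End vectors.

(** * The symplectic form *)

Section symplectic_form.
Context {R : realType} {d : nat}.
Local Notation C := R[i].
Local Notation V := 'rV[R]_(d + d).
Implicit Types (X Y Z : V) (t : R) (l j : 'I_(d + d)).

Lemma dotDl (x y z : 'rV[R]_d) : dot (x + y) z = dot x z + dot y z.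
Proof. by rewrite /dot -big_split; apply: eq_bigr => i _; rewrite mxE mulrDl. Qed.
Lemma dotC (x y : 'rV[R]_d) : dot x y = dot y x.
Proof. by apply: eq_bigr => i _; rewrite mulrC. Qed.
Lemma dotZl t (x y : 'rV[R]_d) : dot (t *: x) y = t * dot x y.
Proof. by rewrite /dot mulr_sumr; apply: eq_bigr => i _; rewrite mxE mulrA. Qed.

Lemma sympC X Y : symplectic X Y = - symplectic Y X.
Proof. by rewrite /symplectic; ring. Qed.
Lemma sympDl X Y Z : symplectic (X + Y) Z = symplectic X Z + symplectic Y Z.
Proof.
by rewrite /symplectic !linearD /= !(dotC _ (_ + _)) !dotDl !(dotC (lsubmx _)); ring.
Qed.
Lemma sympZl t X Y : symplectic (t *: X) Y = t * symplectic X Y.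
Proof.
by rewrite /symplectic !linearZ /= !(dotC _ (_ *: _)) !dotZl !(dotC (lsubmx _)); ring.
Qed.
Lemma sympDr X Y Z : symplectic Z (X + Y) = symplectic Z X + symplectic Z Y.
Proof. by rewrite sympC sympDl (sympC X) (sympC Y); ring. Qed.
Lemma sympZr t X Y : symplectic X (t *: Y) = t * symplectic X Y.
Proof. by rewrite sympC sympZl (sympC Y); ring. Qed.
Lemma sympNl X Y : symplectic (- X) Y = - symplectic X Y.
Proof. by rewrite -scaleN1r sympZl mulN1r. Qed.
Lemma sympNr X Y : symplectic X (- Y) = - symplectic X Y.
Proof. by rewrite -scaleN1r sympZr mulN1r. Qed.
Lemma sympxx X : symplectic X X = 0.
Proof. by have := sympC X X; lra. Qed.

Definition sympE := (sympDl, sympDr, sympNl, sympNr, sympZl, sympZr).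

Lemma symp_bound X Y : `|symplectic X Y| <= 2 * d%:R * `|X| * `|Y|.
Proof.
have db (x y : 'rV[R]_d) a b : (forall i, `|x ord0 i| <= a) ->
    (forall i, `|y ord0 i| <= b) -> `|dot x y| <= d%:R * (a * b).
  move=> xa yb; apply: le_trans (ler_norm_sum _ _ _) _.
  have -> : d%:R * (a * b) = \sum_(i : 'I_d) a * b.
    by rewrite sumr_const card_ord mulr_natl.
  by apply: ler_sum => i _; rewrite normrM ler_pM.
have l1 Z i : `|lsubmx Z ord0 i| <= `|Z| by rewrite mxE coord_le_norm.
have l2 Z i : `|rsubmx Z ord0 i| <= `|Z| by rewrite mxE coord_le_norm.
apply: (le_trans (ler_normB _ _)).
have := db _ _ _ _ (l1 Y) (l2 X); have := db _ _ _ _ (l1 X) (l2 Y).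
nra.
Qed.

Lemma dot_delta (x : 'rV[R]_d) k : dot x (delta_mx 0 k) = x ord0 k.
Proof.
rewrite /dot (bigD1 k)//= mxE !eqxx mulr1 big1 ?addr0// => i ik.
by rewrite mxE (negbTE ik) andbF mulr0.
Qed.

Lemma symp_evl X (k : 'I_d) : symplectic X (ev (lshift d k)) = X ord0 (rshift d k).
Proof.
rewrite /symplectic.
have -> : lsubmx (ev (lshift d k)) = delta_mx 0 k :> 'rV[R]_d.
  by apply/rowP => i; rewrite !mxE eq_lshift.
have -> : rsubmx (ev (lshift d k)) = 0 :> 'rV[R]_d.
  by apply/rowP => i; rewrite !mxE eq_rlshift andbF.
rewrite (dotC (delta_mx _ _)) dot_delta mxE /dot big1 ?subr0// => i _.
by rewrite !mxE mulr0.
Qed.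

Lemma symp_evr X (k : 'I_d) : symplectic X (ev (rshift d k)) = - X ord0 (lshift d k).
Proof.
rewrite /symplectic.
have -> : rsubmx (ev (rshift d k)) = delta_mx 0 k :> 'rV[R]_d.
  by apply/rowP => i; rewrite !mxE eq_rshift.
have -> : lsubmx (ev (rshift d k)) = 0 :> 'rV[R]_d.
  by apply/rowP => i; rewrite !mxE eq_lrshift andbF.
rewrite dot_delta mxE /dot big1 ?sub0r// => i _.
by rewrite !mxE mul0r.
Qed.

(** The symplectic form with a basis vector is, up to sign, the coordinate with the
   conjugate index. *)
Definition partner l : 'I_(d + d) :=
  match fintype.split l with inl k => rshift d k | inr k => lshift d k end.

Lemma symp_partner X l : `|symplectic X (ev (partner l))| = `|X ord0 l|.
Proof.
rewrite /partner; case: fintype.splitP => k lk.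
  by rewrite symp_evr normrN; congr (`|X _ _|); apply: val_inj; rewrite /= lk.
by rewrite symp_evl; congr (`|X _ _|); apply: val_inj; rewrite /= lk.
Qed.

(** The linear form by which a twisted derivative differs from an ordinary one: the
   derivative of [Y |-> expi (2 * symplectic X Y)] at the origin in the direction
   [l]. *)
Definition ell l X : C := 0 +i* (2 * symplectic X (ev l)).

Lemma ellD l X Y : ell l (X + Y) = ell l X + ell l Y.
Proof. by apply: cext; rewrite ?ReD ?ImD /= ?addr0// sympDl; ring. Qed.
Lemma ellZ l t X : ell l (t *: X) = t%:C * ell l X.
Proof. by apply: cext; rewrite ?ReM ?ImM /= ?sympZl; ring. Qed.
Lemma ell0 l : ell l 0 = 0.
Proof. by have := ellZ l 0 0; rewrite scale0r mul0r. Qed.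

Lemma cdrv_ell j l X : cdrv j (ell l) X (ell l (ev j)).
Proof.
apply/cdrv_dist => e e0; exists 1 => // t _.
by rewrite ellD ellZ (addrC (ell l X)) addrK subrr cmod0 mulr_ge0// ltW.
Qed.

Lemma cmod_ell l X : cmod (ell l X) = 2 * `|symplectic X (ev l)|.
Proof.
rewrite /cmod /= expr0n /= add0r sqrtr_sqr normrM gtr0_norm//.
Qed.

Lemma cmod_ell_ev j l : cmod (ell l (ev j)) <= 4 * d%:R.
Proof.
rewrite cmod_ell; have := symp_bound (ev j) (ev l); rewrite !norm_ev; lra.
Qed.

Lemma ccont_of_bounded_partials n (F : 'rV[R]_n -> C) (M : R) :
  (forall (j : 'I_n) x, exists m, cdrv j F x m /\ cmod m <= M) -> forall x, ccont F x.
Proof.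
move=> dF x; apply/ccont_dist => e e0.
pose k : R := `|2 * M * n%:R| + 1.
have k0 : 0 < k by rewrite ltr_wpDl.
exists (e / k); first by rewrite divr_gt0.
move=> y; rewrite ltr_pdivlMr// => yx.
apply: le_lt_trans (lipschitz_of_bounded_partials dF y x) _.
apply: le_lt_trans yx; rewrite mulrC ler_wpM2l//.
by apply: (le_trans (ler_norm _)); rewrite /k; lra.
Qed.

Lemma ck_ell (U : set V) k l : open U -> ck U k (ell l).
Proof.
move=> Uo.
have ce X : ccont (ell l) X.
  apply: (@ccont_of_bounded_partials _ _ (4 * d%:R)) => j Y.
  by exists (ell l (ev j)); split; [exact: cdrv_ell|exact: cmod_ell_ev].
case: k => [|k]; first by split.
apply: ck_intro => // j; exists (fun=> ell l (ev j)); split.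
  by move=> X _; exact: cdrv_ell.
exact: ck_cst.
Qed.

End symplectic_form.

(** * Small increments *)

Section increments.
Context {R : realType}.
Local Notation C := R[i].

Lemma cmod_expiB1 (u : R) : cmod (expi u - 1) <= 2 * `|u|.
Proof.
have [c [_ cE]] := @mvt_sym R cos (fun x => - sin x) (`|u| + 1)
  (fun x _ => is_derive_cos x) u ltac:(lra).
have [b [_ bE]] := @mvt_sym R sin cos (`|u| + 1)
  (fun x _ => is_derive_sin x) u ltac:(lra).
apply: (le_trans (cmod_le _)); rewrite ReD ImD ReN ImN /= oppr0 addr0.
rewrite cos0 in cE; rewrite sin0 subr0 in bE; rewrite cE bE !normrM normrN.
have := normr_ge0 u.
have : `|sin c| <= 1 by rewrite ler_norml sin_geN1 sin_le1.
have : `|cos b| <= 1 by rewrite ler_norml cos_geN1 cos_le1.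
nra.
Qed.

Lemma expi_first_order (e : R) : 0 < e -> exists2 d : R, 0 < d &
  forall u : R, `|u| < d -> cmod (expi u - 1 - (0 +i* u)) <= e * `|u|.
Proof.
move=> e0; have e2 : 0 < e / 2 by lra.
have /derive_dist/(_ _ e2)[d1 d10 h1] := is_derive_cos (0 : R).
have /derive_dist/(_ _ e2)[d2 d20 h2] := is_derive_sin (0 : R).
exists (Num.min d1 d2); first by rewrite lt_min d10.
move=> u; rewrite lt_min => /andP[/h1 + /h2].
have -> : 0 + u *: (1 : R) = u by rewrite add0r /GRing.scale /= mulr1.
rewrite cos0 sin0 !(oppr0, mulr0, addr0, mulr1) => k1 k2.
apply: (le_trans (cmod_le _)); rewrite !(ReD, ReN, ImD, ImN) /=.
rewrite !(oppr0, addr0); lra.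
Qed.

Lemma dnbhs0_ball (A : set R) : (0 : R)^' A ->
  exists2 d : R, 0 < d & forall t, `|t| < d -> t != 0 -> A t.
Proof.
rewrite /dnbhs /within /= => /nbhs_ballP[d /= d0 hd].
by exists d => // t td; apply: hd; rewrite /ball /= sub0r normrN.
Qed.

Lemma ball_dnbhs0 (A : set R) (d : R) : 0 < d ->
  (forall t, `|t| < d -> t != 0 -> A t) -> (0 : R)^' A.
Proof.
move=> d0 hA; rewrite /dnbhs /within /=; apply/nbhs_ballP; exists d => //= t.
by rewrite /ball /= sub0r normrN => td; exact: hA.
Qed.

Variable (n : nat).
Local Notation V := 'rV[R]_n.

(** The phase contributes [(0 +i* b) * H Z] to the limit of the twisted quotient; what
   remains is the derivative along [s *: ev j]. No differentiability of [H] is assumed: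
   it is deduced from convergence of the quotient. *)
Lemma twisted_quotient (H : V -> C) (Z : V) (j : 'I_n) (b s : R) (m : C) :
  s = 1 \/ s = -1 ->
  jlim (0 : R)^' (fun t _ : R => (t^-1)%:C *
     (expi (t * b) * H (Z + (s * t) *: ev j) - H Z)) m ->
  cdrv j H Z (s%:C * (m - (0 +i* b) * H Z)).
Proof.
move=> s1 hm; apply/cdrv_dist => e e0.
have ss : s * s = 1 by case: s1 => ->; rewrite ?mulrNN mulr1.
have sn : `|s| = 1 by case: s1 => ->; rewrite ?normrN normr1.
have hp : 0 < cmod (H Z) * (`|b| + 1) + 1.
  have := cmod_ge0 (H Z); have := normr_ge0 b; nra.
have mp : 0 < cmod m * (`|b| + 1) + 1.
  have := cmod_ge0 m; have := normr_ge0 b; nra.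
have e1 : 0 < e / 3 / (cmod (H Z) * (`|b| + 1) + 1) by rewrite !divr_gt0.
have [d1 d10 h1] := expi_first_order e1.
have e3 : 0 < e / 3 by lra.
have [A [/dnbhs0_ball[d2 d20 h2] hA]] := hm _ e3.
have bp : 0 < `|b| + 1 by have := normr_ge0 b; lra.
pose d := Num.min (Num.min (d1 / (`|b| + 1)) d2) (e / 6 / (cmod m * (`|b| + 1) + 1)).
exists d; first by rewrite !lt_min d20 !divr_gt0//; lra.
move=> t0; rewrite !lt_min => /andP[/andP[t1 t2] t3].
have [->|tn0] := eqVneq t0 0.
  by rewrite scale0r addr0 subrr mul0r subrr cmod0 normr0 mulr0.
pose t := s * t0.
have tE : s * t = t0 by rewrite /t mulrA ss mul1r.
have tabs : `|t| = `|t0| by rewrite /t normrM sn mul1r.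
have tne : t != 0 by rewrite -normr_eq0 tabs normr_eq0.
rewrite -tabs in t1 t2 t3 *.
have At : A t by apply: h2.
have {hA} := hA t t At At; rewrite tE.
set q := expi (t * b); set H1 := H (Z + _); set H0 := H Z.
set r := _ - m => rs.
have tC : t%:C * (t^-1)%:C = 1 :> C by rewrite -rmorphM /= divff.
have qE : q * H1 = H0 + t%:C * (m + r).
  have -> : m + r = (t^-1)%:C * (q * H1 - H0) by rewrite /r; ring.
  by rewrite mulrA tC; ring.
have q' : expi (- (t * b)) * q = 1 by rewrite mulrC expiK.
have -> : H1 = expi (- (t * b)) * (H0 + t%:C * (m + r)).
  by rewrite -qE mulrA q' mul1r.
set p := expi (- (t * b)) in q' *.
have tst : t0%:C * (s%:C * (m - 0 +i* b * H0)) = t%:C * (m - 0 +i* b * H0) :> C.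
  have -> : t%:C = s%:C * t0%:C by rewrite /t rmorphM.
  ring.
rewrite tst.
have ib : t%:C * (0 +i* b) = - (0 +i* (- (t * b))) :> C.
  by apply: cext; rewrite ?ReM ?ImM ?ReN ?ImN /=; ring.
have -> : p * (H0 + t%:C * (m + r)) - H0 - t%:C * (m - 0 +i* b * H0) =
   (p - 1 + t%:C * (0 +i* b)) * H0 + t%:C * m * (p - 1) + t%:C * r * p by ring.
rewrite ib.
have u1 : cmod (p - 1 - (0 +i* (- (t * b)))) <= e / 3 / (cmod H0 * (`|b| + 1) + 1) * (`|t| * `|b|).
  have nb : `|- (t * b)| = `|t| * `|b| by rewrite normrN normrM.
  rewrite -nb; apply: h1; rewrite nb.
  apply: le_lt_trans (_ : `|t| * (`|b| + 1) < _); first by rewrite ler_wpM2l//; lra.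
  by rewrite -ltr_pdivlMr.
have u2 : cmod (p - 1) <= 2 * (`|t| * `|b|).
  by apply: le_trans (cmod_expiB1 _) _; rewrite normrN normrM.
have u3 : cmod p = 1 by exact: cmod_expi.
apply: (le_trans (cmodD _ _)); apply: (le_trans (lerD (cmodD _ _) (lexx _))).
rewrite !cmodM !cmodR u3 mulr1.
have tp : 0 < `|t| by rewrite normr_gt0.
have v1 : cmod (p - 1 - (0 +i* (- (t * b)))) * cmod H0 <= e / 3 * `|t|.
  apply: le_trans (ler_wpM2r (cmod_ge0 _) u1) _.
  set D := cmod H0 * _ + 1.
  have -> : e / 3 / D * (`|t| * `|b|) * cmod H0 = e / 3 * `|t| * (`|b| * cmod H0 / D) by ring.
  apply: ler_piMr; first by rewrite mulr_ge0// ltW.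
  rewrite ler_pdivrMr// mul1r /D.
  have := cmod_ge0 H0; nra.
have v2 : `|t| * cmod m * cmod (p - 1) <= e / 3 * `|t|.
  rewrite -mulrA mulrC ler_wpM2r//.
  apply: le_trans (ler_wpM2l (cmod_ge0 _) u2) _.
  have := t3; rewrite ltr_pdivlMr//.
  have := cmod_ge0 m; have := normr_ge0 b; nra.
have v3 : `|t| * cmod r <= e / 3 * `|t| by rewrite mulrC ler_wpM2r// ltW.
lra.
Qed.

End increments.

(** * Twisted positive definite functions *)

Section adjoin_derivatives.
Context {R : realType} {d : nat}.
Local Notation C := R[i].
Local Notation V := 'rV[R]_(d + d).
Local Notation W := (seq 'I_(d + d)).
Implicit Types (F H : V -> C) (X Y Z : V) (l : 'I_(d + d)) (w : W).

(** The kernel of the twisted convolution with [H], with [X] and [Y] exchanged: the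
   twisted analogue of a kernel that depends on [Y - X] only. *)
Definition twist H X Y : C := expi (2 * symplectic Y X) * H (Y - X).

(** If [twist F X Y] is the product of the vectors [X] and [Y], then [LL l F] and
   [RR l F] give its derivatives, with respect to twisted translations, in the first
   and in the second vector. *)
Definition LL l F : V -> C := fun X => ell l X * F X - pd l F X.
Definition RR l F : V -> C := fun X => ell l X * F X + pd l F X.
(** The product of the derivatives along the words [w] and [w'] of two point
   vectors. *)
Definition LRder (g : V -> C) w w' : V -> C := foldr LL (foldr RR g w') w.

Definition Lopt (o : option 'I_(d + d)) F := if o is Some l then LL l F else F.
Definition Ropt (o : option 'I_(d + d)) F := if o is Some l then RR l F else F.

Lemma LRder_nilr (g : V -> C) l w w' : LRder g (l :: w) w' = LL l (LRder g w w').
Proof. by []. Qed.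

Lemma smooth_LL (U : set V) l F : open U -> smooth U F -> smooth U (LL l F).
Proof.
move=> Uo Fs k; apply: ckD => //; first by apply: ckM => //; exact: ck_ell.
by apply: ckN => //; exact: smooth_pd.
Qed.

Lemma smooth_RR (U : set V) l F : open U -> smooth U F -> smooth U (RR l F).
Proof.
move=> Uo Fs k; apply: ckD => //; first by apply: ckM => //; exact: ck_ell.
exact: smooth_pd.
Qed.

Lemma smooth_LRder (U : set V) g w w' : open U -> smooth U g -> smooth U (LRder g w w').
Proof.
move=> Uo gs; rewrite /LRder; elim: w => [|l w IH] /=; last exact: smooth_LL.
by elim: w' => [//|l w' IH] /=; exact: smooth_RR.
Qed.

Lemma ellE l Z : ell l Z = 0 +i* (2 * symplectic Z (ev l)). Proof. by []. Qed.

Lemma LL_limit l H Z m :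
  jlim (0 : R)^' (fun t _ : R => (t^-1)%:C *
    (expi (t * (2 * symplectic Z (ev l))) * H (Z - t *: ev l) - H Z)) m ->
  cdrv l H Z (ell l Z * H Z - m) /\ LL l H Z = m.
Proof.
move=> hm; have := @twisted_quotient R _ H Z l (2 * symplectic Z (ev l)) (-1) m.
move=> /(_ (or_intror erefl)).
have -> : (-1 : R)%:C * (m - 0 +i* (2 * symplectic Z (ev l)) * H Z) =
    ell l Z * H Z - m by rewrite rmorphN /= -ellE; ring.
move=> /(_ _)h; have {}h : cdrv l H Z (ell l Z * H Z - m).
  by apply: h; apply: jlim_ext hm => t s; rewrite mulN1r scaleNr.
by split => //; rewrite /LL (cdrv_pd h); ring.
Qed.

Lemma RR_limit l H Z m :
  jlim (0 : R)^' (fun t _ : R => (t^-1)%:C *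
    (expi (t * (2 * symplectic Z (ev l))) * H (Z + t *: ev l) - H Z)) m ->
  cdrv l H Z (m - ell l Z * H Z) /\ RR l H Z = m.
Proof.
move=> hm; have := @twisted_quotient R _ H Z l (2 * symplectic Z (ev l)) 1 m.
move=> /(_ (or_introl erefl)).
have -> : (1 : R)%:C * (m - 0 +i* (2 * symplectic Z (ev l)) * H Z) =
    m - ell l Z * H Z by rewrite -ellE; ring.
move=> /(_ _)h; have {}h : cdrv l H Z (m - ell l Z * H Z).
  by apply: h; apply: jlim_ext hm => t s; rewrite mul1r.
by split => //; rewrite /RR (cdrv_pd h); ring.
Qed.

(** A phase depending only on the translated argument turns its translation into a
   twisted translation of [H], which is the same for all pairs with a given
   difference [Y - X]. *)
Lemma twist_shiftl H X Y l (t : R) :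
  expi (- (2 * t * symplectic X (ev l))) * twist H (X + t *: ev l) Y =
  expi (2 * symplectic Y X) *
    (expi (t * (2 * symplectic (Y - X) (ev l))) * H (Y - X - t *: ev l)).
Proof.
rewrite /twist !mulrA -!expiD opprD addrA; congr (expi _ * _).
by rewrite !sympE; ring.
Qed.

Lemma twist_shiftr H X Y l (t : R) :
  expi (2 * t * symplectic Y (ev l)) * twist H X (Y + t *: ev l) =
  expi (2 * symplectic Y X) *
    (expi (t * (2 * symplectic (Y - X) (ev l))) * H (Y - X + t *: ev l)).
Proof.
rewrite /twist !mulrA -!expiD addrAC; congr (expi _ * _).
by rewrite !sympE (sympC (ev l) X); ring.
Qed.

Variables (g : V -> C) (U : set V).
Hypotheses (Uo : open U) (U0 : U 0) (gs : smooth U g).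

Local Notation G := (LRder g).

Definition wkernel (p p' : W * V) : C := twist (G p.1 p'.1) p.2 p'.2.

(** The index [(Some l, p)] stands for the twisted derivative of the vector [p] in the
   direction [l], approximated by difference quotients, and [(None, p)] for [p]
   itself: both kinds have to be adjoined together. *)
Definition dquot (a : option 'I_(d + d) * (W * V)) (t : R) : seq (C * (W * V)) :=
  if a.1 is Some l then
    [:: ((t^-1)%:C * expi (- (2 * t * symplectic a.2.2 (ev l))),
          (a.2.1, a.2.2 + t *: ev l)); (- (t^-1)%:C, a.2)]
  else [:: (1, a.2)].

Lemma conj_expiC (t u : R) : (t%:C * expi u)^*%C = t%:C * expi (- u).
Proof. by rewrite conjM conjR expiJ. Qed.

Lemma conjNR (t : R) : (- t%:C)^*%C = - t%:C.
Proof. by rewrite conjN conjR. Qed.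

Lemma kform_dquot_cst (K : W * V -> W * V -> C) l w X c t :
  kform K (dquot (Some l, (w, X)) t) c =
  (t^-1)%:C * expi (- (2 * t * symplectic X (ev l))) *
     kform K [:: (1, (w, X + t *: ev l))] c
  - (t^-1)%:C * kform K [:: (1, (w, X))] c.
Proof.
rewrite /dquot /= -[_ :: _]/([:: _] ++ [:: _]) kform_catl.
set a := _ * expi _.
have -> : [:: (a, (w, X + t *: ev l))] = lscale a [:: (1, (w, X + t *: ev l))].
  by rewrite /lscale /= mulr1.
have -> : [:: (- (t^-1)%:C, (w, X))] = lscale (- (t^-1)%:C) [:: (1, (w, X))].
  by rewrite /lscale /= mulr1.
by rewrite !kform_scalel mulNr.
Qed.

Lemma kform_cst_dquot (K : W * V -> W * V -> C) l w X c t :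
  kform K c (dquot (Some l, (w, X)) t) =
  (t^-1)%:C * expi (2 * t * symplectic X (ev l)) *
     kform K c [:: (1, (w, X + t *: ev l))]
  - (t^-1)%:C * kform K c [:: (1, (w, X))].
Proof.
rewrite /dquot /= -[_ :: _]/([:: _] ++ [:: _]) kform_catr.
set a := _ * expi _.
have -> : [:: (a, (w, X + t *: ev l))] = lscale a [:: (1, (w, X + t *: ev l))].
  by rewrite /lscale /= mulr1.
have -> : [:: (- (t^-1)%:C, (w, X))] = lscale (- (t^-1)%:C) [:: (1, (w, X))].
  by rewrite /lscale /= mulr1.
by rewrite !kform_scaler /a conj_expiC opprK conjNR mulNr.
Qed.

(** By invariance the Gram numbers of the quotients do not depend on the point [X]:
   they are second difference quotients of [LRder g w w] at the origin, where [g] is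
   known to be smooth. *)
Lemma dquot_diag l w X : exists m,
  jlim (0 : R)^' (fun t s => kform wkernel (dquot (Some l, (w, X)) t)
    (dquot (Some l, (w, X)) s)) m.
Proof.
pose H := G w w.
have Hs : smooth U H by exact: smooth_LRder.
(* The increments are [- t] and [s], hence the sign. *)
exists (- pd l (pd l H) 0).
apply: (@jlim_near _ _ _ _ (fun t s : R => (t^-1)%:C * (s^-1)%:C *
    (H (0 + (- t) *: ev l + s *: ev l) - H (0 + (- t) *: ev l) - H (0 + s *: ev l) + H 0))).
  exists setT; split; first exact: filterT.
  move=> t s _ _.
  have kE p p' : kform wkernel [:: (1, p)] [:: (1, p')] = wkernel p p'.
    by rewrite kform1 conjc1 !mul1r.
  rewrite kform_dquot_cst !kform_cst_dquot !kE /wkernel /= -/H.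
  set e := ev l; set b := symplectic X e.
  have E1 : expi (- (2 * t * b)) * expi (2 * s * b) * twist H (X + t *: e) (X + s *: e)
     = H (0 + (- t) *: e + s *: e).
    rewrite /twist mulrA -!expiD.
    have -> : - (2 * t * b) + 2 * s * b + 2 * symplectic (X + s *: e) (X + t *: e) = 0.
      rewrite !sympE !sympxx (sympC e X) /b; ring.
    rewrite expi0 mul1r; congr H.
    by rewrite opprD addrACA subrr !add0r scaleNr addrC.
  have E2 : expi (- (2 * t * b)) * twist H (X + t *: e) X = H (0 + (- t) *: e).
    rewrite /twist mulrA -!expiD.
    have -> : - (2 * t * b) + 2 * symplectic X (X + t *: e) = 0.
      rewrite !sympE !sympxx /b; ring.
    by rewrite expi0 mul1r; congr H; rewrite opprD addrA subrr !add0r scaleNr.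
  have E3 : expi (2 * s * b) * twist H X (X + s *: e) = H (0 + s *: e).
    rewrite /twist mulrA -!expiD.
    have -> : 2 * s * b + 2 * symplectic (X + s *: e) X = 0.
      rewrite !sympE !sympxx (sympC e X) /b; ring.
    by rewrite expi0 mul1r; congr H; rewrite addrAC subrr.
  have E4 : twist H X X = H 0 by rewrite /twist sympxx mulr0 expi0 mul1r subrr.
  rewrite -E1 -E2 -E3 -E4; ring.
move=> e e0.
have e2 : 0 < e / 2 by lra.
have [r r0 hr] := csecond_difference Uo l l Hs U0 e2.
exists [set t : R | `|t| < r /\ t != 0]; split.
  by apply: (@ball_dnbhs0 _ _ r) => // t tr t0; split.
move=> t s [tr t0] [sr s0].
have := hr (- t) s; rewrite normrN => /(_ tr sr).
set D := _ - _ + _; set P := pd l (pd l H) 0.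
have tC : t%:C * (t^-1)%:C = 1 :> C by rewrite -rmorphM /= divff.
have sC : s%:C * (s^-1)%:C = 1 :> C by rewrite -rmorphM /= divff.
move=> hD.
have -> : (t^-1)%:C * (s^-1)%:C * D - - P = (t^-1)%:C * (s^-1)%:C * (D - (- t * s)%:C * P).
  have -> : (- t * s)%:C = - (t%:C * s%:C) :> C by rewrite !rmorphM rmorphN /= mulNr.
  transitivity ((t^-1)%:C * (s^-1)%:C * D + (t%:C * (t^-1)%:C) * (s%:C * (s^-1)%:C) * P); last by ring.
  by rewrite tC sC; ring.
rewrite !cmodM !cmodR.
apply: (@le_lt_trans _ _ (e / 2)); last by lra.
have ts : 0 < `|t| * `|s| by rewrite mulr_gt0 ?normr_gt0.
rewrite -(ler_pM2l ts).
rewrite !normfV.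
have -> : `|t| * `|s| * (`|t|^-1 * `|s|^-1 * cmod (D - (- t * s)%:C * P)) = cmod (D - (- t * s)%:C * P).
  by field; rewrite !normr_eq0 s0 t0.
by rewrite (mulrC (_ * _)).
Qed.

Lemma eq_sum_supported I (P : pred I) (c : seq (C * I)) (F1 F2 : C * I -> C) :
  supported P c -> (forall a, P a.2 -> F1 a = F2 a) ->
  \sum_(a <- c) F1 a = \sum_(a <- c) F2 a.
Proof.
move=> + FF; elim: c => [|a c IH] /=; first by rewrite !big_nil.
by move=> /andP[Pa Pc]; rewrite !big_cons IH// FF.
Qed.

Lemma jlim_iter T (F : set_system T) (FF : ProperFilter F) (h : T -> T -> C) m (k : T -> C) :
  jlim F h m -> (forall s, jlim F (fun t _ => h t s) (k s)) ->
  jlim F (fun s _ => k s) m.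
Proof.
move=> hm hk e e0; have e2 : 0 < e / 2 by lra.
have [A [FA hA]] := hm _ e2; exists A; split => // s _ As _.
have [B [FB hB]] := hk s _ e2; have [t [At Bt]] := filter_ex (filterI FA FB).
have := hA _ _ At As; have := hB _ _ Bt Bt; have := cmod_tri (k s) (h t s) m.
rewrite (cmodBC (k s) (h t s)); lra.
Qed.

Lemma jlim_swap T (F : set_system T) (h : T -> T -> C) m :
  jlim F h m -> jlim F (fun t s => h s t) m.
Proof. by move=> hm e /hm[A [FA hA]]; exists A; split => // t s At As; exact: hA. Qed.

Variable n : nat.
Hypothesis Kpsd : psd (fun p : W * V => (size p.1 <= n)%N) wkernel.

(** The squared norms of the difference quotients converge by [dquot_diag], so the
   limits may be adjoined. Their products with the old vectors are limits of twisted
   difference quotients of [LRder g w w'] at arbitrary points; the existence of these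
   limits is the existence of the derivatives. The product of two new vectors is an
   iterated limit in either order, so [LL] and [RR] commute. *)
Lemma adjoin_derivatives :
  (forall w w' l X, (size w <= n)%N -> (size w' <= n)%N ->
     exists m, cdrv l (G w w') X m) /\
  (forall w w' l l', (size w <= n)%N -> (size w' <= n)%N ->
     RR l' (LL l (G w w')) = LL l (RR l' (G w w'))) /\
  psd (fun a : option 'I_(d + d) * (W * V) => (size a.2.1 <= n)%N)
    (fun a b => twist (Ropt b.1 (Lopt a.1 (G a.2.1 b.2.1))) a.2.2 b.2.2).
Proof.
pose P' := (fun a : option 'I_(d + d) * (W * V) => (size a.2.1 <= n)%N).
have kE p p' : kform wkernel [:: (1, p)] [:: (1, p')] = wkernel p p'.
  by rewrite kform1 conjc1 !mul1r.
have [||K' [K'psd K'lim]] := @psd_limit R _ _ R (0 : R)^' _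
    (fun p : W * V => (size p.1 <= n)%N) wkernel P' dquot Kpsd.
- move=> [[l|] [w X]] t; rewrite /P' /= /dquot /supported /= ?andbT //.
  by move=> ->.
- move=> [[l|] [w X]] _; first exact: dquot_diag.
  exists (kform wkernel [:: (1, (w, X))] [:: (1, (w, X))]).
  exact: jlim_cst.
have KNN p p' : P' (None, p) -> P' (None, p') -> K' (None, p) (None, p') = wkernel p p'.
  move=> Pp Pp'; rewrite -kE; apply: jlim_unique (K'lim _ _ Pp Pp') _.
  exact: jlim_cst.
have expiNK (b : R) : expi (- b) * expi b = 1 by rewrite mulrC expiK.
have unph (H : V -> C) X Y m (h : R -> R -> C) :
    jlim (0 : R)^' (fun t s => expi (2 * symplectic Y X) * h t s) m ->
    jlim (0 : R)^' h (expi (- (2 * symplectic Y X)) * m).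
  move=> hm; apply: jlim_ext (jlimM (jlim_cst (expi (- (2 * symplectic Y X)))) hm).
  by move=> t s; rewrite mulrA expiNK mul1r.
have phm (a : R) m m' : m' = expi (- a) * m -> m = expi a * m'.
  by move=> ->; rewrite mulrA expiK mul1r.
have EL (H : V -> C) X Y l t :
    (t^-1)%:C * expi (- (2 * t * symplectic X (ev l))) * twist H (X + t *: ev l) Y
    - (t^-1)%:C * twist H X Y = expi (2 * symplectic Y X) * ((t^-1)%:C *
    (expi (t * (2 * symplectic (Y - X) (ev l))) * H (Y - X - t *: ev l) - H (Y - X))).
  by rewrite -mulrA twist_shiftl /twist; ring.
have ER (H : V -> C) X Y l t :
    (t^-1)%:C * expi (2 * t * symplectic Y (ev l)) * twist H X (Y + t *: ev l)
    - (t^-1)%:C * twist H X Y = expi (2 * symplectic Y X) * ((t^-1)%:C *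
    (expi (t * (2 * symplectic (Y - X) (ev l))) * H (Y - X + t *: ev l) - H (Y - X))).
  by rewrite -mulrA twist_shiftr /twist; ring.
have KLN l w X w' Y : (size w <= n)%N -> (size w' <= n)%N ->
    (exists m, cdrv l (G w w') (Y - X) m) /\
    K' (Some l, (w, X)) (None, (w', Y)) = twist (LL l (G w w')) X Y.
  move=> wn wn'; have h := K'lim (Some l, (w, X)) (None, (w', Y)) wn wn'.
  have : jlim (0 : R)^' (fun t _ : R => expi (2 * symplectic Y X) * ((t^-1)%:C *
    (expi (t * (2 * symplectic (Y - X) (ev l))) * G w w' (Y - X - t *: ev l) - G w w' (Y - X))))
    (K' (Some l, (w, X)) (None, (w', Y))).
    by apply: jlim_ext h => t s; rewrite kform_dquot_cst !kE /wkernel /= EL.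
  move=> /unph => /(_ g)/LL_limit[h1 h2]; split; first by eexists; exact: h1.
  by rewrite /twist; exact: phm.
have KNR l w X w' Y : (size w <= n)%N -> (size w' <= n)%N ->
    K' (None, (w, X)) (Some l, (w', Y)) = twist (RR l (G w w')) X Y.
  move=> wn wn'; have h := K'lim (None, (w, X)) (Some l, (w', Y)) wn wn'.
  have : jlim (0 : R)^' (fun t _ : R => expi (2 * symplectic Y X) * ((t^-1)%:C *
    (expi (t * (2 * symplectic (Y - X) (ev l))) * G w w' (Y - X + t *: ev l) - G w w' (Y - X))))
    (K' (None, (w, X)) (Some l, (w', Y))).
    apply: jlim_swap; apply: jlim_ext h => t s.
    by rewrite kform_cst_dquot !kE /wkernel /= ER.
  move=> /unph => /(_ g)/RR_limit[_ h2].
  by rewrite /twist; exact: phm.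
have KLR l w X l' w' Y : (size w <= n)%N -> (size w' <= n)%N ->
    K' (Some l, (w, X)) (Some l', (w', Y)) = twist (RR l' (LL l (G w w'))) X Y /\
    K' (Some l, (w, X)) (Some l', (w', Y)) = twist (LL l (RR l' (G w w'))) X Y.
  move=> wn wn'; have h := K'lim (Some l, (w, X)) (Some l', (w', Y)) wn wn'.
  split.
    have : jlim (0 : R)^' (fun t _ : R => expi (2 * symplectic Y X) * ((t^-1)%:C *
      (expi (t * (2 * symplectic (Y - X) (ev l'))) * LL l (G w w') (Y - X + t *: ev l')
        - LL l (G w w') (Y - X))))
      (K' (Some l, (w, X)) (Some l', (w', Y))).
      apply: (jlim_iter _ h) => s; rewrite -ER.
      have h1 Y' := K'lim (Some l, (w, X)) (None, (w', Y')) wn wn'.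
      rewrite -!(KLN _ _ _ _ _ wn wn').2.
      rewrite -mulNr; apply: (jlim_ext _ (jlimD (jlimM (jlim_cst
         ((s^-1)%:C * expi (2 * s * symplectic Y (ev l')))) (h1 (Y + s *: ev l')))
         (jlimM (jlim_cst (- (s^-1)%:C)) (h1 Y)))) => t s'.
      by rewrite kform_cst_dquot mulNr.
    move=> /unph => /(_ g)/RR_limit[_ h2].
    by rewrite /twist; exact: phm.
  have : jlim (0 : R)^' (fun t _ : R => expi (2 * symplectic Y X) * ((t^-1)%:C *
    (expi (t * (2 * symplectic (Y - X) (ev l))) * RR l' (G w w') (Y - X - t *: ev l)
      - RR l' (G w w') (Y - X))))
    (K' (Some l, (w, X)) (Some l', (w', Y))).
    apply: (jlim_iter _ (jlim_swap h)) => t; rewrite -EL.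
    have h1 X' := jlim_swap (K'lim (None, (w, X')) (Some l', (w', Y)) wn wn').
    rewrite -!(KNR _ _ _ _ _ wn wn').
    rewrite -(mulNr _ (K' _ _)); apply: (jlim_ext _ (jlimD (jlimM (jlim_cst
       ((t^-1)%:C * expi (- (2 * t * symplectic X (ev l))))) (h1 (X + t *: ev l)))
       (jlimM (jlim_cst (- (t^-1)%:C)) (h1 X)))) => s t'.
    by rewrite kform_dquot_cst (mulNr _ (kform _ _ _)).
  move=> /unph => /(_ g)/LL_limit[_ h2].
  by rewrite /twist; exact: phm.
split; [|split].
- move=> w w' l X wn wn'; have [] := KLN l w 0 w' X wn wn'.
  by rewrite subr0.
- move=> w w' l l' wn wn'; apply/funext => Z.
  have [e1 e2] := KLR l w 0 l' w' Z wn wn'.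
  have := esym e1; rewrite e2 /twist subr0.
  move=> /(congr1 (fun z => expi (- (2 * symplectic Z 0)) * z)).
  by rewrite !mulrA expiNK !mul1r.
- move=> c Pc; have := K'psd c Pc.
  congr (0 <= _); rewrite /kform.
  have same a b : P' a -> P' b -> K' a b =
    twist (Ropt b.1 (Lopt a.1 (G a.2.1 b.2.1))) a.2.2 b.2.2.
    case: a b => [[l|] [w X]] [[l'|] [w' Y]] Pa Pb /=.
    - exact: (KLR _ _ _ _ _ _ Pa Pb).1.
    - exact: (KLN _ _ _ _ _ Pa Pb).2.
    - exact: KNR.
    - exact: KNN.
  apply: (eq_sum_supported Pc) => a Pa.
  by apply: (eq_sum_supported Pc) => b Pb; rewrite same.
Qed.

End adjoin_derivatives.

Lemma psd_pullback {R : realType} (I I' : Type) (P : pred I) (P' : pred I')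
    (K : I -> I -> R[i]) (K' : I' -> I' -> R[i]) (f : I' -> I) :
  psd P K -> (forall i, P' i -> P (f i)) ->
  (forall i j, P' i -> P' j -> K' i j = K (f i) (f j)) -> psd P' K'.
Proof.
move=> Kpsd Pf KK c Pc.
have := Kpsd [seq (p.1, f p.2) | p <- c]; rewrite /supported all_map => /(_ _)h.
have {}h : 0 <= kform K [seq (p.1, f p.2) | p <- c] [seq (p.1, f p.2) | p <- c].
  by apply: h; apply: sub_all Pc => p /=; exact: Pf.
move: h; congr (0 <= _); rewrite /kform big_map.
apply: (eq_sum_supported Pc) => p Pp; rewrite big_map.
by apply: (eq_sum_supported Pc) => q Pq /=; rewrite KK.
Qed.

Section global_derivatives.
Context {R : realType} {d : nat}.
Local Notation C := R[i].
Local Notation V := 'rV[R]_(d + d).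
Local Notation W := (seq 'I_(d + d)).
Variables (g : V -> C) (U : set V).
Hypotheses (Uo : open U) (U0 : U 0) (gs : smooth U g).
Hypothesis gpsd : psd predT (twist g).
Local Notation G := (LRder g).
Implicit Types (X : V) (l : 'I_(d + d)) (w : W).

(** Induction on the number of derivatives. The recursion rule for the second word is
   carried along because [LRder] is defined by applying the operators [RR] first, and
   moving a further one inside is commutation with all [LL]. *)
Lemma psd_words n : psd (fun p : W * V => (size p.1 <= n)%N) (wkernel g) /\
  forall w w' l, (size w <= n)%N -> (size w' < n)%N ->
    G w (l :: w') = RR l (G w w').
Proof.
elim: n => [|n [Kn rel]].
  split => //; apply: (psd_pullback (f := snd)) gpsd _ _ => // -[w X] [w' Y].
  by rewrite !leqn0 /= => /nilP -> /nilP ->.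
have [ex [comm Kn1]] := adjoin_derivatives Uo U0 gs Kn.
have rel1 w w' l : (size w <= n.+1)%N -> (size w' < n.+1)%N ->
    G w (l :: w') = RR l (G w w').
  elim: w => [//|m w IH] /= wn wn'.
  by rewrite IH ?(ltnW wn)// -comm.
split => //.
pose f (p : W * V) : option 'I_(d + d) * (W * V) :=
  if p.1 is l :: w then if (size p.1 <= n)%N then (None, p) else (Some l, (w, p.2))
  else (None, p).
apply: (psd_pullback (f := f)) Kn1 _ _.
  by move=> [[|l w] X] //=; rewrite /f /=; case: ifP.
move=> [w X] [w' Y] /= wn wn'.
have fE w1 X1 : (size w1 <= n)%N -> f (w1, X1) = (None, (w1, X1)).
  by case: w1 => [//|l w1] h; rewrite /f h.
have fE2 l1 w1 X1 : (n < size (l1 :: w1))%N -> f (l1 :: w1, X1) = (Some l1, (w1, X1)).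
  by rewrite /f ltnNge => /negbTE /= ->.
have [h|h] := leqP (size w) n; have [h'|h'] := leqP (size w') n.
- by rewrite !fE.
- rewrite (fE w)//; case: w' wn' h' => [//|l w'] wn' h'.
  by rewrite fE2// /wkernel /= rel1.
- rewrite (fE w')//; case: w wn h => [//|l w] wn h.
  by rewrite fE2.
- case: w' wn' h' => [//|l' w'] wn' h'; case: w wn h => [//|l w] wn h.
  rewrite !fE2//; congr (twist _ _ _); exact: (rel1 (l :: w) w' l').
Qed.

Lemma LRder_RR w w' l : G w (l :: w') = RR l (G w w').
Proof.
have [_] := psd_words (maxn (size w) (size w').+1).
by apply; rewrite ?leq_maxl// leq_max ltnSn orbT.
Qed.

Lemma LRder_ex w w' l X : exists m, cdrv l (G w w') X m.
Proof.
have [Kn _] := psd_words (maxn (size w) (size w')).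
have [ex _] := adjoin_derivatives Uo U0 gs Kn.
by apply: ex; rewrite ?leq_maxl// leq_maxr.
Qed.

Lemma LRder_cdrv w w' l X :
  cdrv l (G w w') X ((2^-1)%:C * (G w (l :: w') X - G (l :: w) w' X)).
Proof.
have [m hm] := LRder_ex w w' l X.
have -> : (2^-1)%:C * (G w (l :: w') X - G (l :: w) w' X) = m => //.
rewrite LRder_RR LRder_nilr /LL /RR (cdrv_pd hm).
have -> : (2^-1)%:C = 2^-1 :> C by rewrite fmorphV rmorph_nat.
by field.
Qed.

Lemma LRder_ell w w' l X :
  ell l X * G w w' X = (2^-1)%:C * (G w (l :: w') X + G (l :: w) w' X).
Proof.
rewrite LRder_RR LRder_nilr /LL /RR.
have -> : (2^-1)%:C = 2^-1 :> C by rewrite fmorphV rmorph_nat.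
by field.
Qed.

(** Cauchy-Schwarz for the derivatives of the point vectors [0] and [X]: their squared
   norms do not depend on the points. *)
Lemma LRder_bound w w' X :
  cmod (G w w' X) ^+ 2 <= cmod (G w w 0) * cmod (G w' w' 0).
Proof.
have [Kn _] := psd_words (maxn (size w) (size w')).
have := @psd_cs _ _ _ _ Kn (w, 0) (w', X).
rewrite leq_maxl leq_maxr => /(_ isT isT).
rewrite /wkernel /= /twist cmodM cmod_expi mul1r subr0 => /le_trans; apply.
rewrite !sympxx !subrr !mulr0 !expi0 !mul1r.
apply: le_trans (ler_norm _) _; rewrite normrM.
by apply: ler_pM => //; exact: cmod_Re.
Qed.

(** The family of all [LRder g w w'] is bounded and closed under partial derivatives. *)
Lemma LRder_ck k w w' : ck setT k (G w w').
Proof.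
have bd w1 w2 : exists M : R, forall X, cmod (G w1 w2 X) <= M.
  exists (cmod (G w1 w1 0) * cmod (G w2 w2 0) + 1) => X.
  have := LRder_bound w1 w2 X; set a := _ * _; have := cmod_ge0 (G w1 w2 X).
  have : 0 <= a by rewrite mulr_ge0 ?cmod_ge0.
  by rewrite expr2; nra.
have cont w1 w2 X : ccont (G w1 w2) X.
  pose M l := projT1 (cid (bd w1 (l :: w2))) + projT1 (cid (bd (l :: w1) w2)).
  have hM l Y : cmod (G w1 (l :: w2) Y) + cmod (G (l :: w1) w2 Y) <= M l.
    by rewrite /M; do 2 (case: cid => ? ? /=); apply: lerD.
  apply: (@ccont_of_bounded_partials _ _ _ (\sum_l M l)) => l Y.
  eexists; split; first exact: LRder_cdrv.
  have M0 l' : 0 <= M l' by apply: le_trans (hM l' 0); rewrite addr_ge0 ?cmod_ge0.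
  rewrite cmodM cmodR ger0_norm//.
  apply: (@le_trans _ _ (M l)).
    have := cmodB (G w1 (l :: w2) Y) (G (l :: w1) w2 Y); have := hM l Y.
    have := cmod_ge0 (G w1 (l :: w2) Y - G (l :: w1) w2 Y); lra.
  by rewrite (bigD1 l)//= lerDl sumr_ge0.
elim: k w w' => [|k IH] w w'; first by split.
apply: ck_intro => // [|l]; first exact: openT.
eexists; split; first by move=> X _; exact: LRder_cdrv.
apply: ckZ; first exact: openT.
by apply: ckD; [exact: openT|exact: IH|apply: ckN; [exact: openT|exact: IH]].
Qed.

End global_derivatives.

(** * Growth of derivatives at the origin *)

Section growth.
Context {R : realType} {d : nat}.
Local Notation C := R[i].
Local Notation V := 'rV[R]_(d + d).
Variables (U : set V).
Hypotheses (Uo : open U) (U0 : U 0).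
Implicit Types (F H : V -> C) (o : bool * 'I_(d + d)).

Definition opl o F := if o.1 then LL o.2 F else RR o.2 F.
Definition opw (ops : seq (bool * 'I_(d + d))) F := foldr opl F ops.
Definition osign o : C := if o.1 then -1 else 1.

Lemma cmod_osign o : cmod (osign o) = 1.
Proof. by rewrite /osign; case: o.1; rewrite ?cmodN cmod1. Qed.

Lemma oplE o F X : opl o F X = ell o.2 X * F X + osign o * pd o.2 F X.
Proof. by case: o => -[] l; rewrite /opl /osign /= /LL /RR ?mulN1r ?mul1r. Qed.

Lemma LRder_opw F w w' :
  LRder F w w' = opw ([seq (true, l) | l <- w] ++ [seq (false, l) | l <- w']) F.
Proof.
rewrite /LRder /opw foldr_cat !foldr_map; congr foldr.
Qed.

Lemma smooth_opw F ops : smooth U F -> smooth U (opw ops F).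
Proof.
by move=> Fs; elim: ops => [//|[[] l] ops IH] /=; [exact: smooth_LL|exact: smooth_RR].
Qed.

Lemma opl_ext o F H X : (forall Y, U Y -> F Y = H Y) -> U X -> opl o F X = opl o H X.
Proof. by move=> FH UX; rewrite !oplE FH// (pd_ext Uo o.2 FH UX). Qed.

(** The linear combination is indexed by a sequence of functions because the
   commutators of [pd_opw] come in this form. *)
Lemma opl_comb o F (r : seq (C * (V -> C))) X : smooth U F ->
  (forall p, List.In p r -> smooth U p.2) -> U X ->
  opl o (fun Y => F Y + \sum_(p <- r) p.1 * p.2 Y) X =
    opl o F X + \sum_(p <- r) p.1 * opl o p.2 X.
Proof.
move=> Fs rs UX; elim: r F Fs rs => [|p r IH] F Fs rs.
  rewrite !big_nil addr0; apply: opl_ext => // Y UY; by rewrite big_nil addr0.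
have ps : smooth U p.2 by apply: rs; left.
rewrite !big_cons.
have Fps : smooth U (fun Y => F Y + p.1 * p.2 Y).
  by move=> k; apply: ckD => //; exact: ckZ.
rewrite addrA.
have -> : opl o F X + p.1 * opl o p.2 X = opl o (fun Y => F Y + p.1 * p.2 Y) X.
  rewrite !oplE (cdrv_pd (cdrvD (smooth_drv o.2 Fs UX) (cdrvZ p.1 (smooth_drv o.2 ps UX)))).
  by ring.
rewrite -IH//; last by move=> q qr; apply: rs; right.
by apply: opl_ext => // Y UY; rewrite big_cons addrA.
Qed.

Lemma pd_opl k o F X : smooth U F -> U X ->
  pd k (opl o F) X = opl o (pd k F) X + ell o.2 (ev k) * F X.
Proof.
move=> Fs UX.
have h : cdrv k (opl o F) X (ell o.2 (ev k) * F X + ell o.2 X * pd k F X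
     + osign o * pd k (pd o.2 F) X).
  apply: (@cdrv_near _ _ _ (fun Y => ell o.2 Y * F Y + osign o * pd o.2 F Y)).
    by near=> Y; rewrite oplE.
  apply: cdrvD; first by apply: cdrvM; [exact: cdrv_ell|exact: smooth_drv Fs UX].
  by apply: cdrvZ; apply: smooth_drv UX; exact: smooth_pd.
by rewrite (cdrv_pd h) oplE (pd_comm Uo o.2 k Fs UX); ring.
Unshelve. all: by end_near. Qed.

(** A derivative passes through a word of operators at the cost of one commutator for
   each of them; the commutator with [LL l] or [RR l] is a constant, at most [4 * d],
   and deletes the operator from the word. *)
Lemma pd_opw k ops F : smooth U F ->
  exists r : seq (C * seq (bool * 'I_(d + d))),
    [/\ size r = size ops,
        forall p, List.In p r -> cmod p.1 <= 4 * d%:R /\ size p.2 = (size ops).-1 &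
        forall X, U X -> pd k (opw ops F) X =
          opw ops (pd k F) X + \sum_(p <- r) p.1 * opw p.2 F X].
Proof.
move=> Fs; elim: ops => [|o ops [r [rs rb rE]]].
  by exists [::]; split => // X UX; rewrite big_nil addr0.
exists ((ell o.2 (ev k), ops) :: [seq (p.1, o :: p.2) | p <- r]); split.
- by rewrite /= size_map rs.
- move=> p /= [<-|/List.in_map_iff[q [<- qr]]] /=; first by split => //; exact: cmod_ell_ev.
  have [h1 h2] := rb q qr; split => //; rewrite h2 prednK// -rs.
  by case: (r) qr.
- move=> X UX /=; rewrite pd_opl//; last exact: smooth_opw.
  have -> : opl o (pd k (opw ops F)) X =
      opl o (fun Y => opw ops (pd k F) Y +
        \sum_(p <- [seq (p.1, opw p.2 F) | p <- r]) p.1 * p.2 Y) X.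
    by apply: opl_ext => // Y UY; rewrite rE// big_map.
  rewrite opl_comb//; last 2 first.
  - by apply: smooth_opw; exact: smooth_pd.
  - by move=> p /List.in_map_iff[q [<- _]] /=; exact: smooth_opw.
  rewrite big_cons !big_map /= -addrA; congr (_ + _); rewrite addrC; congr (_ + _).
Qed.

Lemma sum_le_size I (r : seq I) (f : I -> R) (c : R) :
  (forall i, List.In i r -> f i <= c) -> \sum_(i <- r) f i <= (size r)%:R * c.
Proof.
elim: r => [|i r IH] h; first by rewrite big_nil mul0r.
rewrite big_cons /= -natr1 mulrDl mul1r addrC lerD//; last by apply: h; left.
by apply: IH => j jr; apply: h; right.
Qed.

Variables (s : R) (F : V -> C) (C0 h : R).
Hypotheses (s_half : 2^-1 <= s) (Fs : smooth U F) (h0 : 0 < h) (C00 : 0 <= C0).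
Hypothesis Fb : forall u, cmod (pds u F 0) <= C0 * h ^+ size u * ((size u)`!%:R `^ s).

(* One operator at the origin costs a derivative, [h], or a commutator, [4 * d]; the
   last summand makes [A] at least [1]. *)
Let A : R := h + 4 * d%:R + 1.

(** Two factors larger than [M] are gained in the factorial, and with [s >= 1/2] the
   power [s] of their product still exceeds [M]. This is where
   [s >= 1/2], rather than [s >= 0], enters. *)
Lemma fact_gain (M r : nat) : 
  M.+1%:R * ((M + r)`!%:R `^ s) <= (M.+2 + r)`!%:R `^ s :> R.
Proof.
have sq : ((M.+1%:R ^+ 2) * (M + r)`!%:R) <= (M.+2 + r)`!%:R :> R.
  rewrite -natrX -natrM ler_nat !addSn !factS mulnA leq_mul//.
  by rewrite expnS expn1 leq_mul// ltnS ?leqW ?leq_addr.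
have s0 : 0 <= s by apply: le_trans s_half; lra.
apply: le_trans (_ : ((M.+1%:R ^+ 2) * (M + r)`!%:R) `^ s <= _); last first.
  by apply: ge0_ler_powR => //; rewrite nnegrE// mulr_ge0// exprn_ge0.
rewrite powRM//.
rewrite ler_wpM2r ?powR_ge0//.
apply: le_trans (_ : (M.+1%:R ^+ 2) `^ (2^-1) <= _); last first.
  by apply: ler_powR => //; rewrite exprn_ege1// ler1n.
by rewrite -powR_mulrn// -powRrM divff// powRr1.
Qed.

(** At the origin the outermost operator is plus or minus a derivative, since [ell]
   vanishes there. Moving it to the right either adds a letter to [u] or cancels it
   against one of the remaining [M] operators. There are [M] such cancellations, each
   leaving a word with two operators fewer. *)
Lemma opw_growth M : forall ops u, size ops = M ->
  cmod (opw ops (pds u F) 0) <= C0 * A ^+ M * h ^+ size u * ((M + size u)`!%:R `^ s).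
Proof.
have d0 : 0 <= d%:R :> R by exact: ler0n.
have A1 : 1 <= A by move: d0; rewrite /A; move: (d%:R : R) h0 => D ? ?; lra.
have A0 : 0 < A by lra.
elim/ltn_ind: M => M IH ops u; case: ops => [|o ops] /= sz.
  by rewrite -sz expr0 mulr1 add0n; exact: Fb.
case: M IH sz => [//|M] IH [sz].
rewrite oplE ell0 mul0r add0r.
have us : smooth U (pds u F) by exact: smooth_pds.
have [r [rs rb rE]] := pd_opw o.2 ops us.
have -> : cmod (osign o * pd o.2 (opw ops (pds u F)) 0) = cmod (pd o.2 (opw ops (pds u F)) 0).
  by rewrite cmodM cmod_osign mul1r.
rewrite rE//.
apply: le_trans (cmodD _ _) _.
have t1 : cmod (opw ops (pd o.2 (pds u F)) 0) <=
    C0 * A ^+ M * h ^+ (size u).+1 * ((M + (size u).+1)`!%:R `^ s).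
  exact: (IH M (ltnSn M) ops (o.2 :: u) sz).
set Q := ((M.+1 + size u)`!%:R `^ s).
have Q0 : 0 <= Q by exact: powR_ge0.
rewrite addnS -addSn -/Q in t1.
have t2 : cmod (\sum_(p <- r) p.1 * opw p.2 (pds u F) 0) <=
    4 * d%:R * C0 * A ^+ M * h ^+ size u * Q.
  apply: le_trans (cmod_sum _ _ _) _.
  have [M0|[m mE]] : M = 0%N \/ exists m, M = m.+1.
  - by case: (M) => [|m]; [left|right; exists m].
  - have -> : r = [::] by apply: size0nil; rewrite rs sz.
    by rewrite big_nil !mulr_ge0// exprn_ge0// ltW.
  pose B := 4 * d%:R * (C0 * A ^+ m * h ^+ size u * ((m + size u)`!%:R `^ s)).
  apply: le_trans (sum_le_size (c := B) _) _.
    move=> p pr; have [p1 p2] := rb p pr; rewrite cmodM /B.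
    apply: ler_pM; rewrite ?cmod_ge0//.
    by apply: IH; rewrite ?mE// p2 sz mE.
  have fg : M%:R * ((m + size u)`!%:R `^ s) <= Q.
    by rewrite /Q mE; exact: fact_gain.
  have c1 : 0 <= 4 * d%:R * C0 * A ^+ m * h ^+ size u.
    by rewrite !mulr_ge0// ?exprn_ge0// ltW.
  rewrite rs sz /B.
  apply: (@le_trans _ _ (4 * d%:R * C0 * A ^+ m * h ^+ size u * Q)).
    have -> : M%:R * (4 * d%:R * (C0 * A ^+ m * h ^+ size u * ((m + size u)`!%:R `^ s)))
      = 4 * d%:R * C0 * A ^+ m * h ^+ size u * (M%:R * ((m + size u)`!%:R `^ s)) by ring.
    by rewrite ler_wpM2l.
  have -> : 4 * d%:R * C0 * A ^+ M * h ^+ size u * Q =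
     A * (4 * d%:R * C0 * A ^+ m * h ^+ size u * Q) by rewrite mE exprS; ring.
  by rewrite ler_peMl// mulr_ge0.
apply: le_trans (lerD t1 t2) _.
have -> : C0 * A ^+ M * h ^+ (size u).+1 * Q + 4 * d%:R * C0 * A ^+ M * h ^+ size u * Q
   = (h + 4 * d%:R) * (C0 * A ^+ M * h ^+ size u * Q) by rewrite exprS; ring.
have -> : C0 * A ^+ M.+1 * h ^+ size u * Q = A * (C0 * A ^+ M * h ^+ size u * Q).
  by rewrite exprS; ring.
rewrite ler_wpM2r//; last by rewrite /A; lra.
by do 2 (apply: mulr_ge0 => //); rewrite ?mulr_ge0// exprn_ge0// ltW.
Qed.

End growth.

(** * Factorials and multi-indices *)

Section factorials.

Lemma bin_le_exp (n k : nat) : ('C(n, k) <= 2 ^ n)%N.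
Proof.
have [nk|nk] := ltnP n k; first by rewrite bin_small.
rewrite -[2%N]/(1 + 1)%N expnDn (bigD1 (Ordinal (nk : (k < n.+1)%N)))//=.
by rewrite !exp1n !muln1 leq_addr.
Qed.

Lemma fact_addn_le (m n : nat) : ((m + n)`! <= 2 ^ (m + n) * (m`! * n`!))%N.
Proof.
have := @bin_fact (m + n) m (leq_addr _ _); rewrite addKn => <-.
by rewrite leq_mul2r bin_le_exp orbT.
Qed.

Lemma fact_muln_le (m n : nat) : (m`! * n`! <= (m + n)`!)%N.
Proof.
have := @bin_fact (m + n) m (leq_addr _ _); rewrite addKn => <-.
by rewrite leq_pmull// bin_gt0 leq_addr.
Qed.

(** Replacing a product of factorials by the factorial of the sum costs only a
   geometric factor, harmless in all estimates of Gelfand-Shilov type. *)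
Lemma fact_sum_le (I : Type) (r : seq I) (k : I -> nat) :
  ((\sum_(i <- r) k i)`! <= (2 ^ size r) ^ (\sum_(i <- r) k i) * \prod_(i <- r) (k i)`!)%N.
Proof.
elim: r => [|i r IH]; first by rewrite !big_nil.
rewrite !big_cons /=; apply: leq_trans (fact_addn_le _ _) _.
set S := (\sum_(_ <- _) _)%N in IH *; set P := (\prod_(_ <- _) _)%N in IH *.
rewrite expnS expnMn -mulnA leq_mul2l expn_eq0 /=.
rewrite [leqRHS]mulnCA leq_mul2l; apply/orP; right.
by apply: leq_trans IH _; rewrite leq_mul2r expnD leq_pmull ?orbT// expn_gt0 expn_gt0.
Qed.

Lemma prod_fact_le (I : Type) (r : seq I) (k : I -> nat) :
  (\prod_(i <- r) (k i)`! <= (\sum_(i <- r) k i)`!)%N.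
Proof.
elim: r => [|i r IH]; first by rewrite !big_nil.
rewrite !big_cons; apply: leq_trans (fact_muln_le _ _).
by rewrite leq_mul2l IH orbT.
Qed.

End factorials.

Section multi_indices.
Context {n : nat}.
Implicit Types (a : {ffun 'I_n -> nat}) (u : seq 'I_n).

Definition mi_word a : seq 'I_n := flatten [seq nseq (a j) j | j <- enum 'I_n].

Lemma size_mi_word a : size (mi_word a) = mi_size a.
Proof.
rewrite /mi_word size_flatten /shape -map_comp sumnE big_map /mi_size big_enum /=.
by apply: eq_bigr => i _; rewrite size_nseq.
Qed.

(** Words and multi-indices are compared through the number of occurrences of each
   direction. *)
Lemma mi_word_count u : perm_eq u (mi_word [ffun j => count_mem j u]).
Proof.
apply/allP => x _ /=; apply/eqP; rewrite /mi_word count_flatten -map_comp.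
rewrite sumnE big_map big_enum /= (bigD1 x)//= big1 ?addn0 => [|j jx].
  by rewrite count_nseq ffunE /= eqxx mul1n.
by rewrite count_nseq /= (negbTE jx) mul0n.
Qed.

End multi_indices.

Lemma mi_size_fact_le {n} (a : {ffun 'I_n -> nat}) :
  ((mi_size a)`! <= (2 ^ n) ^ mi_size a * mi_fact a)%N.
Proof.
have := fact_sum_le (enum 'I_n) a.
by rewrite size_enum_ord !big_enum.
Qed.

Lemma mi_fact_le {n} (a b : {ffun 'I_n -> nat}) :
  ((mi_size a + mi_size b)`! <=
    (2 ^ n.+1) ^ (mi_size a + mi_size b) * (mi_fact a * mi_fact b))%N.
Proof.
apply: leq_trans (fact_addn_le _ _) _.
rewrite expnS expnMn -mulnA leq_mul2l expn_eq0 /= expnD mulnACA.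
by rewrite leq_mul// mi_size_fact_le.
Qed.

Section gelfand_shilov_bounds.
Context {R : realType} {n : nat}.
Local Notation C := R[i].
Local Notation V := 'rV[R]_n.

Lemma ereal_sup_bounded (S : set (\bar R)) : (ereal_sup S < +oo)%E ->
  exists2 c : R, 0 <= c & forall x : R, S x%:E -> x <= c.
Proof.
move=> Soo; exists `|fine (ereal_sup S)| => // x Sx.
have : (x%:E <= ereal_sup S)%E by exact: ereal_sup_ubound.
case: (ereal_sup S) Soo => [c| |] //= _.
by rewrite lee_fin => /le_trans; apply; exact: ler_norm.
Qed.

(** The hypothesis is in terms of multi-indices; the operators act by words. A word is
   a permutation of the word of a multi-index, whose factorial is at most the
   factorial of its order. *)
Lemma derivative_bounds (s h : R) (f : V -> C) (U Omega : set V) (X : V) :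
  0 <= s -> 0 < h -> open U -> U X -> Omega X -> smooth U f ->
  (ereal_sup
     [set ereal_sup
        [set (Normc.normc (mderiv beta f X) /
              ((mi_fact beta)%:R `^ s * h ^+ mi_size beta))%:E
          | X in Omega]
      | beta in [set: {ffun 'I_n -> nat}]] < +oo)%E ->
  exists2 C0 : R, 0 <= C0 &
    forall u, cmod (pds u f X) <= C0 * h ^+ size u * ((size u)`!%:R `^ s).
Proof.
move=> s0 h0 Uo UX OX fs sup.
pose T := ereal_sup [set ereal_sup
        [set (Normc.normc (mderiv beta f X) /
              ((mi_fact beta)%:R `^ s * h ^+ mi_size beta))%:E
          | X in Omega]
      | beta in [set: {ffun 'I_n -> nat}]].
exists `|fine T| => // u.
pose b := [ffun j => count_mem j u].
have uE := mi_word_count u.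
have : ((Normc.normc (mderiv b f X) / ((mi_fact b)%:R `^ s * h ^+ mi_size b))%:E <= T)%E.
  apply: (@le_trans _ _ (ereal_sup [set (Normc.normc (mderiv b f X) /
              ((mi_fact b)%:R `^ s * h ^+ mi_size b))%:E | X in Omega])).
    by apply: ereal_sup_ubound; exists X.
  by apply: ereal_sup_ubound; exists b.
rewrite -/T in sup; case: T sup => [c| |] //= _.
have mf0 : 0 < (mi_fact b)%:R :> R by rewrite ltr0n; apply: prodn_gt0 => j; exact: fact_gt0.
have den0 : 0 < (mi_fact b)%:R `^ s * h ^+ mi_size b by rewrite mulr_gt0 ?powR_gt0 ?exprn_gt0.
rewrite lee_fin ler_pdivrMr// => hc.
rewrite (pds_perm Uo fs uE UX) -(cmod_pderivs Uo _ fs UX).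
apply: le_trans hc _.
apply: le_trans (ler_wpM2r (ltW den0) (ler_norm c)) _.
rewrite -mulrA ler_wpM2l// mulrC (perm_size uE) size_mi_word.
apply: ler_wpM2l; first by rewrite exprn_ge0// ltW.
apply: ge0_ler_powR; rewrite ?nnegrE// ler_nat.
exact: (prod_fact_le _ b).
Qed.

Lemma pds_lin b (c c' : C) (F H : V -> C) X : smooth setT F -> smooth setT H ->
  pds b (fun Y => c * F Y + c' * H Y) X = c * pds b F X + c' * pds b H X.
Proof.
move=> Fs Hs; elim: b X => [//|j b IH] X /=.
rewrite (pd_ext openT j (fun Y _ => IH Y) (I : [set: V] X)).
apply: cdrv_pd; apply: cdrvD; apply: cdrvZ.
  exact: (smooth_drv j (smooth_pds b Fs) (I : [set: V] X)).
exact: (smooth_drv j (smooth_pds b Hs) (I : [set: V] X)).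
Qed.

End gelfand_shilov_bounds.

Lemma powR_exprn {R : realType} (x s : R) k : 0 <= x -> (x ^+ k) `^ s = (x `^ s) ^+ k.
Proof.
move=> x0; elim: k => [|k IH]; first by rewrite !expr0 powR1.
by rewrite !exprS powRM ?exprn_ge0// IH.
Qed.

Section conclusion.
Context {R : realType} {d : nat}.
Local Notation C := R[i].
Local Notation V := 'rV[R]_(d + d).
Variables (g : V -> C) (U : set V) (s C0 h : R).
Hypotheses (Uo : open U) (U0 : U 0) (gs : smooth U g).
Hypothesis gpsd : psd predT (twist g).
Hypotheses (s_half : 2^-1 <= s) (h0 : 0 < h) (C00 : 0 <= C0).
Hypothesis gb : forall u, cmod (pds u g 0) <= C0 * h ^+ size u * ((size u)`!%:R `^ s).
Local Notation G := (LRder g).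

Let A : R := h + 4 * d%:R + 1.
(* The factor [2 ^ s] pays for [(2 m)! (2 m')! <= 2 ^ (2 M) * (M!) ^ 2] when
   [M = m + m']. *)
Let B : R := A * (2 `^ s).

Let s0 : 0 <= s. Proof. by apply: le_trans s_half; rewrite invr_ge0. Qed.
Let A0 : 0 < A.
Proof. by rewrite /A ltr_wpDl// addr_ge0// ?mulr_ge0// ltW. Qed.
Let B0 : 0 < B. Proof. by rewrite mulr_gt0// powR_gt0. Qed.

(** The values at the origin needed by Cauchy-Schwarz have words of lengths [2 m] and
   [2 m']; the geometric mean of their factorials is comparable to [(m + m')!]. *)
Lemma LRder_growth w w' X :
  cmod (G w w' X) <= C0 * B ^+ (size w + size w') * ((size w + size w')`!%:R `^ s).
Proof.
have diag v : cmod (G v v 0) <= C0 * A ^+ (size v + size v) * ((size v + size v)`!%:R `^ s).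
  have := opw_growth Uo U0 s_half gs h0 C00 gb
    (ops := [seq (true, l) | l <- v] ++ [seq (false, l) | l <- v]) [::] erefl.
  by rewrite -LRder_opw size_cat !size_map expr0 mulr1 addn0.
set M := (size w + size w')%N.
rewrite -(@ler_pXn2r _ 2)// ?nnegrE ?cmod_ge0//; last first.
  by rewrite !mulr_ge0 ?powR_ge0// exprn_ge0// ltW.
apply: le_trans (LRder_bound Uo U0 gs gpsd w w' X) _.
apply: le_trans (ler_pM (cmod_ge0 _) (cmod_ge0 _) (diag w) (diag w')) _.
set m := size w; set m' := size w'.
have -> : C0 * A ^+ (m + m) * ((m + m)`!%:R `^ s) * (C0 * A ^+ (m' + m') * ((m' + m')`!%:R `^ s))
  = (C0 * A ^+ M) ^+ 2 * (((m + m)`! * (m' + m')`!)%:R `^ s).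
  rewrite natrM powRM// exprMn -exprM (_ : (M * 2 = (m + m) + (m' + m'))%N).
    by rewrite (exprD A (m + m) (m' + m')); ring.
  by rewrite /M muln2 -addnn addnACA.
have -> : (C0 * B ^+ M * (M`!%:R `^ s)) ^+ 2 = (C0 * A ^+ M) ^+ 2 *
    ((2 `^ s) ^+ M * (M`!%:R `^ s)) ^+ 2.
  have -> : B ^+ M = A ^+ M * (2 `^ s) ^+ M by rewrite /B exprMn.
  ring.
rewrite ler_wpM2l ?sqr_ge0//.
have -> : ((2 `^ s) ^+ M * (M`!%:R `^ s)) ^+ 2 = ((2 ^ (M + M) * (M`! * M`!))%:R `^ s).
  rewrite natrM natrX natrM powRM// ?powRM// powR_exprn//.
  by rewrite (exprD _ M M); ring.
apply: ge0_ler_powR; rewrite ?nnegrE// ler_nat.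
apply: leq_trans (fact_muln_le _ _) _.
have -> : (m + m + (m' + m') = M + M)%N by rewrite /M addnACA.
exact: fact_addn_le.
Qed.

Lemma LRder_smooth w w' : smooth setT (G w w').
Proof. by move=> k; exact: (LRder_ck Uo U0 gs gpsd). Qed.

(** Each derivative and each factor [ell l] is half the difference, respectively half
   the sum, of two functions [LRder] with one more letter; so a monomial of [M] such
   operations is a convex combination, up to signs, of functions with [M] more
   letters. *)
Lemma monomial_derivative_bound b v w w' X M :
  (size v + size b + size w + size w')%N = M ->
  cmod (\prod_(l <- v) ell l X * pds b (G w w') X) <= C0 * B ^+ M * (M`!%:R `^ s).
Proof.
have half (z1 z2 : C) (c : R) : cmod z1 <= c -> cmod z2 <= c ->
    cmod ((2^-1)%:C * (z1 + z2)) <= c.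
  move=> h1 h2; rewrite cmodM cmodR ger0_norm ?invr_ge0//.
  have := cmodD z1 z2; lra.
elim/last_ind: b v w w' M => [|b l IH] v w w' M.
  rewrite addn0 /=.
  elim: v w w' M => [|l v IH] w w' M /= <-.
    rewrite big_nil mul1r add0n; exact: LRder_growth.
  have -> : \prod_(j <- l :: v) ell j X * G w w' X =
      \prod_(j <- v) ell j X * (ell l X * G w w' X) by rewrite big_cons; ring.
  rewrite (LRder_ell Uo U0 gs gpsd).
  have -> : \prod_(j <- v) ell j X * ((2^-1)%:C * (G w (l :: w') X + G (l :: w) w' X))
    = (2^-1)%:C * (\prod_(j <- v) ell j X * G w (l :: w') X +
                   \prod_(j <- v) ell j X * G (l :: w) w' X) by ring.
  apply: half.
    by apply: IH; rewrite /= !addnS !addSn.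
  by apply: IH; rewrite /= !addnS !addSn.
have -> : pds (rcons b l) (G w w') X = pds b (pd l (G w w')) X.
  by rewrite /pds foldr_rcons.
have -> : pd l (G w w') = fun Y => (2^-1)%:C * G w (l :: w') Y +
    (- (2^-1)%:C) * G (l :: w) w' Y.
  apply/funext => Y; rewrite (cdrv_pd (LRder_cdrv Uo U0 gs gpsd w w' l Y)); ring.
rewrite pds_lin; [|exact: LRder_smooth|exact: LRder_smooth].
set p1 := pds b _ X; set p2 := pds b _ X; set p := \prod_(j <- v) _.
have -> : p * ((2^-1)%:C * p1 + (- (2^-1)%:C) * p2) = (2^-1)%:C * (p * p1 + - (p * p2)) by ring.
rewrite size_rcons => <-; apply: half; rewrite ?cmodN.
  by apply: IH; rewrite /= !addnS !addSn.
by apply: IH; rewrite /= !addnS !addSn.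
Qed.

(** The coordinate [i] is obtained from [ell] in the conjugate direction. *)
Lemma monom_le_ell (a : {ffun 'I_(d + d) -> nat}) X :
  `|mi_monom a X| <= cmod (\prod_(l <- map partner (mi_word a)) (ell l X : C)).
Proof.
have cnp (r : seq 'I_(d + d)) : cmod (\prod_(l <- r) (ell l X : C)) = \prod_(l <- r) cmod (ell l X : C).
  by elim: r => [|l r IH]; rewrite ?big_nil ?cmod1// !big_cons cmodM IH.
rewrite cnp /mi_word map_flatten big_flatten /= -map_comp big_map big_enum /= /mi_monom normr_prod.
apply: ler_prod => i _; rewrite normr_ge0 /= normrX.
have -> : \prod_(j <- map partner (nseq (a i) i)) cmod (ell j X) = cmod (ell (partner i) X) ^+ a i.
  rewrite big_map; elim: (a i) => [|k IH]; first by rewrite big_nil expr0.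
  by rewrite -[nseq _ _]/(i :: nseq k i) big_cons exprS IH.
apply: lerXn2r; rewrite ?nnegrE ?cmod_ge0// cmod_ell symp_partner.
by have := normr_ge0 (X ord0 i); lra.
Qed.

Lemma gelfand_shilov_of_psd : gelfand_shilov s g.
Proof.
have gsm : smooth setT g by exact: (LRder_smooth [::] [::]).
split; first by apply/(smooth_onP openT).
(* The cost of passing from the factorial of the order to the factorials of the two
   multi-indices. *)
pose D : R := (2 ^ (d + d).+1)%:R `^ s.
have D0 : 0 < D by rewrite powR_gt0// ltr0n expn_gt0.
exists (B * D); split; first exact: mulr_gt0.
apply: (@le_lt_trans _ _ C0%:E); last exact: ltry.
apply: ge_ereal_sup => _ [[a b] _ <-]; apply: ge_ereal_sup => _ [X _ <-] /=.
rewrite lee_fin.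
set M := (mi_size a + mi_size b)%N.
have mf0 : 0 < (mi_fact a * mi_fact b)%:R :> R.
  by rewrite ltr0n muln_gt0 !prodn_gt0// => j; exact: fact_gt0.
have den0 : 0 < (mi_fact a * mi_fact b)%:R `^ s * (B * D) ^+ M.
  by rewrite mulr_gt0 ?powR_gt0 ?exprn_gt0// mulr_gt0.
rewrite ler_pdivrMr//.
have -> : Normc.normc ((mi_monom a X)%:C * mderiv b g X) =
    `|mi_monom a X| * cmod (pds (mi_word b) g X).
  by rewrite -(cmod_pderivs openT (mi_word b) gsm (I : [set: V] X)) -cmodR -cmodM.
apply: le_trans (ler_wpM2r (cmod_ge0 _) (monom_le_ell a X)) _.
rewrite -cmodM.
have MM : (size (map partner (mi_word a)) + size (mi_word b) + size ([::] : seq 'I_(d + d)) +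
    size ([::] : seq 'I_(d + d)))%N = M.
  by rewrite size_map !size_mi_word /= !addn0.
apply: le_trans (monomial_derivative_bound X MM) _.
rewrite (_ : _ * (B * D) ^+ M = B ^+ M * (D ^+ M * (mi_fact a * mi_fact b)%:R `^ s)); last first.
  by rewrite exprMn; ring.
rewrite [leRHS]mulrA; apply: ler_wpM2l.
  by rewrite mulr_ge0// exprn_ge0// ltW.
have -> : D ^+ M * (mi_fact a * mi_fact b)%:R `^ s =
    (((2 ^ (d + d).+1) ^ M * (mi_fact a * mi_fact b))%:R `^ s).
  rewrite [in RHS]natrM powRM// natrX; congr (_ * _).
  by rewrite /D powR_exprn.
by apply: ge0_ler_powR; rewrite ?nnegrE// ler_nat mi_fact_le.
Qed.

End conclusion.

(** * Integration over the coordinate space *)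

Section tuple_integral.
Context {R : realType}.
Local Notation RR := (measurableTypeR R).
Local Notation T n := (n.-tuple RR).
Local Notation mu n := (lebesgue_tuple R n).
Local Notation leb := (@lebesgue_measure R).

Lemma ge0_integral_tuple0 (f : T 0 -> \bar R) :
  (forall t, (0 <= f t)%E) -> (\int[mu 0]_t f t = f [tuple])%E.
Proof.
move=> f0; have fE : f = cst (f [tuple]) by apply/funext => t; rewrite (tuple0 t).
rewrite fE integral_cst//= /dirac indicE mem_set//; exact: mule1.
Qed.

Lemma ge0_integral_tupleS n (f : T n.+1 -> \bar R) :
  measurable_fun [set: T n.+1] f -> (forall t, (0 <= f t)%E) ->
  (\int[mu n.+1]_t f t = \int[leb]_x \int[mu n]_t f [tuple of x :: t])%E.
Proof.
move=> mf f0.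
have mc := @measurable_tuple_cons R n.
transitivity (\int[pushforward (leb \x mu n)%E (@tuple_cons R n)]_t f t)%E.
  exact: eq_measure_integral.
rewrite ge0_integral_pushforward//= preimage_setT.
rewrite (fubini_tonelli1 (f \o @tuple_cons R n))//=.
exact: measurableT_comp.
Qed.

Section invariance.
Variables (n : nat).

Definition tmap (phi : nat -> R -> R) (t : T n) : T n :=
  [tuple phi i (tnth t i) | i < n].

Lemma measurable_tmap phi : (forall i, measurable_fun [set: RR] (phi i : RR -> RR)) ->
  measurable_fun [set: T n] (tmap phi).
Proof.
move=> mphi; apply/measurable_fun_tnthP => i.
rewrite (_ : _ \o _ = phi i \o (@tnth n RR ^~ i)).
  by apply: measurableT_comp => //; exact: measurable_tnth.
by apply/funext => t /=; rewrite tnth_mktuple.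
Qed.

End invariance.

Lemma tmap_cons n phi (x : R) (t : T n) :
  tmap phi [tuple of x :: t] = [tuple of phi 0%N x :: tmap (phi \o S) t].
Proof.
apply: eq_from_tnth => i; rewrite tnth_mktuple.
have [->|i0] := eqVneq i ord0; first by rewrite !tnth0.
have i1n : (i.-1 < n)%N by rewrite prednK ?lt0n// -ltnS.
have -> : i = lift ord0 (Ordinal i1n).
  by apply/val_inj => /=; rewrite /bump/= add1n prednK// lt0n.
by rewrite !tnthS tnth_mktuple.
Qed.

Definition preserves (phi : R -> R) := measurable_fun [set: RR] (phi : RR -> RR) /\
  forall f : RR -> \bar R, measurable_fun [set: RR] f -> (forall x, (0 <= f x)%E) ->
    (\int[leb]_x f (phi x) = \int[leb]_x f x)%E.

(** Reflections and translations act coordinatewise, so invariance of the integral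
   reduces to one coordinate, by induction on the dimension. *)
Lemma ge0_integral_tmap n phi (f : T n -> \bar R) :
  (forall i, preserves (phi i)) -> measurable_fun [set: T n] f -> (forall t, (0 <= f t)%E) ->
  (\int[mu n]_t f (tmap phi t) = \int[mu n]_t f t)%E.
Proof.
elim: n phi f => [|n IH] phi f pp mf f0.
  by rewrite !ge0_integral_tuple0//; congr f; apply: eq_from_tnth => -[].
rewrite !ge0_integral_tupleS//; last first.
  by apply: measurableT_comp => //; apply: measurable_tmap => i; exact: (pp i).1.
have mf' x : measurable_fun [set: T n] (fun t : T n => f [tuple of x :: t]).
  by apply: measurableT_comp => //; exact: measurable_cons.
have mF : measurable_fun [set: RR] (fun x : RR => \int[mu n]_t f [tuple of x :: t])%E.
  have := @measurable_fun_fubini_tonelli_F _ _ _ _ R (mu n) (f \o @tuple_cons R n).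
  apply; last by move=> z; exact: f0.
  by apply: measurableT_comp => //; exact: measurable_tuple_cons.
transitivity (\int[leb]_x (fun x => \int[mu n]_t f [tuple of x :: t]) (phi 0%N x))%E.
  apply: eq_integral => x _.
  have pS i : preserves ((phi \o S) i) by exact: pp.
  rewrite -[RHS](IH (phi \o S) _ pS)//=.
  by apply: eq_integral => t _; rewrite tmap_cons.
by apply: (pp 0%N).2 => // x; exact: integral_ge0.
Qed.

Lemma integral_tmap n phi (f : T n -> \bar R) :
  (forall i, preserves (phi i)) -> measurable_fun [set: T n] f ->
  (\int[mu n]_t f (tmap phi t) = \int[mu n]_t f t)%E.
Proof.
move=> pp mf; rewrite integralE [RHS]integralE.
congr (_ - _)%E.
  transitivity (\int[mu n]_t (f^\+ (tmap phi t)))%E.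
    by apply: eq_integral => t _; rewrite unlock.
  apply: (ge0_integral_tmap pp) => //; exact: measurable_funepos.
transitivity (\int[mu n]_t (f^\- (tmap phi t)))%E.
  by apply: eq_integral => t _; rewrite unlock.
apply: (ge0_integral_tmap pp) => //; exact: measurable_funeneg.
Qed.

Lemma preserves_opp : preserves -%R.
Proof.
split; first exact: oppr_measurable.
move=> f mf f0; rewrite -[RHS](@eq_measure_integral _ _ _ _ _ (pushforward leb (-%R : RR -> RR))).
  by rewrite ge0_integral_pushforward// preimage_setT.
by move=> A mA _; exact: lebesgue_measureN.
Qed.

Lemma preserves_shift (a : R) : preserves (fun x => x + a).
Proof.
have ma : measurable_fun [set: RR] ((fun x => x + a) : RR -> RR).
  exact: measurable_funD.
split => // f mf f0.
rewrite -[RHS](@eq_measure_integral _ _ _ _ _ (pushforward leb ((fun x => x + a) : RR -> RR))).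
  by rewrite ge0_integral_pushforward// preimage_setT.
move=> A mA _; apply/esym/lebesgue_measure_unique => //= _ [[b c]] _ <-.
rewrite /pushforward.
have -> : (fun x => x + a) @^-1` `]b, c]%classic = `]b - a, c - a]%classic.
  by apply/seteqP; split => x /=; rewrite !in_itv /= ltrBlDr lerBrDr.
rewrite !lebesgue_measure_itv /= !lte_fin ltrD2r.
by case: ifP => // _; congr EFin; ring.
Qed.

Lemma preserves_affine (s a : R) : s = 1 \/ s = -1 -> preserves (fun x => s * x + a).
Proof.
move=> s1; have [m1 p1] := preserves_shift a; have [m2 p2] := preserves_opp.
case: s1 => ->.
  under eq_fun do rewrite mul1r; exact: preserves_shift.
split.
  under eq_fun do rewrite mulN1r.
  exact: (@measurableT_comp _ _ _ _ _ _ (fun x : RR => x + a) _ (-%R : RR -> RR)).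
move=> f mf f0; under eq_integral do rewrite mulN1r.
rewrite (p2 (fun x => f (x + a)))//; first exact: p1.
by apply: measurableT_comp.
Qed.

Lemma ge0_integral_prod n (b : R -> R) (c : R) : measurable_fun [set: RR] (b : RR -> R) ->
  (forall x, 0 <= b x) -> (\int[leb]_x (b x)%:E = c%:E)%E ->
  (\int[mu n]_t (\prod_(i < n) b (tnth t i))%:E = (c ^+ n)%:E)%E.
Proof.
move=> mb b0 bc; elim: n => [|n IH].
  rewrite ge0_integral_tuple0 ?big_ord0 ?expr0// => t.
  by rewrite lee_fin prodr_ge0.
have mprod k : measurable_fun [set: T k] (fun t : T k => \prod_(i < k) b (tnth t i)).
  apply: measurable_prod => i _.
  by apply: (measurableT_comp mb); exact: measurable_tnth.
rewrite ge0_integral_tupleS; last 2 first.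
- apply/measurable_EFinP; exact: mprod.
- by move=> t; rewrite lee_fin prodr_ge0.
transitivity (\int[leb]_x ((b x)%:E * (c ^+ n)%:E))%E.
  apply: eq_integral => x _; rewrite -IH -ge0_integralZl//; last 3 first.
  - apply/measurable_EFinP; exact: mprod.
  - by move=> t _; rewrite lee_fin prodr_ge0.
  - by rewrite lee_fin.
  apply: eq_integral => t _; rewrite big_ord_recl tnth0 EFinM.
  by congr (_ * _)%E; congr EFin; apply: eq_bigr => i _; rewrite tnthS.
have c0 : 0 <= c by rewrite -lee_fin -bc; apply: integral_ge0 => x _; rewrite lee_fin.
rewrite ge0_integralZr//; last 3 first.
- by apply/measurable_EFinP; exact: mb.
- by move=> x _; rewrite lee_fin.
- by rewrite lee_fin exprn_ge0.
by rewrite bc -EFinM exprS.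
Qed.

Lemma integral_oneDsqrV : (\int[leb]_x ((@oneDsqr R x)^-1)%:E = pi%:E)%E.
Proof.
rewrite ge0_symfun_integralT.
- rewrite -set_itvcy integral0y_oneDsqr -EFinM; congr EFin; by field.
- by move=> x; rewrite invr_ge0 ltW// oneDsqr_gt0.
- exact: continuous_oneDsqrV.
- by move=> x; rewrite /= /oneDsqr /= sqrrN.
Qed.

End tuple_integral.

Section real_integral.
Context {R : realType} {n : nat}.
Local Notation RR := (measurableTypeR R).
Local Notation T := (n.-tuple RR).
Local Notation V := 'rV[R]_n.
Local Notation mu := (lebesgue_tuple R n).

Definition tup2row (t : T) : V := \row_i tnth t i.

(** The sigma-algebra on tuples is generated by the coordinates, not by open sets: a
   continuous function is the pointwise limit of its values on finer and finer
   grids, which are countably valued functions of the integer parts. *)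
Lemma continuous_measurable_row (h : V -> R) :
  (forall x, {for x, continuous h}) -> measurable_fun [set: T] (h \o tup2row).
Proof.
move=> hc.
pose e (k : nat) (t : T) : n.-tuple int := [tuple Num.floor (tnth t i * k.+1%:R) | i < n].
pose p (k : nat) (z : n.-tuple int) : V := \row_i ((tnth z i)%:~R / k.+1%:R).
apply: (@measurable_fun_cvg _ T R setT (fun k t => h (p k (e k t)))); last first.
  move=> t _; apply: (@cvg_comp _ _ _ (fun k => p k (e k t)) h _ (nbhs (tup2row t))).
    apply/cvgrPdist_le => eps eps0.
    exists (Num.truncn eps^-1) => // k /= Nk.
    apply: norm_le => [|i]; first exact: ltW.
    rewrite !mxE tnth_mktuple.
    have k0 : 0 < k.+1%:R :> R by [].
    set x := tnth t i.
    have /andP[f1 f2] := floor_itv (x * k.+1%:R).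
    have -> : x - (Num.floor (x * k.+1%:R))%:~R / k.+1%:R =
        (x * k.+1%:R - (Num.floor (x * k.+1%:R))%:~R) / k.+1%:R by field.
    rewrite normrM normfV (gtr0_norm k0) ler_pdivrMr//.
    apply: (@le_trans _ _ 1).
      rewrite intrD in f2; rewrite ler_norml; apply/andP; split; lra.
    rewrite -ler_pdivrMl// mulr1.
    apply: le_trans (ltW (truncnS_gt _)) _; rewrite ler_nat ltnS//.
  exact: hc.
move=> k _ B mB; rewrite setTI.
have -> : (fun t => h (p k (e k t))) @^-1` B =
    \bigcup_(z : n.-tuple int) (if h (p k z) \in B then e k @^-1` [set z] else set0).
  apply/seteqP; split => [t Bt|t [z _]].
    by exists (e k t) => //=; rewrite mem_set.
  by case: ifPn => // /set_mem Bz /= ez; move: Bz; rewrite -ez.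
apply: countable_bigcupT_measurable; first exact: countableP.
move=> z; case: ifP => // _.
have -> : e k @^-1` [set z] = \bigcap_(i in [set: 'I_n])
    ((@tnth n RR ^~ i) @^-1` [set x : R | Num.floor (x * k.+1%:R) = tnth z i]).
  apply/seteqP; split => [t /= <- i _ /=|t H /=]; first by rewrite tnth_mktuple.
  by apply: eq_from_tnth => i; rewrite tnth_mktuple; exact: H.
apply: fin_bigcap_measurable; first exact: finite_finset.
move=> i _; rewrite -[X in measurable X]setTI; apply: measurable_tnth => //.
have -> : [set x : R | Num.floor (x * k.+1%:R) = tnth z i] =
    `[(tnth z i)%:~R / k.+1%:R, (tnth z i + 1)%:~R / k.+1%:R[%classic.
  apply/seteqP; split => x /=; rewrite in_itv /= ler_pdivrMr// ltr_pdivlMr//.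
    by move=> <-; exact: floor_itv.
  by move=> h1; apply: floor_def.
exact: measurable_itv.
Qed.

(** The function [1 / (1 + x ^ 2)] has integral [pi], so this product is integrable in
   any dimension; it serves as a dominating function. *)
Definition weight (x : V) : R := \prod_i (oneDsqr (x ord0 i))^-1.

Lemma weight_gt0 x : 0 < weight x.
Proof. by apply: prodr_gt0 => i _; rewrite invr_gt0 (lt_le_trans ltr01). Qed.

Definition rdom (h : V -> R) := mu.-integrable setT (EFin \o (h \o tup2row)).

Definition rint (h : V -> R) : R := \int[mu]_t h (tup2row t).

Lemma weight_integrable (c : R) : mu.-integrable setT (EFin \o (fun t => c * weight (tup2row t))).
Proof.
have wE t : weight (tup2row t) = \prod_(i < n) (oneDsqr (tnth t i))^-1.
  by apply: eq_bigr => i _; rewrite mxE.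
have mw : measurable_fun [set: RR] (fun x : RR => (oneDsqr (x : R))^-1).
  by apply: continuous_measurable_fun; exact: continuous_oneDsqrV.
have mww : measurable_fun [set: T] (fun t : T => weight (tup2row t)).
  under eq_fun do rewrite wE.
  apply: measurable_prod => i _.
  by apply: (measurableT_comp mw); exact: measurable_tnth.
apply: (@integrableZl _ _ _ mu setT measurableT c (EFin \o (fun t => weight (tup2row t)))).
apply/integrableP; split; first exact/measurable_EFinP.
under eq_integral do rewrite /= (ger0_norm (ltW (weight_gt0 _))) wE.
rewrite (ge0_integral_prod n mw _ integral_oneDsqrV) ?ltry//.
Qed.

Lemma rdom_weight (c : R) h : 0 <= c -> (forall x, {for x, continuous h}) ->
  (forall x, `|h x| <= c * weight x) -> rdom h.
Proof.
move=> c0 hc hb; apply: le_integrable (weight_integrable c) => //.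
  by apply/measurable_EFinP; exact: continuous_measurable_row.
move=> t _ /=; rewrite lee_fin [leRHS]ger0_norm//.
by rewrite mulr_ge0// ltW// weight_gt0.
Qed.

Lemma rdom_measurable h : rdom h -> measurable_fun [set: T] (h \o tup2row).
Proof. by move=> /measurable_int /measurable_EFinP. Qed.

Lemma rdomD g h : rdom g -> rdom h -> rdom (fun x => g x + h x).
Proof.
by move=> gi hi; apply: eq_integrable (integrableD measurableT gi hi).
Qed.

Lemma rdomZ c h : rdom h -> rdom (fun x => c * h x).
Proof. by move=> hi; apply: eq_integrable (integrableZl measurableT c hi). Qed.

Lemma rintD g h : rdom g -> rdom h -> rint (fun x => g x + h x) = rint g + rint h.
Proof. by move=> gi hi; exact: RintegralD. Qed.

Lemma rintZ c h : rdom h -> rint (fun x => c * h x) = c * rint h.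
Proof. by move=> hi; exact: RintegralZl. Qed.

Lemma rint_le g h : rdom g -> rdom h -> (forall x, g x <= h x) -> rint g <= rint h.
Proof.
move=> gi hi gh.
by apply: le_Rintegral.
Qed.

Lemma rint_ge0 h : (forall x, 0 <= h x) -> 0 <= rint h.
Proof. by move=> h0; exact: Rintegral_ge0. Qed.

Lemma rdom_abs h : rdom h -> rdom (fun x => `|h x|).
Proof. by move=> hi; apply: eq_integrable (integrable_abse hi). Qed.

Lemma rint_abs h : rdom h -> `|rint h| <= rint (fun x => `|h x|).
Proof. by move=> hi; exact: le_normr_Rintegral. Qed.

Section affine.
Variables (s : R) (w : V).
Hypothesis s1 : s = 1 \/ s = -1.

Let phi (i : nat) (x : R) : R := s * x + (if insub i is Some j then w ord0 j else 0).

Let phi_preserves i : preserves (phi i). Proof. exact: preserves_affine. Qed.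

Let phiE t : s *: tup2row t + w = tup2row (tmap phi t).
Proof. by apply/rowP => i; rewrite !mxE tnth_mktuple /phi valK. Qed.

Lemma rdom_affine h : rdom h -> rdom (fun x => h (s *: x + w)).
Proof.
move=> hi; have mh := rdom_measurable hi; apply/integrableP; split.
  apply/measurable_EFinP.
  rewrite (_ : _ \o _ = (h \o tup2row) \o tmap phi); last first.
    by apply/funext => t /=; rewrite phiE.
  by apply: measurableT_comp => //; apply: measurable_tmap => i; exact: (phi_preserves i).1.
move/integrableP : hi => [_].
rewrite -(@ge0_integral_tmap R n phi (fun t => `|(EFin \o (h \o tup2row)) t|%E))//.
  by apply: le_lt_trans; rewrite le_eqVlt; apply/orP; left; apply/eqP;
    apply: eq_integral => t _ /=; rewrite phiE.
by apply: measurableT_comp => //; exact/measurable_EFinP.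
Qed.

Lemma rint_affine h : rdom h -> rint (fun x => h (s *: x + w)) = rint h.
Proof.
move=> hi; rewrite /rint /Rintegral -[in RHS](@integral_tmap R n phi)//; last first.
  by apply/measurable_EFinP; exact: rdom_measurable.
congr fine; apply: eq_integral => t _; congr (h _)%:E; exact: phiE.
Qed.

End affine.

Lemma rdom_shift h w : rdom h -> rdom (fun x => h (x + w)).
Proof.
move=> /(rdom_affine w (or_introl erefl)).
by under eq_fun do rewrite scale1r.
Qed.

Lemma rint_shift h w : rdom h -> rint (fun x => h (x + w)) = rint h.
Proof.
move=> /(rint_affine w (or_introl erefl)) <-.
by congr rint; apply/funext => x; rewrite scale1r.
Qed.

(** Integrate over [z] first: the inner integral is then a translate of [rint a]. *)
Lemma rint_conv (a b : V -> R) : rdom a -> rdom b ->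
  (forall z, rdom (fun y => a (z + y) * b y)) ->
  rdom (fun z => rint (fun y => a (z + y) * b y)) /\
  rint (fun z => rint (fun y => a (z + y) * b y)) = rint a * rint b.
Proof.
move=> ai bi abi.
have ma := rdom_measurable ai; have mb := rdom_measurable bi.
pose f (p : T * T) : \bar R := (a (tup2row p.1 + tup2row p.2) * b (tup2row p.2))%:E.
have mf : measurable_fun [set: T * T] f.
  apply/measurable_EFinP; apply: measurable_funM; last first.
    by apply: (measurableT_comp mb); exact: measurable_snd.
  pose add (p : T * T) : T := [tuple tnth p.1 i + tnth p.2 i | i < n].
  rewrite (_ : (fun p => _) = (a \o tup2row) \o add); last first.
    apply/funext => p /=; congr a; apply/rowP => i; rewrite !mxE.
    by rewrite tnth_mktuple.
  apply: (measurableT_comp ma); apply/measurable_fun_tnthP => i.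
  rewrite (_ : _ \o _ = (fun p : T * T => tnth p.1 i + tnth p.2 i)); last first.
    by apply/funext => p /=; rewrite tnth_mktuple.
  apply: measurable_funD.
    by apply: (measurableT_comp (measurable_tnth i)); exact: measurable_fst.
  by apply: (measurableT_comp (measurable_tnth i)); exact: measurable_snd.
have inner t' : (\int[mu]_t f (t, t') = (rint a * b (tup2row t'))%:E)%E.
  have sa := rdom_shift (tup2row t') ai.
  rewrite -(rint_shift (tup2row t') ai) mulrC -(rintZ _ sa) /rint /Rintegral fineK.
    by apply: eq_integral => t _; rewrite /f /= mulrC.
  exact: integrable_fin_num (rdomZ _ sa).
have fi : ((mu \x mu)%E).-integrable setT f.
  apply/(integrable21ltyP mu mu mf).
  have : (\int[mu]_t' (rint (fun x => `|a x|) * `|b (tup2row t')|)%:E < +oo)%E.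
    have /integrableP[_] := rdomZ (rint (fun x => `|a x|)) (rdom_abs bi).
    apply: le_lt_trans; apply: ge0_le_integral => //.
    - by move=> t _; rewrite lee_fin mulr_ge0// rint_ge0.
    - by have /measurable_int := rdomZ (rint (fun x => `|a x|)) (rdom_abs bi).
    - by apply: measurableT_comp => //; have /measurable_int := rdomZ (rint (fun x => `|a x|)) (rdom_abs bi).
    - by move=> t _ /=; rewrite lee_fin ler_norm.
  apply: le_lt_trans; rewrite le_eqVlt; apply/orP; left; apply/eqP.
  apply: eq_integral => t' _.
  have sa := rdom_shift (tup2row t') (rdom_abs ai).
  rewrite -(rint_shift (tup2row t') (rdom_abs ai)) mulrC -(rintZ _ sa) /rint /Rintegral fineK.
    by apply: eq_integral => t _; rewrite /f /= normrM mulrC.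
  exact: integrable_fin_num (rdomZ _ sa).
have outer t : fubini_F mu f t = (rint (fun y => a (tup2row t + y) * b y))%:E.
  by rewrite /fubini_F /rint /Rintegral fineK//; exact: integrable_fin_num (abi (tup2row t)).
split.
  have := integrable_fubini_F fi.
  by apply: eq_integrable => // t _; rewrite outer.
have := Fubini fi.
rewrite (eq_integral (fun t => (rint (fun y => a (tup2row t + y) * b y))%:E)); last first.
  by move=> t _; exact: outer.
rewrite [RHS](eq_integral (fun t' => (rint a * b (tup2row t'))%:E)); last first.
  by move=> t' _; exact: inner.
by move=> E; rewrite -(rintZ _ bi) /rint /Rintegral -E.
Qed.

(** On a box around the origin [h] exceeds half of [h 0], and the box has positive
   measure. *)
Lemma rint_gt0 h : rdom h -> (forall x, 0 <= h x) -> {for 0, continuous h} -> 0 < h 0 ->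
  0 < rint h.
Proof.
move=> hi h0 hc hp.
have /cvgr_gt/(_ (h 0 / 2)) := hc.
rewrite ltr_pdivrMr// mulr_natr mulr2n ltrDl => /(_ hp) /nbhs_ballP[d /= d0 hd].
pose e : R := d / 2; have e0 : 0 < e by rewrite divr_gt0.
pose b (t : R) : R := \1_(`[- e, e]%classic) t.
have mb : measurable_fun [set: RR] (b : RR -> R) by exact: measurable_indic.
have b0 t : 0 <= b t by rewrite /b indicE.
have bi : (\int[lebesgue_measure]_x (b x)%:E = (e + e)%:E)%E.
  rewrite integral_indic// setIT.
  have /= -> := @lebesgue_measure_itv R `[- e, e].
  by rewrite lte_fin ifT ?gtrN// -EFinB opprK.
have pI := @ge0_integral_prod R n b (e + e) mb b0 bi.
have lt0 : 0 < h 0 / 2 * (e + e) ^+ n.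
  by rewrite mulr_gt0 ?divr_gt0 ?exprn_gt0// addr_gt0.
apply: lt_le_trans lt0 _; rewrite -lee_fin.
have -> : (rint h)%:E = (\int[mu]_t (h (tup2row t))%:E)%E.
  by rewrite /rint /Rintegral fineK//; exact: integrable_fin_num hi.
rewrite EFinM -pI -ge0_integralZl//; last 3 first.
- apply/measurable_EFinP; apply: measurable_prod => i _.
  by apply: (measurableT_comp mb); exact: measurable_tnth.
- by move=> t _; rewrite lee_fin prodr_ge0.
- by rewrite lee_fin divr_ge0.
apply: ge0_le_integral => //.
- by move=> t _; rewrite mule_ge0// lee_fin ?divr_ge0// prodr_ge0.
- apply: measurable_funeM; apply/measurable_EFinP; apply: measurable_prod => i _.
  by apply: (measurableT_comp mb); exact: measurable_tnth.
- by apply/measurable_EFinP; exact: rdom_measurable.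
move=> t _; rewrite -EFinM lee_fin.
have [tb|tb] := pselect (forall i, `|tnth t i| <= e).
  rewrite big1 ?mulr1 => [|i _]; last first.
    by rewrite /b indicE mem_set//= in_itv /= -ler_norml.
  apply/ltW/hd; rewrite -ball_normE /= sub0r normrN.
  apply: (@le_lt_trans _ _ e); last by rewrite /e; lra.
  by apply: norm_le => [|i]; [exact: ltW|rewrite mxE].
have [i ti] : exists i, ~ `|tnth t i| <= e by apply/existsNP.
rewrite (bigD1 i)//= {1}/b indicE memNset ?mul0r ?mulr0//.
by rewrite /= in_itv /= -ler_norml.
Qed.

End real_integral.

(** * Smooth functions of one variable *)

Section one_variable.
Context {R : realType}.
Implicit Types (u v : R -> R) (x : R).

Fixpoint ck1 (k : nat) u : Prop := if k is k'.+1 then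
    exists u', (forall x, is_derive x (1 : R) u (u' x)) /\ ck1 k' u'
  else forall x, {for x, continuous u}.

Lemma is_derive_cont u x l : is_derive x (1 : R) u l -> {for x, continuous u}.
Proof. by move=> [h _]; apply/differentiable_continuous/derivable1_diffP. Qed.

Lemma ck1_cont k u : ck1 k u -> forall x, {for x, continuous u}.
Proof. by case: k => [|k]//= [u' [h _]] x; exact: is_derive_cont (h x). Qed.

Lemma ck1W k u : ck1 k.+1 u -> ck1 k u.
Proof.
elim: k u => [|k IH] u; first by move=> h; exact: ck1_cont h.
by move=> [u' [h1 h2]]; exists u'; split => //; apply: IH.
Qed.

Lemma ck1_cst k (c : R) : ck1 k (fun=> c).
Proof.
elim: k c => [|k IH] c; first by move=> x; exact: cst_continuous.
by exists (fun=> 0); split => // x; exact: is_derive_cst.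
Qed.

Lemma ck1D k u v : ck1 k u -> ck1 k v -> ck1 k (fun x => u x + v x).
Proof.
elim: k u v => [|k IH] u v; first by move=> h1 h2 x; exact: continuousD (h1 x) (h2 x).
move=> [u' [h1 h2]] [v' [h3 h4]]; exists (fun x => u' x + v' x); split; last exact: IH.
by move=> x; apply: is_derive_ext (is_deriveD (h1 x) (h3 x)) _ _.
Qed.

Lemma ck1M k u v : ck1 k u -> ck1 k v -> ck1 k (fun x => u x * v x).
Proof.
elim: k u v => [|k IH] u v; first by move=> h1 h2 x; exact: continuousM (h1 x) (h2 x).
move=> hu hv; have hu' := ck1W hu; have hv' := ck1W hv.
have [u' [h1 h2]] := hu; have [v' [h3 h4]] := hv.
exists (fun x => u' x * v x + u x * v' x); split; last by apply: ck1D; exact: IH.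
move=> x; apply: is_derive_ext (is_deriveM (h1 x) (h3 x)) _ _ => //.
by rewrite addrC; congr (_ + _); rewrite /GRing.scale /= mulrC.
Qed.

Lemma ck1V k u : (forall x, u x != 0) -> ck1 k u -> ck1 k (fun x => (u x)^-1).
Proof.
move=> u0; elim: k => [|k IH].
  by move=> h x; apply: continuousV (h x).
move=> hu; have uV := IH (ck1W hu); have [u' [h1 h2]] := hu.
exists (fun x => (-1) * ((u x)^-1 * (u x)^-1) * u' x); split.
  move=> x; apply: is_derive_ext (is_deriveV (u0 x) (h1 x)) _ _ => //.
  by rewrite /GRing.scale /= expr2 invfM mulN1r.
by apply: ck1M h2; apply: ck1M (ck1_cst _ _) _; exact: ck1M.
Qed.

Lemma ck1_affine k u (s b : R) : ck1 k u -> ck1 k (fun x => u (s * x + b)).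
Proof.
have dl x : is_derive x (1 : R) (fun x => s * x + b) s.
  apply: is_derive_ext (is_deriveD (is_deriveZ s (is_derive_id x (1 : R)))
     (is_derive_cst b x (1 : R))) _ _ => //.
  by rewrite addr0 /GRing.scale /= mulr1.
elim: k u => [|k IH] u.
  by move=> h x; apply: (continuous_comp (is_derive_cont (dl x))); exact: h.
move=> [u' [h1 h2]]; exists (fun x => s * u' (s * x + b)); split; last first.
  exact: ck1M (ck1_cst _ _) (IH _ h2).
move=> x; rewrite mulrC.
exact: (@is_derive1_comp R u (fun x => s * x + b) x _ _ (h1 (s * x + b)) (dl x)).
Qed.

(** The functions [x ^- m * exp (- 1 / x)], extended by [0] to [x <= 0]: their
   span is stable under differentiation. *)
Definition flat (m : nat) x : R := if 0 < x then x^-1 ^+ m * expR (- x^-1) else 0.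

(** This is [y ^ (m + 1) / (m + 1)! <= exp y] for [y = 1 / x]. *)
Lemma flat_bound m x : `|flat m x| <= (m.+1)`!%:R * `|x|.
Proof.
rewrite /flat; case: ifPn => [x0|_]; last by rewrite normr0 mulr_ge0.
have y0 : 0 < x^-1 by rewrite invr_gt0.
rewrite (gtr0_norm x0) ger0_norm; last by rewrite mulr_ge0// ?exprn_ge0 ?expR_ge0// ltW.
have := expR_ge1Dxn m (ltW y0); rewrite expRN.
have F0 : 0 < (m.+1)`!%:R :> R by rewrite ltr0n fact_gt0.
move: ((m.+1)`!%:R : R) F0 => F F0 hE.
have E0 := expR_gt0 (x^-1).
rewrite ler_pdivrMr//.
apply: le_trans (_ : F * x * (x^-1 ^+ m.+1 / F) <= _); last first.
  by apply: ler_wpM2l; [rewrite mulr_ge0// ltW|apply: le_trans hE; rewrite lerDr].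
have -> : F * x * (x^-1 ^+ m.+1 / F) = x^-1 ^+ m; last by [].
by rewrite exprS; move: (x^-1 ^+ m) => z; field; rewrite !gt_eqF.
Qed.

Lemma flat_derive m x : is_derive x (1 : R) (flat m) (- m%:R * flat m.+1 x + flat m.+2 x).
Proof.
have [x0|x0|->] := ltgtP x 0.
- have -> : - m%:R * flat m.+1 x + flat m.+2 x = 0.
    by rewrite /flat !ltNge (ltW x0)/= mulr0 addr0.
  apply: (near_eq_is_derive _ (is_derive_cst (0 : R) x (1 : R))).
  near=> y; rewrite /flat ltNge ifN// negbK ltW//.
  by near: y; exact: lt_nbhsl.
- have dV : is_derive x (1 : R) (fun y => y^-1) (- x ^- 2).
    apply: is_derive_ext (is_deriveV _ (is_derive_id x (1 : R))) _ _ => //.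
      by rewrite gt_eqF.
    by rewrite /GRing.scale /= mulr1.
  have dE : is_derive (x^-1) (1 : R) (fun z => z ^+ m * expR (- z))
      (m%:R * x^-1 ^+ m.-1 * expR (- x^-1) - x^-1 ^+ m * expR (- x^-1)).
    have d1 := @is_derive1_comp R expR -%R (x^-1) _ _
      (is_derive_expR (- x^-1)) (is_deriveN (is_derive_id (x^-1) (1 : R))).
    have d2 := is_deriveX m (is_derive_id (x^-1) (1 : R)).
    apply: is_derive_ext (is_deriveM d2 d1) _ _.
      by apply/funext => z; rewrite !fctE.
    by rewrite /GRing.scale /= !fctE; ring.
  have FE : \near x, (x^-1) ^+ m * expR (- x^-1) = flat m x.
    near=> y; rewrite /flat ifT//.
    by near: y; exact: lt_nbhsr.
  apply: (near_eq_is_derive FE).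
  suff -> : - m%:R * flat m.+1 x + flat m.+2 x =
      (m%:R * x^-1 ^+ m.-1 * expR (- x^-1) - x^-1 ^+ m * expR (- x^-1)) * (- x ^- 2).
    exact: (@is_derive1_comp R (fun z => z ^+ m * expR (- z)) (fun y => y^-1) _ _ _ dE dV).
  by rewrite /flat x0 -exprVn; case: m {dE FE} => [|m] /=; rewrite !exprS ?expr0; ring.
have F k : flat k 0 = 0 by rewrite /flat ltxx.
rewrite !F mulr0 addr0.
apply/derive_dist => e e0; exists (e / (m.+2)`!%:R).
  by rewrite divr_gt0// ltr0n fact_gt0.
move=> t td; rewrite F add0r subr0 mulr0 subr0 /GRing.scale /= mulr1.
have -> : flat m t = t * flat m.+1 t.
  rewrite /flat; case: ifPn => [t0|_]; last by rewrite mulr0.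
  by rewrite exprS -mulrA mulVKf// gt_eqF.
rewrite normrM mulrC; apply: ler_wpM2r => //.
apply: (le_trans (flat_bound _ _)).
by rewrite mulrC -ler_pdivlMr ?ltr0n ?fact_gt0// ltW.
Unshelve. all: by end_near.
Qed.

Lemma ck1_flat k m : ck1 k (flat m).
Proof.
elim: k m => [|k IH] m; first by move=> x; exact: is_derive_cont (flat_derive m x).
exists (fun x => - m%:R * flat m.+1 x + flat m.+2 x); split; first exact: flat_derive.
by apply: ck1D; [apply: ck1M (ck1_cst _ _) _|]; exact: IH.
Qed.

Definition sm1 u := forall k, ck1 k u.

Definition dn (k : nat) u : R -> R := iter k (fun v x => 'D_(1 : R) v x) u.

Lemma sm1_derive u : sm1 u -> forall x, is_derive x (1 : R) u (dn 1 u x).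
Proof. by move=> /(_ 1%N)[u' [h _]] x; have [h1 h2] := h x; rewrite /dn /= h2. Qed.

Lemma sm1_dn1 u : sm1 u -> sm1 (dn 1 u).
Proof.
move=> su k; have [u' [h1 h2]] := su k.+1.
suff -> : dn 1 u = u' by [].
by apply/funext => x; have [_] := h1 x.
Qed.

Lemma sm1_dn k u : sm1 u -> sm1 (dn k u).
Proof. by elim: k => //= k IH /IH; exact: sm1_dn1. Qed.

Lemma bounded_of_support u (M : R) : (forall x, {for x, continuous u}) ->
  (forall x, M < `|x| -> u x = 0) -> exists2 B : R, 0 <= B & forall x, `|u x| <= B.
Proof.
move=> uc u0; have M0 : - `|M| <= `|M| by rewrite lerNl (le_trans _ (normr_ge0 M))// lerNl oppr0.
have cu : {within `[- `|M|, `|M|], continuous (fun x => `|u x|)}.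
  apply: continuous_subspaceT => x; apply: (continuous_comp (uc x)).
  exact: norm_continuous.
have [c _ hc] := EVT_max M0 cu.
exists `|u c| => // x; have [xM|Mx] := leP `|x| `|M|.
  by apply: hc; rewrite in_itv /= -ler_norml.
by rewrite u0 ?normr0// (le_lt_trans (ler_norm _)).
Qed.

(** The two terms of the denominator do not vanish together, and the quotient is [0] up
   to [0] and [1] from [1] on. *)
Definition step x : R := flat 0 x / (flat 0 x + flat 0 (1 - x)).

Lemma flat0_ge0 x : 0 <= flat 0 x.
Proof. by rewrite /flat; case: ifP => // _; rewrite expr0 mul1r expR_ge0. Qed.

Lemma flat0_gt0 x : 0 < x -> 0 < flat 0 x.
Proof. by move=> x0; rewrite /flat x0 expr0 mul1r expR_gt0. Qed.

Lemma flat0_le x y : x <= y -> flat 0 x <= flat 0 y.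
Proof.
move=> xy; rewrite {1}/flat; case: ifP => [x0|_]; last exact: flat0_ge0.
have y0 := lt_le_trans x0 xy.
by rewrite /flat y0 !expr0 !mul1r ler_expR lerN2 lef_pV2.
Qed.

Lemma step_den_gt0 x : 0 < flat 0 x + flat 0 (1 - x).
Proof.
have [x0|x0] := ltP 0 x; first by rewrite ltr_pwDl ?flat0_gt0 ?flat0_ge0.
by rewrite ltr_wpDl ?flat0_ge0// flat0_gt0//; lra.
Qed.

Lemma step_sm : sm1 step.
Proof.
move=> k; apply: ck1M; first exact: ck1_flat.
apply: ck1V => [x|]; first by rewrite gt_eqF// step_den_gt0.
apply: ck1D; first exact: ck1_flat.
have := ck1_affine (-1) 1 (ck1_flat k 0).
by congr ck1; apply/funext => x; rewrite mulN1r addrC.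
Qed.

Lemma step0 x : x <= 0 -> step x = 0.
Proof. by move=> x0; rewrite /step {1}/flat ltNge x0 /= mul0r. Qed.

Lemma step1 x : 1 <= x -> step x = 1.
Proof.
move=> x1; have x0 : 0 < x by exact: lt_le_trans x1.
have -> : step x = flat 0 x / (flat 0 x + 0).
  by congr (_ / (_ + _)); rewrite /flat ltNge subr_le0 x1.
by rewrite addr0 mulfV// gt_eqF// flat0_gt0.
Qed.

Lemma step_le x y : x <= y -> step x <= step y.
Proof.
move=> xy; rewrite /step ler_pdivrMr ?step_den_gt0// mulrAC ler_pdivlMr ?step_den_gt0//.
have h1 := flat0_le xy; have h2 : flat 0 (1 - y) <= flat 0 (1 - x).
  by apply: flat0_le; lra.
rewrite !mulrDr (mulrC (flat 0 y) (flat 0 x)) lerD2l.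
by apply: ler_pM => //; exact: flat0_ge0.
Qed.

Lemma step_ge0 x : 0 <= step x.
Proof. by rewrite divr_ge0// ?flat0_ge0// ltW// step_den_gt0. Qed.

Lemma step_le1 x : step x <= 1.
Proof. by rewrite ler_pdivrMr ?step_den_gt0// mul1r lerDl flat0_ge0. Qed.

Lemma dn_step0 k x : 1 < `|x| -> dn k.+1 step x = 0.
Proof.
have near1 (y : R) : 1 < `|y| -> \forall z \near y, 1 < `|z|.
  move=> y1; have /cvgr_gt := @norm_continuous _ R y; exact.
have D0 (u : R -> R) (c y : R) : (\forall z \near y, u z = c) -> 'D_(1 : R) u y = 0.
  by move=> uc; rewrite (@near_eq_derive _ _ _ _ (cst c))// derive_cst.
elim: k x => [|k IH] x x1.
  have [x0|x0] := ltP x 0.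
    apply: (D0 _ 0); near=> y.
    by rewrite step0// ltW//; near: y; exact: lt_nbhsl.
  apply: (D0 _ 1); rewrite ger0_norm// in x1.
  by near=> y; rewrite step1// ltW//; near: y; exact: lt_nbhsr.
by apply: (D0 _ 0); near=> y; apply: IH; near: y; exact: near1.
Unshelve. all: by end_near.
Qed.

(** The derivatives of positive order are continuous with compact support. *)
Lemma dn_step_bounded k : exists2 B : R, 0 <= B & forall x, `|dn k step x| <= B.
Proof.
case: k => [|k].
  by exists 1 => // x; rewrite ger0_norm ?step_ge0// step_le1.
apply: (@bounded_of_support _ 1) => x; last exact: dn_step0.
exact: ck1_cont (sm1_dn k.+1 step_sm 0%N) x.
Qed.

End one_variable.

Section lift.
Context {R : realType} {n : nat}.
Local Notation C := R[i].
Local Notation V := 'rV[R]_n.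
Implicit Types (u : R -> R) (i j : 'I_n) (s b : R).

Definition lift1 i s b u : V -> C := fun x => (u (s * x ord0 i + b))%:C.

Lemma cdrv_lift1 i j s b u u' : (forall x, is_derive x (1 : R) u (u' x)) -> forall x,
  cdrv j (lift1 i s b u) x ((i == j)%:R * s%:C * lift1 i s b u' x).
Proof.
move=> hu x; apply/cdrv_dist => e e0.
have s0 : 0 < `|s| + 1 by rewrite ltr_wpDl.
have /derive_dist := hu (s * x ord0 i + b).
have es : 0 < e / (`|s| + 1) by rewrite divr_gt0.
move=> /(_ _ es)[d d0 hd]; exists (d / (`|s| + 1)); first by rewrite divr_gt0.
move=> t td; rewrite /lift1 !mxE eqxx andTb eq_sym.
have [ij|ij] := eqVneq i j; last first.
  by rewrite !mulr0 addr0 subrr mul0r mul0r mulr0 subr0 cmod0 mulr_ge0// ltW.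
have ts : `|t * s| <= (`|s| + 1) * `|t|.
  by rewrite normrM mulrC; apply: ler_wpM2r => //; lra.
have /hd h : `|t * s| < d.
  by apply: le_lt_trans ts _; rewrite mulrC -ltr_pdivlMr.
rewrite /GRing.scale /= mulr1 in h.
have E : s * x ord0 i + b + t * s = s * (x ord0 i + t * 1) + b by ring.
rewrite E in h.
have -> : (u (s * (x ord0 i + t * 1) + b))%:C - (u (s * x ord0 i + b))%:C -
   t%:C * (1 * s%:C * (u' (s * x ord0 i + b))%:C) =
   (u (s * (x ord0 i + t * 1) + b) - u (s * x ord0 i + b) - t * s * u' (s * x ord0 i + b))%:C.
  by apply: cext; rewrite ?(ReD, ImD, ReN, ImN, ReM, ImM, ReR, ImR) /=; ring.
rewrite cmodR; apply: le_trans h _; rewrite -mulrA; apply: ler_wpM2l; first exact: ltW.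
by rewrite ler_pdivrMl.
Qed.

Lemma smooth_lift1 i s b u : sm1 u -> smooth setT (lift1 i s b u).
Proof.
move=> su k; move: (su k); elim: k u {su} => [|k IH] u.
  move=> uc; split => // x _; split; last by apply: for_cont_ext (@cst_continuous _ _ 0 x).
  have h : {for x, continuous (fun y : V => s * y ord0 i + b)}.
    apply: continuousD; last exact: cst_continuous.
    by apply: continuousM; [exact: cst_continuous|exact: coord_continuous].
  exact: (@continuous_comp _ _ _ (fun y : V => s * y ord0 i + b) u x h (uc _)).
move=> hu; have [u' [h1 h2]] := hu.
apply: ck_intro => [|x _|j]; first exact: openT.
  have h0 := ck1W hu; exact: (ck_cont (IH _ h0)).
exists (fun x => (i == j)%:R * s%:C * lift1 i s b u' x); split.
  by move=> x _; exact: cdrv_lift1.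
by apply: ckZ; [exact: openT|exact: IH].
Qed.

Lemma pds_lift1 i s b u w : sm1 u -> `|s| <= 1 -> exists2 c : C, cmod c <= 1 &
  forall x, pds w (lift1 i s b u) x = c * lift1 i s b (dn (size w) u) x.
Proof.
move=> su s1; elim: w => [|j w [c c1 IH]]; first by exists 1; rewrite ?cmod1// => x; rewrite mul1r.
exists (c * ((i == j)%:R * s%:C)) => [|x].
  rewrite !cmodM cmodR; case: eqVneq => _; rewrite ?cmod1 ?cmod0 ?mul1r ?mul0r ?mulr0//.
  by rewrite mulr_ile1// cmod_ge0.
rewrite [LHS]/= (pd_ext openT j (fun y _ => IH y))//.
rewrite (cdrv_pd (cdrvZ c (cdrv_lift1 i j s b (sm1_derive (sm1_dn (size w) su)) x))).
by rewrite !mulrA.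
Qed.

End lift.

Section cutoffs.
Context {R : realType} {n : nat}.
Local Notation C := R[i].
Local Notation V := 'rV[R]_n.
Implicit Types (x : V) (r s : R).

(** One smooth step for each face of the cube [s * |x| <= r]. *)
Definition cutr r s x : R :=
  \prod_i (step (s * x ord0 i + r) * step (- s * x ord0 i + r)).

Lemma prodRC (I : Type) (q : seq I) (F : I -> R) :
  (\prod_(i <- q) F i)%:C = \prod_(i <- q) (F i)%:C.
Proof. by elim/big_rec2 : _ => // i y1 y2 _ <-; rewrite rmorphM. Qed.

Lemma smooth_cut r s : smooth setT (fun x => (cutr r s x)%:C).
Proof.
move=> k; apply: (ck_ext openT) (_ : ck setT k (fun x => \prod_(i < n)
    (lift1 i s r step x * lift1 i (- s) r step x))).
  by move=> x _; rewrite prodRC; apply: eq_bigr => i _; rewrite rmorphM.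
by apply: (ck_prod openT) => i; apply: (ckM openT); exact: smooth_lift1 step_sm k.
Qed.

Lemma cutr_ge0 r s x : 0 <= cutr r s x.
Proof. by apply: prodr_ge0 => i _; rewrite mulr_ge0// step_ge0. Qed.

Lemma cutr_eq1 r s x : 0 <= s -> s * `|x| <= r - 1 -> cutr r s x = 1.
Proof.
move=> s0 h; apply: big1 => i _.
have hi : `|s * x ord0 i| <= r - 1.
  rewrite normrM ger0_norm//; apply: le_trans h; apply: ler_wpM2l => //.
  exact: coord_le_norm.
move: hi; rewrite ler_norml => /andP[h1 h2].
by rewrite !step1 ?mulr1 ?mulNr//; lra.
Qed.

Lemma cutr_eq0 r s x : 0 < s -> 0 <= r -> r < s * `|x| -> cutr r s x = 0.
Proof.
move=> s0 r0 h; apply: contraTeq h => c0; rewrite -leNgt -ler_pdivlMl//.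
apply: norm_le => [|i]; first by rewrite mulr_ge0// invr_ge0 ltW.
rewrite ler_pdivlMl// -(gtr0_norm s0) -normrM; rewrite leNgt; apply: contraNN c0 => hi.
rewrite /cutr (bigD1 i)//= mulNr; move: hi; rewrite lter_normr => /orP[hi|hi].
  by rewrite (step0 (x := - _ + _)) ?mulr0 ?mul0r//; lra.
by rewrite step0 ?mul0r//; lra.
Qed.

(** Smooth partition of unity into boxes of side [2 / L]; the telescoping sum over
   [k] equals one as long as [`|L * t| <= m - 1]. *)
Definition win (L : R) (m : nat) (k : nat) (t : R) : R :=
  step (L * t + (m%:R - k%:R)) - step (L * t + (m%:R - k.+1%:R)).

Definition boxes (L : R) (m : nat) (f : {ffun 'I_n -> 'I_(m + m)}) x : R :=
  \prod_i win L m (f i) (x ord0 i).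

Lemma win_ge0 L m k t : 0 <= win L m k t.
Proof. by rewrite subr_ge0; apply: step_le; rewrite lerD2l lerD2l lerN2 ler_nat. Qed.

Lemma win_sum L m t : `|L * t| <= m%:R - 1 -> \sum_(k < m + m) win L m k t = 1.
Proof.
rewrite ler_norml => /andP[h1 h2].
rewrite -(big_mkord xpredT (fun k => win L m k t)).
rewrite (@telescope_sumr_eq _ _ _ (fun k => - step (L * t + (m%:R - k%:R)))) ?leq0n//; last first.
  by move=> k _; rewrite /win; lra.
rewrite natrD step0 ?oppr0 ?sub0r ?opprK; last lra.
by rewrite step1//; lra.
Qed.

Lemma boxes_ge0 L m (f : {ffun 'I_n -> 'I_(m + m)}) x : 0 <= boxes L f x.
Proof. by apply: prodr_ge0 => i _; exact: win_ge0. Qed.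

Lemma boxes_sum L m x : 0 <= L -> L * `|x| <= m%:R - 1 ->
  \sum_(f : {ffun 'I_n -> 'I_(m + m)}) boxes L f x = 1.
Proof.
move=> L0 h; rewrite /boxes -(bigA_distr_bigA (fun i (k : 'I_(m + m)) => win L m k (x ord0 i))).
apply: big1 => i _; apply: win_sum; rewrite normrM ger0_norm//; apply: le_trans h.
by apply: ler_wpM2l => //; exact: coord_le_norm.
Qed.

Definition box_center (L : R) (m : nat) (f : {ffun 'I_n -> 'I_(m + m)}) : V :=
  \row_i (((f i)%:R + 1 - m%:R) / L).

Lemma boxes_support L m (f : {ffun 'I_n -> 'I_(m + m)}) x : 0 < L -> L^-1 < `|x - box_center L f| -> boxes L f x = 0.
Proof.
move=> L0 h; apply: contraTeq h => c0; rewrite -leNgt.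
apply: norm_le => [|i]; first by rewrite invr_ge0 ltW.
rewrite !mxE leNgt; apply: contraNN c0 => hi.
rewrite /boxes (bigD1 i)//=.
suff -> : win L m (f i) (x ord0 i) = 0 by rewrite mul0r.
have {}hi : 1 < `|L * x ord0 i - ((f i)%:R + 1 - m%:R)|.
  have -> : L * x ord0 i - ((f i)%:R + 1 - m%:R) = L * (x ord0 i - ((f i)%:R + 1 - m%:R) / L).
    by field; rewrite gt_eqF.
  by rewrite normrM gtr0_norm// mulrC -ltr_pdivrMr// mul1r.
rewrite /win -natr1; move: ((f i)%:R : R) (m%:R : R) hi => k M.
rewrite lter_normr => /orP[hi|hi].
  by rewrite !step1 ?subrr//; lra.
by rewrite !step0 ?subrr//; lra.
Qed.

Lemma smooth_boxes L m (f : {ffun 'I_n -> 'I_(m + m)}) : smooth setT (fun x => (boxes L f x)%:C).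
Proof.
move=> k; apply: (ck_ext openT) (_ : ck setT k (fun x => \prod_(i < n)
    (lift1 i L (m%:R - (f i)%:R) step x - lift1 i L (m%:R - (f i).+1%:R) step x))).
  by move=> x _; rewrite prodRC; apply: eq_bigr => i _; rewrite rmorphB.
apply: (ck_prod openT) => i; apply: (ckD openT); last apply: (ckN openT);
  exact: smooth_lift1 step_sm k.
Qed.

End cutoffs.

(** * Complex integrals *)

Section complex_integral.
Context {R : realType} {n : nat}.
Local Notation C := R[i].
Local Notation V := 'rV[R]_n.
Implicit Types (F G : V -> C) (x w : V) (h : V -> R).

Lemma cmod_cont F x : ccont F x -> {for x, continuous (fun y => cmod (F y))}.
Proof.
move=> /ccont_dist Fc.
suff : cmod (F y) @[y --> x] --> cmod (F x) by [].
have ball_hd (d : R) (P : V -> Prop) : 0 < d -> (forall y, `|y - x| < d -> P y) ->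
    \forall y \near x, P y.
  move=> d0 hP; apply/nbhs_ballP; exists d => //= y.
  by rewrite -ball_normE /ball_ /= distrC; exact: hP.
apply/cvgrPdist_lt => [|e /Fc[d d0 hd]]; first exact: (nbhs_filter x).
apply: (ball_hd d) => // y /hd; apply: le_lt_trans.
rewrite ler_norml; apply/andP; split.
  have := cmodD (F x) (F y - F x); rewrite subrKC => ?; lra.
by have := cmodD (F y) (F x - F y); rewrite subrKC (cmodBC (F y)) => ?; lra.
Qed.

Lemma compact_cball (M : R) : compact [set x : V | `|x| <= M].
Proof.
have [M0|M0] := ltP M 0.
  rewrite (_ : [set _ | _] = set0); first exact: compact0.
  by apply/seteqP; split => x //= h; have := le_lt_trans (le_trans (normr_ge0 x) h) M0; rewrite ltxx.
have -> : [set x : V | `|x| <= M] = [set v | forall i, `[- M, M]%classic (v ord0 i)].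
  apply/seteqP; split => x /= h.
    by move=> i; rewrite in_itv /= -ler_norml; apply: le_trans h; exact: coord_le_norm.
  by apply: norm_le => // i; have := h i; rewrite in_itv /= -ler_norml.
by apply: (@rV_compact _ n (fun=> `[- M, M]%classic)) => _; exact: segment_compact.
Qed.

(** The class of integrands for correlations: closed under products and translations,
   and integrable without further conditions. *)
Definition tc F := (forall x, ccont F x) /\ exists M : R, forall x, M < `|x| -> F x = 0.

Lemma tc_bounded F : tc F -> exists2 B : R, 0 <= B & forall x, cmod (F x) <= B.
Proof.
move=> [Fc [M FM]]; pose A := [set x : V | `|x| <= `|M|].
have A0 : A !=set0 by exists 0; rewrite /A /= normr0.
have cF : {within A, continuous (fun x => cmod (F x))}.
  by apply: continuous_subspaceT => x; exact: cmod_cont.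
have [c _ hc] := compact_EVT_max A0 (@compact_cball `|M|) cF.
exists (cmod (F c)); first exact: cmod_ge0.
move=> x; have [xM|Mx] := leP `|x| `|M|; first by apply: hc; rewrite inE.
by rewrite FM ?cmod0 ?cmod_ge0// (le_lt_trans (ler_norm _)).
Qed.

Lemma weight_ge (M : R) x : 0 <= M -> `|x| <= M -> ((1 + M) ^+ 2 ^+ n)^-1 <= weight x.
Proof.
move=> M0 xM; rewrite /weight -exprVn.
have -> : ((1 + M) ^+ 2)^-1 ^+ n = \prod_(i < n) ((1 + M) ^+ 2)^-1.
  by rewrite prodr_const card_ord.
have p0 : 0 < (1 + M) ^+ 2 by rewrite exprn_gt0//; lra.
apply: ler_prod => i _; rewrite invr_ge0 ltW//=.
rewrite lef_pV2 ?posrE ?oneDsqr_gt0// /oneDsqr.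
have h := le_trans (coord_le_norm x i) xM.
have : (x ord0 i) ^+ 2 <= M ^+ 2.
  by rewrite -(real_normK (num_real (x ord0 i))) ler_sqr ?nnegrE.
nra.
Qed.

Lemma rdom_cs h : (forall x, {for x, continuous h}) ->
  (exists M : R, forall x, M < `|x| -> h x = 0) -> rdom h.
Proof.
move=> hc [M hM]; have [|B B0 hB] := @tc_bounded (fun x => (h x)%:C).
  split; last by exists M => x /hM ->.
  move=> x; split; first exact: hc.
  exact: cst_continuous.
have p0 : 0 < (1 + `|M|) ^+ 2 ^+ n.
  by rewrite !exprn_gt0// ltr_pwDl.
apply: (@rdom_weight R n (B * (1 + `|M|) ^+ 2 ^+ n)) => //.
  by rewrite mulr_ge0// ltW.
move=> x; have [xM|Mx] := leP `|x| `|M|.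
  apply: (@le_trans _ _ B); first by have := hB x; rewrite cmodR.
  rewrite -mulrA; apply: ler_peMr => //; rewrite -ler_pdivrMl// mulr1.
  exact: weight_ge.
rewrite hM; last by rewrite (le_lt_trans (ler_norm _)).
by rewrite normr0 (mulr_ge0 (mulr_ge0 B0 (ltW p0)) (ltW (weight_gt0 x))).
Qed.

Definition cdom F := rdom (fun x => complex.Re (F x)) /\ rdom (fun x => complex.Im (F x)).

Definition cint F : C := rint (fun x => complex.Re (F x)) +i* rint (fun x => complex.Im (F x)).

Lemma cintegral_cint F : cintegral F = cint F.
Proof. by []. Qed.

Lemma tc_cdom F : tc F -> cdom F.
Proof.
by move=> [Fc [M FM]]; split; apply: rdom_cs; do ?[by move=> x; case: (Fc x)];
   exists M => x /FM ->.
Qed.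

Lemma tc_cmod F : tc F -> rdom (fun x => cmod (F x)).
Proof.
move=> [Fc [M FM]]; apply: rdom_cs; first by move=> x; exact: cmod_cont.
by exists M => x /FM ->; exact: cmod0.
Qed.

Lemma cdomD F G : cdom F -> cdom G -> cdom (fun x => F x + G x).
Proof.
move=> [F1 F2] [G1 G2]; split.
  by under eq_fun do rewrite ReD; exact: rdomD.
by under eq_fun do rewrite ImD; exact: rdomD.
Qed.

Lemma cintD F G : cdom F -> cdom G -> cint (fun x => F x + G x) = cint F + cint G.
Proof.
move=> [F1 F2] [G1 G2]; rewrite /cint.
under eq_fun do rewrite ReD; under [X in _ +i* rint X]eq_fun do rewrite ImD.
by rewrite !rintD.
Qed.

Lemma cdomZ (c : C) F : cdom F -> cdom (fun x => c * F x).
Proof.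
move=> [F1 F2]; split.
  under eq_fun do rewrite ReM -mulNr; exact: rdomD (rdomZ _ _) (rdomZ _ _).
by under eq_fun do rewrite ImM; exact: rdomD (rdomZ _ _) (rdomZ _ _).
Qed.

Lemma cintZ (c : C) F : cdom F -> cint (fun x => c * F x) = c * cint F.
Proof.
move=> [F1 F2]; rewrite /cint; apply: cext.
  rewrite ReM /=; under eq_fun do rewrite ReM -mulNr.
  by rewrite rintD ?rintZ ?mulNr//; exact: rdomZ.
rewrite ImM /=; under eq_fun do rewrite ImM.
by rewrite rintD ?rintZ//; exact: rdomZ.
Qed.

Lemma cdomB F G : cdom F -> cdom G -> cdom (fun x => F x - G x).
Proof.
move=> Fd Gd; have := cdomD Fd (cdomZ (-1) Gd).
by under eq_fun do rewrite mulN1r.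
Qed.

Lemma cintB F G : cdom F -> cdom G -> cint (fun x => F x - G x) = cint F - cint G.
Proof.
move=> Fd Gd; rewrite -(mulN1r (cint G)) -cintZ// -cintD//; last exact: cdomZ.
by congr cint; apply/funext => x; rewrite mulN1r.
Qed.

Lemma rint0 : rint (fun _ : V => 0 : R) = 0.
Proof.
have h : rdom (fun _ : V => 0 : R).
  apply: rdom_cs; first by move=> x; exact: cst_continuous.
  by exists 0.
rewrite -[RHS](mul0r (rint (fun _ : V => 0 : R))) -(rintZ 0 h).
by congr rint; apply/funext => x; rewrite mul0r.
Qed.

Lemma cdom0 : cdom (fun=> 0).
Proof. by apply: tc_cdom; split; [move=> x; exact: ccont_cst|exists 0]. Qed.

Lemma cint0 : cint (fun=> 0) = 0.
Proof. by rewrite /cint /= rint0. Qed.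

Lemma cint_sum (I : Type) (r : seq I) (F : I -> V -> C) : (forall i, cdom (F i)) ->
  cdom (fun x => \sum_(i <- r) F i x) /\
  cint (fun x => \sum_(i <- r) F i x) = \sum_(i <- r) cint (F i).
Proof.
move=> Fd; elim: r => [|i r [IH1 IH2]].
  under eq_fun do rewrite big_nil; rewrite big_nil cint0; split => //; exact: cdom0.
under eq_fun do rewrite big_cons; rewrite big_cons; split; first exact: cdomD.
by rewrite cintD// IH2.
Qed.

Lemma cintJ F : cdom F -> cint (fun x => (F x)^*%C) = (cint F)^*%C.
Proof.
move=> [F1 F2]; rewrite /cint; apply: cext; rewrite ?ReJ ?ImJ /=.
  by congr rint; apply/funext => x; rewrite ReJ.
rewrite -mulN1r -rintZ//; congr rint; apply/funext => x; by rewrite ImJ mulN1r.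
Qed.

(** The factor [2] comes from estimating the real and the imaginary part
   separately. *)
Lemma cint_bound F h : cdom F -> rdom h -> (forall x, cmod (F x) <= h x) ->
  cmod (cint F) <= 2 * rint h.
Proof.
move=> [F1 F2] hd Fh; apply: le_trans (cmod_le _) _; rewrite /cint /= mulr_natl mulr2n.
apply: lerD; apply: le_trans (rint_abs _) _ => //; apply: rint_le => //.
- exact: rdom_abs.
- by move=> x; apply: le_trans (Fh x); exact: cmod_Re.
- exact: rdom_abs.
- by move=> x; apply: le_trans (Fh x); exact: cmod_Im.
Qed.

Lemma cint_shift F w : cdom F -> cint (fun x => F (x + w)) = cint F.
Proof. by move=> [F1 F2]; rewrite /cint; congr (_ +i* _); [exact: (rint_shift w F1)|exact: (rint_shift w F2)]. Qed.

Lemma cint_opp F : cdom F -> cint (fun x => F (- x)) = cint F.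
Proof.
move=> [F1 F2]; rewrite /cint.
have E h : rdom h -> rint (fun x => h (- x)) = rint h.
  move=> hd; rewrite -(rint_affine 0 (or_intror erefl) hd).
  by congr rint; apply/funext => x; rewrite addr0 scaleN1r.
by congr (_ +i* _); [exact: E F1|exact: E F2].
Qed.

Lemma tcM F G : tc F -> (forall x, ccont G x) -> tc (fun x => F x * G x).
Proof.
move=> [Fc [M FM]] Gc; split; first by move=> x; exact: ccontM.
by exists M => x /FM ->; rewrite mul0r.
Qed.

Lemma tc_shift F w : tc F -> tc (fun x => F (x + w)).
Proof.
move=> [Fc [M FM]]; split; first by move=> x; exact: ccont_shift.
exists (M + `|w|) => x xM; apply: FM; have := ler_normB (x + w) w.
by rewrite addrK => ?; lra.
Qed.

Lemma cint_conv F G : tc F -> tc G ->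
  cdom (fun z => cint (fun y => F (z + y) * G y)) /\
  cint (fun z => cint (fun y => F (z + y) * G y)) = cint F * cint G.
Proof.
move=> Fc Gc; have [F1 F2] := tc_cdom Fc; have [G1 G2] := tc_cdom Gc.
have P (p q : C -> R) : (forall F, tc F -> tc (fun x => (p (F x))%:C)) ->
    (forall F, tc F -> tc (fun x => (q (F x))%:C)) ->
    rdom (fun z => rint (fun y => p (F (z + y)) * q (G y))) /\
    rint (fun z => rint (fun y => p (F (z + y)) * q (G y))) =
    rint (fun x => p (F x)) * rint (fun x => q (G x)).
  move=> hp hq.
  apply: (@rint_conv R n (fun x => p (F x)) (fun x => q (G x))).
  - by have [] := tc_cdom (hp _ Fc).
  - by have [] := tc_cdom (hq _ Gc).
  move=> z; have h : tc (fun y => (p (F (z + y)))%:C * (q (G y))%:C).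
    apply: tcM; last by have [] := hq _ Gc.
    have := tc_shift z (hp _ Fc).
    by congr tc; apply/funext => y; rewrite addrC.
  have [] := tc_cdom h.
  by under eq_fun do rewrite ReM /= mulr0 subr0.
have tR F' : tc F' -> tc (fun x => (complex.Re (F' x))%:C).
  move=> [h [M hM]]; split; last by exists M => x /hM ->.
  by move=> x; have [h1 h2] := h x; split => //; exact: cst_continuous.
have tI F' : tc F' -> tc (fun x => (complex.Im (F' x))%:C).
  move=> [h [M hM]]; split; last by exists M => x /hM ->.
  by move=> x; have [h1 h2] := h x; split => //; exact: cst_continuous.
have [rr rrE] := P _ _ tR tR; have [ri riE] := P _ _ tR tI.
have [ir irE] := P _ _ tI tR; have [ii iiE] := P _ _ tI tI.
have inn (p q : C -> R) z : (forall F, tc F -> tc (fun x => (p (F x))%:C)) ->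
    (forall F, tc F -> tc (fun x => (q (F x))%:C)) ->
    rdom (fun y => p (F (z + y)) * q (G y)).
  move=> hp hq; have h : tc (fun y => (p (F (z + y)))%:C * (q (G y))%:C).
    apply: tcM; last by have [] := hq _ Gc.
    have := tc_shift z (hp _ Fc).
    by congr tc; apply/funext => y; rewrite addrC.
  have [] := tc_cdom h.
  by under eq_fun do rewrite ReM /= mulr0 subr0.
have E z : cint (fun y => F (z + y) * G y) =
   (rint (fun y => complex.Re (F (z + y)) * complex.Re (G y)) +
    (-1) * rint (fun y => complex.Im (F (z + y)) * complex.Im (G y))) +i*
   (rint (fun y => complex.Re (F (z + y)) * complex.Im (G y)) +
    rint (fun y => complex.Im (F (z + y)) * complex.Re (G y))).
  rewrite /cint; apply: cext => /=.
    under eq_fun do rewrite ReM -mulN1r.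
    by rewrite rintD ?rintZ//; do ?apply: rdomZ; apply: inn.
  under eq_fun do rewrite ImM.
  by rewrite rintD//; apply: inn.
rewrite (funext E); split.
  by split; [exact: rdomD rr (rdomZ _ ii)|exact: rdomD ri ir].
rewrite [LHS]/cint; apply: cext => /=.
  by rewrite rintD//; [rewrite rintZ// rrE iiE mulN1r|exact: rdomZ].
by rewrite rintD// riE irE.
Qed.

End complex_integral.

(** * Test functions and Schwartz functions *)

Section test_functions.
Context {R : realType} {n : nat}.
Local Notation C := R[i].
Local Notation V := 'rV[R]_n.
Implicit Types (F G phi psi : V -> C) (x w : V) (j : 'I_n).

Lemma smoothD F G : smooth setT F -> smooth setT G -> smooth setT (fun x => F x + G x).
Proof. by move=> h1 h2 k; apply: ckD => //; exact: openT. Qed.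

Lemma smoothM F G : smooth setT F -> smooth setT G -> smooth setT (fun x => F x * G x).
Proof. by move=> h1 h2 k; apply: ckM => //; exact: openT. Qed.

Lemma smoothJ F : smooth setT F -> smooth setT (fun x => (F x)^*%C).
Proof. by move=> h k; apply: ckJ => //; exact: openT. Qed.

Lemma smooth_cst (c : C) : smooth setT (fun _ : V => c).
Proof. by move=> k; apply: ck_cst; exact: openT. Qed.

Lemma smooth_ext F G : F =1 G -> smooth setT F -> smooth setT G.
Proof. by move=> /funext ->. Qed.

Lemma smoothB F G : smooth setT F -> smooth setT G -> smooth setT (fun x => F x - G x).
Proof.
move=> h1 h2; apply: smooth_ext (smoothD h1 (smoothM (smooth_cst (-1)) h2)) => x.
by rewrite mulN1r.
Qed.

Lemma smooth_shift F w : smooth setT F -> smooth setT (fun x => F (x + w)).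
Proof.
move=> h k; move: (h k) => {h}; elim: k F => [|k IH] F Fk.
  by split => // x _; apply: ccont_shift; exact: ck_cont Fk _ _.
apply: (ck_intro openT) => [x _|j]; first by apply: ccont_shift; exact: ck_cont Fk _ _.
exists (fun x => pd j F (x + w)); split; last by apply: IH; exact: ck_pd.
by move=> x _; apply: cdrv_shift; exact: ck_drv Fk _.
Qed.

Lemma pdM j F G x : smooth setT F -> smooth setT G ->
  pd j (fun y => F y * G y) x = pd j F x * G x + F x * pd j G x.
Proof. by move=> Fs Gs; apply: cdrv_pd; apply: cdrvM; exact: smooth_drv. Qed.

Lemma pdsB b F G x : smooth setT F -> smooth setT G ->
  pds b (fun y => F y - G y) x = pds b F x - pds b G x.
Proof.
move=> Fs Gs; have := pds_lin b 1 (-1) x Fs Gs; rewrite mul1r mulN1r => <-.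
by congr (pds b _ x); apply/funext => y; rewrite mul1r mulN1r.
Qed.

Lemma pdsD b F G x : smooth setT F -> smooth setT G ->
  pds b (fun y => F y + G y) x = pds b F x + pds b G x.
Proof.
move=> Fs Gs; have := pds_lin b 1 1 x Fs Gs; rewrite !mul1r => <-.
by congr (pds b _ x); apply/funext => y; rewrite !mul1r.
Qed.

Lemma pds_rcons b j F : pds (rcons b j) F = pds b (pd j F).
Proof. by rewrite /pds foldr_rcons. Qed.

Definition tf phi := smooth setT phi /\ exists M : R, forall x, M < `|x| -> phi x = 0.

Lemma tf_tc phi : tf phi -> tc phi.
Proof. by move=> [h1 h2]; split => // x; exact: smooth_cont. Qed.

Lemma support_pds b phi (M : R) : (forall x, M < `|x| -> phi x = 0) ->
  forall x, M < `|x| -> pds b phi x = 0.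
Proof.
move=> h x xM; have Uo : open [set y : V | M < `|y|].
  by apply: (@open_comp _ _ (fun y : V => `|y|) [set r : R | M < r]); [move=> ? _; exact: norm_continuous|exact: open_gt].
rewrite (pds_ext Uo b (G := fun=> 0))//.
elim: b {h} x xM => //= j b IH x xM.
by rewrite (pd_ext Uo j (G := fun=> 0))//; exact: cdrv_pd (cdrv_cst j x 0).
Qed.

Lemma tf_pds b phi : tf phi -> tf (pds b phi).
Proof.
move=> [h1 [M hM]]; split; first exact: smooth_pds.
by exists M; exact: support_pds.
Qed.

Lemma tf_pd j phi : tf phi -> tf (pd j phi).
Proof. exact: (tf_pds [:: j]). Qed.

Lemma tfD phi psi : tf phi -> tf psi -> tf (fun x => phi x + psi x).
Proof.
move=> [h1 [M hM]] [h2 [N hN]]; split; first exact: smoothD.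
exists (Num.max M N) => x; rewrite gt_max => /andP[xM xN].
by rewrite hM ?hN// addr0.
Qed.

Lemma tfM phi F : tf phi -> smooth setT F -> tf (fun x => phi x * F x).
Proof.
move=> [h1 [M hM]] h2; split; first exact: smoothM.
by exists M => x xM; rewrite hM// mul0r.
Qed.

Lemma tfZ (c : C) phi : tf phi -> tf (fun x => c * phi x).
Proof.
move=> h; have := tfM h (smooth_cst c).
by congr tf; apply/funext => x; rewrite mulrC.
Qed.

Lemma tf_ext phi psi : phi =1 psi -> tf phi -> tf psi.
Proof. by move=> /funext ->. Qed.

Lemma tfJ phi : tf phi -> tf (fun x => (phi x)^*%C).
Proof.
move=> [h1 [M hM]]; split; first exact: smoothJ.
by exists M => x xM; rewrite hM// conjR.
Qed.

Lemma tf0 : tf (fun=> 0).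
Proof. by split; [exact: smooth_cst|exists 0]. Qed.

Lemma tf_sum (I : Type) (r : seq I) (F : I -> V -> C) : (forall i, tf (F i)) ->
  tf (fun x => \sum_(i <- r) F i x).
Proof.
move=> h; elim: r => [|i r IH]; first by under eq_fun do rewrite big_nil; exact: tf0.
by under eq_fun do rewrite big_cons; exact: tfD.
Qed.

Lemma tf_shift phi w : tf phi -> tf (fun x => phi (x + w)).
Proof.
by move=> h; have [_ h2] := tc_shift w (tf_tc h); split => //; apply: smooth_shift; case: h.
Qed.

Lemma tf_bounded phi : tf phi -> exists2 B : R, 0 <= B & forall x, cmod (phi x) <= B.
Proof. by move=> /tf_tc; exact: tc_bounded. Qed.

Lemma common_bound (I : finType) (T : Type) (f : I -> T -> R) :
  (forall i, exists2 B : R, 0 <= B & forall t, f i t <= B) ->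
  exists2 B : R, 0 <= B & forall i t, f i t <= B.
Proof.
move=> h; have /boolp.choice[B hB] : forall i, exists B : R, 0 <= B /\ forall t, f i t <= B.
  by move=> i; have [B B0 hB] := h i; exists B.
exists (\sum_i B i); first by apply: sumr_ge0 => i _; case: (hB i).
move=> i t; apply: le_trans ((hB i).2 t) _.
by rewrite (bigD1 i)//= lerDl; apply: sumr_ge0 => k _; case: (hB k).
Qed.

Lemma smooth_lipschitz F (M : R) : smooth setT F -> (forall j x, cmod (pd j F x) <= M) ->
  forall x y, cmod (F x - F y) <= 2 * M * n%:R * `|x - y|.
Proof.
move=> Fs hM; apply: lipschitz_of_bounded_partials => j x; exists (pd j F x).
by split => //; exact: smooth_drv.
Qed.

Lemma tf_lipschitz phi : tf phi -> exists2 L : R, 0 <= L &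
  forall x y, cmod (phi x - phi y) <= L * `|x - y|.
Proof.
move=> h; have [B B0 hB] : exists2 B : R, 0 <= B & forall j x, cmod (pd j phi x) <= B.
  by apply: common_bound => j; exact: tf_bounded (tf_pd j h).
exists (2 * B * n%:R); first by rewrite !mulr_ge0.
by apply: smooth_lipschitz => //; case: h.
Qed.

Lemma mi_monom_le (a : {ffun 'I_n -> nat}) x : `|mi_monom a x| <= (1 + `|x|) ^+ mi_size a.
Proof.
rewrite /mi_monom /mi_size normr_prod -prodrXr.
apply: ler_prod => i _; rewrite normr_ge0 normrX /=.
by apply: lerXn2r; rewrite ?nnegrE ?addr_ge0//; have := coord_le_norm x i; lra.
Qed.

Lemma seminorm_le F (a b : {ffun 'I_n -> nat}) (c : R) : smooth setT F ->
  (forall x, (1 + `|x|) ^+ mi_size a * cmod (pds (mi_word b) F x) <= c) ->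
  (schwartz_seminorm a b F <= c%:E)%E.
Proof.
move=> Fs hc; apply: ge_ereal_sup => _ [x _ <-]; rewrite lee_fin -/(cmod _) cmodM cmodR.
apply: le_trans (hc x); rewrite /mderiv (cmod_pderivs openT _ Fs)//.
by apply: ler_wpM2r; [exact: cmod_ge0|exact: mi_monom_le].
Qed.

Lemma schwartz_smooth phi : schwartz phi -> smooth setT phi.
Proof. by move=> [/(smooth_onP openT)]. Qed.

Lemma tf_decay phi : tf phi -> forall b k, exists2 B : R, 0 <= B &
  forall x, (1 + `|x|) ^+ k * cmod (pds b phi x) <= B.
Proof.
move=> h b k; have [B B0 hB] := tf_bounded (tf_pds b h).
have [_ [M hM]] := h.
exists ((1 + `|M|) ^+ k * B); first by rewrite mulr_ge0// exprn_ge0// addr_ge0.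
move=> x; have [xM|Mx] := leP `|x| `|M|.
  apply: ler_pM => //; rewrite ?exprn_ge0 ?addr_ge0 ?cmod_ge0//.
  by apply: lerXn2r; rewrite ?nnegrE ?addr_ge0// lerD2l.
rewrite (support_pds b hM); last exact: le_lt_trans (ler_norm _) Mx.
by rewrite cmod0 mulr0 mulr_ge0// exprn_ge0// addr_ge0.
Qed.

Lemma schwartz_of_decay F : smooth setT F -> (forall b k, exists2 B : R, 0 <= B &
  forall x, (1 + `|x|) ^+ k * cmod (pds b F x) <= B) -> schwartz F.
Proof.
move=> Fs h; split; first exact/(smooth_onP openT).
move=> a b; have [B _ hB] := h (mi_word b) (mi_size a).
exact: le_lt_trans (seminorm_le Fs hB) (ltry _).
Qed.

Lemma tf_schwartz phi : tf phi -> schwartz phi.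
Proof. by move=> h; apply: schwartz_of_decay; [case: h|exact: tf_decay]. Qed.

Lemma schwartz_decay phi : schwartz phi -> forall b k, exists2 B : R, 0 <= B &
  forall x, (1 + `|x|) ^+ k * cmod (pds b phi x) <= B.
Proof.
move=> h; have hs := schwartz_smooth h; have [_ hn] := h.
have mono (a : {ffun 'I_n -> nat}) b : exists2 B : R, 0 <= B &
    forall x, `|mi_monom a x| * cmod (pds b phi x) <= B.
  have [B B0 hB] := ereal_sup_bounded (hn a [ffun j => count_mem j b]).
  exists B => // x; apply: hB; exists x => //.
  rewrite -/(cmod _) cmodM cmodR /mderiv (cmod_pderivs openT _ hs)//; congr (_ * cmod _)%:E.
  by apply/esym; apply: (pds_perm openT hs (mi_word_count b)).

move=> b k.
have [B1 B10 hB1] : exists2 B : R, 0 <= B & forall (i : 'I_n) x, `|x ord0 i| ^+ k * cmod (pds b phi x) <= B.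
  apply: (@common_bound _ _ (fun (i : 'I_n) x => `|x ord0 i| ^+ k * cmod (pds b phi x))) => i.
  have [B B0 hB] := mono [ffun j => if j == i then k else 0%N] b.
  exists B => // x; have := hB x; rewrite /mi_monom (bigD1 i)//= ffunE eqxx big1 ?mulr1 ?normrX//.
  by move=> j ji; rewrite ffunE (negbTE ji) expr0.
have [B0 B00 hB0] := mono [ffun=> 0%N] b.
have {}hB0 x : cmod (pds b phi x) <= B0.
  have := hB0 x; rewrite /mi_monom big1 ?normr1 ?mul1r// => i _.
  by rewrite ffunE expr0.
exists (2 ^+ k * (B0 + B1)); first by rewrite mulr_ge0// ?exprn_ge0// addr_ge0.
move=> x; have p0 := cmod_ge0 (pds b phi x).
have [x1|x1] := leP `|x| 1.
  apply: ler_pM; [by rewrite exprn_ge0// addr_ge0|exact: p0| |].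
    by apply: lerXn2r; rewrite ?nnegrE ?addr_ge0//; lra.
  by apply: le_trans (hB0 x) _; rewrite lerDl.
have x0 : 0 < `|x| by exact: lt_trans x1.
have [i xi] : exists i : 'I_n, `|x| <= `|x ord0 i|.
  apply: contrapT => hno.
  have hlt : \big[Num.max/0]_i `|x ord0 i| < `|x|.
    by apply/bigmax_ltP; split => // i _; rewrite ltNge; apply/negP => xi; apply: hno; exists i.
  have : `|x| <= \big[Num.max/0]_i `|x ord0 i|.
    apply: norm_le => [|i]; first exact: bigmax_ge_id.
    exact: (le_bigmax _ (fun i => `|x ord0 i|)).
  by rewrite leNgt hlt.
apply: (@le_trans _ _ ((2 * `|x ord0 i|) ^+ k * cmod (pds b phi x))).
  by apply: ler_wpM2r => //; apply: lerXn2r; rewrite ?nnegrE ?addr_ge0 ?mulr_ge0//; lra.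
rewrite exprMn -mulrA; apply: ler_wpM2l; first by rewrite exprn_ge0.
by apply: le_trans (hB1 i x) _; rewrite lerDr.
Qed.

End test_functions.

(** * Convergence in the Schwartz space *)

Section schwartz_convergence.
Context {R : realType} {n : nat}.
Local Notation C := R[i].
Local Notation V := 'rV[R]_n.
Implicit Types (F G phi psi : V -> C) (P Q : nat -> V -> C) (rho : nat -> V -> R).
Implicit Types (x w : V) (j : 'I_n) (b : seq 'I_n).

(** All derivatives are [O(1 / rho)], uniformly in the index of the family. With [rho]
   growing in the index and in [x], this is convergence to [0] in the Schwartz space
   with a rate. *)
Definition udecay rho P := (forall N, smooth setT (P N)) /\
  forall b, exists2 c : R, 0 <= c & forall N x, rho N x * cmod (pds b (P N) x) <= c.

Lemma udecay_le rho rho' P : (forall N x, rho' N x <= rho N x) -> udecay rho P -> udecay rho' P.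
Proof.
move=> h [Ps hP]; split => // b; have [c c0 hc] := hP b; exists c => // N x.
by apply: le_trans (hc N x); apply: ler_wpM2r => //; exact: cmod_ge0.
Qed.

Lemma udecay_pd rho P j : udecay rho P -> udecay rho (fun N => pd j (P N)).
Proof.
move=> [Ps hP]; split => [N|b]; first exact: smooth_pd.
by have [c c0 hc] := hP (rcons b j); exists c => // N x; rewrite -pds_rcons.
Qed.

(** The Leibniz rule: the derivatives of a product decay like the product. *)
Lemma udecayM rho rho' P Q : (forall N x, 0 <= rho N x) -> (forall N x, 0 <= rho' N x) ->
  udecay rho P -> udecay rho' Q ->
  udecay (fun N x => rho N x * rho' N x) (fun N x => P N x * Q N x).
Proof.
move=> r0 r0' hP hQ; split => [N|b]; first by apply: smoothM; [case: hP|case: hQ].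
elim/last_ind: b P Q hP hQ => [|b j IH] P Q hP hQ.
  have [_ /(_ [::])[c c0 hc]] := hP; have [_ /(_ [::])[c' c0' hc']] := hQ.
  exists (c * c'); first exact: mulr_ge0.
  move=> N x; rewrite [pds _ _]/= cmodM mulrACA.
  by apply: ler_pM => //; rewrite mulr_ge0 ?cmod_ge0.
have [c c0 hc] := IH _ _ (udecay_pd j hP) hQ; have [c' c0' hc'] := IH _ _ hP (udecay_pd j hQ).
have [Ps _] := hP; have [Qs _] := hQ.
exists (c + c'); first exact: addr_ge0.
move=> N x; rewrite pds_rcons.
rewrite (pds_ext openT b (fun y _ => pdM j y (Ps N) (Qs N)))// pdsD; last 2 first.
- by apply: smoothM => //; exact: smooth_pd.
- by apply: smoothM => //; exact: smooth_pd.
apply: (@le_trans _ _ (rho N x * rho' N x * (cmod (pds b (fun y => pd j (P N) y * Q N y) x) +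
   cmod (pds b (fun y => P N y * pd j (Q N) y) x)))).
  by apply: ler_wpM2l; [exact: mulr_ge0|exact: cmodD].
by rewrite mulrDr; apply: lerD; [exact: hc|exact: hc'].
Qed.

Lemma udecay_ext rho rho' P Q : (forall N x, rho N x = rho' N x) -> (forall N x, P N x = Q N x) ->
  udecay rho P -> udecay rho' Q.
Proof.
move=> h1 h2; have -> : rho = rho' by apply/funext => N; apply/funext => x.
by have -> : P = Q by apply/funext => N; apply/funext => x.
Qed.

Lemma udecay_cst (c : C) : udecay (fun _ _ => 1) (fun _ _ => c).
Proof.
split => [N|b]; first exact: smooth_cst.
case: b => [|j b]; first by exists (cmod c); [exact: cmod_ge0|move=> N x; rewrite /= mul1r].
have E (r : seq 'I_n) y : pds r (fun _ : V => 0 : C) y = 0.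
  elim: r y => //= l r IH y.
  by rewrite (pd_ext openT l (G := fun=> 0))//; exact: cdrv_pd (cdrv_cst l y 0).
exists 0 => // N x; rewrite (lastI j b) pds_rcons.
rewrite (pds_ext openT _ (G := fun=> 0))//; first by rewrite E cmod0 mulr0.
by move=> z _; exact: cdrv_pd (cdrv_cst _ z c).
Qed.

Lemma udecay_prod (I : Type) (r : seq I) (P : I -> nat -> V -> C) :
  (forall i, udecay (fun _ _ => 1) (P i)) -> udecay (fun _ _ => 1) (fun N x => \prod_(i <- r) P i N x).
Proof.
move=> h; elim: r => [|i r IH].
  by apply: udecay_ext (udecay_cst 1) => // N x; rewrite big_nil.
have := udecayM (fun _ _ => ler01) (fun _ _ => ler01) (h i) IH.
by apply: udecay_ext => N x; rewrite ?mulr1 ?big_cons.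
Qed.

Definition cutN (N : nat) x : C := (cutr N.+2%:R 1 x)%:C.

Lemma cutN_udecay : udecay (fun _ _ => 1) cutN.
Proof.
have L i s (b : nat -> R) : `|s| <= 1 -> udecay (fun _ _ => 1) (fun N => lift1 (n := n) i s (b N) step).
  move=> s1; split => [N|w]; first by apply: smooth_lift1; exact: step_sm.
  have [B B0 hB] := dn_step_bounded (R := R) (size w).
  exists B => // N x; have [c c1 ->] := pds_lift1 i (b N) w step_sm s1.
  rewrite mul1r cmodM cmodR -[leRHS]mul1r.
  by apply: ler_pM => //; exact: cmod_ge0.
have := @udecay_prod _ (index_enum 'I_n) (fun i N x => lift1 i 1 (N.+2%:R) step x * lift1 i (-1) (N.+2%:R) step x) _.
have E : cutN = (fun N x => \prod_i (lift1 i 1 (N.+2%:R) step x * lift1 i (-1) (N.+2%:R) step x)).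
  apply/funext => N; apply/funext => x; rewrite /cutN /cutr prodRC.
  by apply: eq_bigr => i _; rewrite rmorphM.
rewrite -E; apply => i.
have := udecayM (fun _ _ => ler01) (fun _ _ => ler01)
  (L i 1 (fun N => N.+2%:R) _) (L i (-1) (fun N => N.+2%:R) _).
rewrite normrN normr1 => /(_ (lexx 1) (lexx 1)).
by apply: udecay_ext => N x; rewrite ?mulr1.
Qed.

Lemma cutN_tf N : tf (cutN N).
Proof.
split; first exact: smooth_cut.
exists N.+2%:R => x xN; rewrite /cutN cutr_eq0// ?mul1r//.
Qed.

Lemma cutN_eq1 N x : `|x| <= N.+1%:R -> cutN N x = 1.
Proof. by move=> h; rewrite /cutN cutr_eq1// mul1r -(natr1 N.+1) addrK. Qed.

(** Where [cutN N] differs from [1] one has [N + 1 <= |x|], so one more power of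
   [1 + |x|] in the decay of [psi] yields the factor [N + 1]. *)
Lemma cutN_decay psi : schwartz psi -> forall k,
  udecay (fun N x => N.+1%:R * (1 + `|x|) ^+ k) (fun N x => psi x * cutN N x - psi x).
Proof.
move=> hpsi k; have ps := schwartz_smooth hpsi.
(* [cutN N - 1] vanishes inside the ball and is only bounded outside. *)
pose r1 (N : nat) (x : V) : R := if `|x| < N.+1%:R then N.+1%:R else 1.
have h1 : udecay r1 (fun N x => cutN N x - 1).
  have [cs hc] := cutN_udecay.
  split => [N|b]; first by apply: smoothB => //; exact: smooth_cst.
  have [c c0 {}hc] := hc b.
  have [c' c0' hc'] : exists2 c : R, 0 <= c & forall x, cmod (pds b (fun _ : V => 1) x) <= c.
    have [_ /(_ b)[c' c0' hc']] := udecay_cst 1.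
    by exists c' => // x; have := hc' 0%N x; rewrite mul1r.
  exists (c + c'); first exact: addr_ge0.
  move=> N x; rewrite /r1; case: ifPn => [xN|_].
    have Uo : open [set y : V | `|y| < N.+1%:R].
      apply: (@open_comp _ _ (fun y : V => `|y|) [set r : R | r < N.+1%:R]).
        by move=> ? _; exact: norm_continuous.
      exact: open_lt.
    rewrite (pds_ext Uo b (G := fun=> 0))//; last first.
      by move=> y /= yN; rewrite cutN_eq1 ?subrr// ltW.
    suff -> : pds b (fun _ : V => 0 : C) x = 0 by rewrite cmod0 mulr0 addr_ge0.
    by apply: (@support_pds _ _ b _ (-1)) => //; rewrite (lt_le_trans _ (normr_ge0 x))// ltrN10.
  rewrite mul1r pdsB//; last exact: smooth_cst.
  apply: le_trans (cmodB _ _) _; apply: lerD; last exact: hc'.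
  by have := hc N x; rewrite mul1r.
have h2 : udecay (fun _ x => (1 + `|x|) ^+ k.+1) (fun _ => psi).
  split => // b; have [c c0 hc] := schwartz_decay hpsi b k.+1; exists c => // N x; exact: hc.
have r0 N (x : V) : 0 <= r1 N x by rewrite /r1; case: ifP.
have p0 (x : V) m : 0 <= (1 + `|x|) ^+ m by rewrite exprn_ge0// addr_ge0.
have := udecayM r0 (fun _ x => p0 x k.+1) h1 h2.
have -> : (fun N x => psi x * cutN N x - psi x) = (fun N x => (cutN N x - 1) * psi x).
  by apply/funext => N; apply/funext => x; ring.
apply: udecay_le => N x; rewrite exprS mulrA; apply: ler_wpM2r => //.
rewrite /r1; case: ifPn => [_|]; last by rewrite -leNgt mul1r; lra.
by apply: ler_peMr => //; rewrite lerDl.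
Qed.

(** A neighbourhood in the Schwartz space involves finitely many seminorms, hence
   finitely many of the constants of the family. *)
Lemma tempered_lim (a : (V -> C) -> C) P psi : tempered a -> schwartz psi ->
  (forall N, schwartz (P N)) ->
  (forall k, udecay (fun N x => N.+1%:R * (1 + `|x|) ^+ k) (fun N x => P N x - psi x)) ->
  forall e : R, 0 < e -> exists N0, forall N, (N0 <= N)%N -> cmod (a (P N) - a psi) < e.
Proof.
move=> [_ ac] hpsi hP hw e /(ac _ hpsi)[m [delta [d0 hd]]].
have /boolp.choice[c hc] : forall b, exists c : R, 0 <= c /\
    forall N x, N.+1%:R * (1 + `|x|) ^+ m * cmod (pds b (fun y => P N y - psi y) x) <= c.
  by move=> b; have [_ /(_ b)[c c0 hc]] := hw m; exists c.
(* The sum over all words of length at most [m] dominates each constant. *)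
pose tot : R := \sum_(k < m.+1) \sum_(w : k.-tuple 'I_n) c w.
have c_ge0 b : 0 <= c b by case: (hc b).
have tot_ge b : (size b <= m)%N -> c b <= tot.
  move=> bm; have bm' : (size b < m.+1)%N by [].
  rewrite /tot (bigD1 (Ordinal bm'))//= (bigD1 (in_tuple b))//= -addrA lerDl.
  by rewrite addr_ge0 ?sumr_ge0// => k _; rewrite sumr_ge0.
have tot0 : 0 <= tot by apply: sumr_ge0 => k _; apply: sumr_ge0.
exists (Num.truncn (tot / delta)) => N hN.
have hN' : tot < N.+1%:R * delta.
  rewrite -ltr_pdivrMr//; apply: lt_le_trans (truncnS_gt _) _.
  by rewrite ler_nat ltnS.
apply: hd => // a1 b1 ha hb; apply: (@le_lt_trans _ _ (tot / N.+1%:R)%:E); last first.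
  by rewrite lte_fin ltr_pdivrMr// mulrC.
apply: seminorm_le => [|x]; first by apply: smoothB; exact: schwartz_smooth.
rewrite ler_pdivlMr// mulrC mulrA.
apply: le_trans (tot_ge (mi_word b1) _); last by rewrite size_mi_word.
apply: le_trans ((hc (mi_word b1)).2 N x).
apply: ler_wpM2r; first exact: cmod_ge0.
by apply: ler_wpM2l => //; apply: ler_weXn2l => //; rewrite lerDl.
Qed.

Lemma cdom_of_decay F (B : R) : (forall x, ccont F x) -> 0 <= B ->
  (forall x, (1 + `|x|) ^+ (2 * n) * cmod (F x) <= B) ->
  cdom F /\ cmod (cint F) <= B * (2 * rint (fun x : V => weight x)).
Proof.
move=> Fc B0 hB.
have Fw x : cmod (F x) <= B * weight x.
  apply: (@le_trans _ _ (B * ((1 + `|x|) ^+ 2 ^+ n)^-1)).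
    by rewrite ler_pdivlMr ?exprn_gt0// ?ltr_pwDl// mulrC -exprM.
  by apply: ler_wpM2l => //; exact: weight_ge.
have Fd : cdom F.
  split; apply: (rdom_weight B0); do ?[by move=> x; case: (Fc x)]; move=> x;
    apply: le_trans (Fw x); [exact: cmod_Re|exact: cmod_Im].
split => //; have := cint_bound Fd (weight_integrable B) Fw.
have w1 : rdom (fun x : V => weight x).
  have := weight_integrable (R := R) (n := n) 1.
  by rewrite /rdom; congr integrable; apply/funext => t /=; rewrite mul1r.
by rewrite rintZ// mulrCA.
Qed.

End schwartz_convergence.

(** * Twisted correlations of test functions *)

Section correlation.
Context {R : realType} {d : nat}.
Local Notation C := R[i].
Local Notation V := 'rV[R]_(d + d).
Implicit Types (F phi psi : V -> C) (X Y Z W : V) (j : 'I_(d + d)).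

Definition phase W X : C := expi (2 * symplectic X W).

Lemma cmod_phase W X : cmod (phase W X) = 1.
Proof. exact: cmod_expi. Qed.

Lemma phaseD W X Y : phase W (X + Y) = phase W X * phase W Y.
Proof. by rewrite /phase sympDl mulrDr expiD. Qed.

Lemma imag_scale j W (t : R) : (0 +i* (t * (2 * symplectic (ev j) W)) : C) = t%:C * - ell j W.
Proof.
rewrite mulrN -mulNr -rmorphN -ellZ /ell sympZl (sympC W).
have E (s r : R) : s * (2 * r) = 2 * (- s * - r) by ring.
by rewrite E.
Qed.

Lemma cdrv_phase j W X : cdrv j (phase W) X (- ell j W * phase W X).
Proof.
apply/cdrv_dist => e e0.
have c0 : 0 < 1 + `|2 * symplectic (ev j) W| by rewrite ltr_pwDl.
have [del del0 hdel] := expi_first_order (divr_gt0 e0 c0).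
exists (del / (1 + `|2 * symplectic (ev j) W|)); first by rewrite divr_gt0.
move=> t td.
have tb : `|t * (2 * symplectic (ev j) W)| <= `|t| * (1 + `|2 * symplectic (ev j) W|).
  by rewrite normrM; apply: ler_wpM2l => //; rewrite lerDr.
have /hdel h : `|t * (2 * symplectic (ev j) W)| < del.
  by apply: le_lt_trans tb _; rewrite -ltr_pdivlMr.
have -> : phase W (X + t *: ev j) - phase W X - t%:C * (- ell j W * phase W X) =
    phase W X * (expi (t * (2 * symplectic (ev j) W)) - 1 - (0 +i* (t * (2 * symplectic (ev j) W)))).
  rewrite phaseD {2}/phase sympZl [in expi _]mulrCA.
  have -> : (0 +i* (t * (2 * symplectic (ev j) W)) : C) = t%:C * - ell j W.
    exact: imag_scale.
  have E (p q l t' : C) : p * q - p - t' * (- l * p) = p * (q - 1 - t' * - l) by ring.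
  exact: E.
rewrite cmodM cmod_phase mul1r; apply: le_trans h _.
apply: le_trans (ler_wpM2l (ltW (divr_gt0 e0 c0)) tb) _.
have -> : e / (1 + `|2 * symplectic (ev j) W|) * (`|t| * (1 + `|2 * symplectic (ev j) W|)) = e * `|t|.
  by field; rewrite gt_eqF.
by [].
Qed.

Lemma smooth_phase W : smooth setT (phase W).
Proof.
move=> k; have pc X : ccont (phase W) X.
  apply: (ccont_of_bounded_partials (M := \sum_j cmod (ell j W))) => j Z.
  exists (- ell j W * phase W Z); split; first exact: cdrv_phase.
  rewrite cmodM cmod_phase mulr1 cmodN (bigD1 j)// lerDl.
  by apply: sumr_ge0 => i _; exact: cmod_ge0.
elim: k => [|k IH]; first by split.
apply: (ck_intro openT) => // j; exists (fun X => - ell j W * phase W X); split.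
  by move=> X _; exact: cdrv_phase.
by apply: ckZ => //; exact: openT.
Qed.

Lemma smooth_ell j : smooth setT (ell j : V -> C).
Proof. by move=> k; apply: ck_ell; exact: openT. Qed.

Lemma smooth_phase_r Z : smooth setT (fun Y => phase Y Z).
Proof.
apply: smooth_ext (smoothJ (smooth_phase Z)) => Y.
by rewrite /phase (sympC Z) mulrN expiJ.
Qed.

(** A Lipschitz bound on the derivative makes the remainder quadratic, with a constant
   that can be integrated: this allows differentiation under the integral. *)
Lemma taylor_bound j F (D : R -> C) X (b : R) :
  (forall t, cdrv j F (X + t *: ev j) (D t)) ->
  (forall t, cmod (D t - D 0) <= b * `|t|) ->
  forall t : R, cmod (F (X + t *: ev j) - F X - t%:C * D 0) <= 2 * b * t ^+ 2.
Proof.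
move=> dF hD t; have t1 : `|t| < `|t| + 1 by rewrite ltrDl.
have X0 : F X = F (X + 0 *: ev j) by rewrite scale0r addr0.
have b0 : 0 <= b by have := hD 1; rewrite normr1 mulr1; apply: le_trans; exact: cmod_ge0.
have bound (c : R) : `|c| <= `|t| -> b * `|c| * `|t| <= b * t ^+ 2.
  move=> ct; rewrite -(real_normK (num_real t)) expr2 mulrA.
  by apply: ler_wpM2r => //; apply: ler_wpM2l.
have [c1 [c1t c1E]] := @mvt_sym R (fun t => complex.Re (F (X + t *: ev j)))
  (fun t => complex.Re (D t)) _ (fun r _ => (cdrv_line (dF r)).1) t t1.
have [c2 [c2t c2E]] := @mvt_sym R (fun t => complex.Im (F (X + t *: ev j)))
  (fun t => complex.Im (D t)) _ (fun r _ => (cdrv_line (dF r)).2) t t1.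
rewrite -X0 in c1E c2E; apply: le_trans (cmod_le _) _.
rewrite !(ReD, ImD, ReN, ImN, ReM, ImM, ReR, ImR) c1E c2E.
have -> : 2 * b * t ^+ 2 = b * t ^+ 2 + b * t ^+ 2 by ring.
apply: lerD.
  apply: le_trans (bound _ c1t).
  have -> : complex.Re (D c1) * t - (t * complex.Re (D 0) - 0 * complex.Im (D 0)) =
     complex.Re (D c1 - D 0) * t by rewrite ReD ReN; ring.
  by rewrite normrM; apply: ler_wpM2r => //; apply: le_trans (cmod_Re _) (hD _).
apply: le_trans (bound _ c2t).
have -> : complex.Im (D c2) * t - (t * complex.Im (D 0) + 0 * complex.Re (D 0)) =
   complex.Im (D c2 - D 0) * t by rewrite ImD ImN; ring.
by rewrite normrM; apply: ler_wpM2r => //; apply: le_trans (cmod_Im _) (hD _).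
Qed.

Definition corr_ker phi psi Z Y : C := (psi (Z + Y))^*%C * phi Y * phase Y Z.

(** Up to the constant of the twisted convolution, this is the function to which [a]
   is applied in the pairing of the twisted convolution of [a] and [phi] with [psi]. *)
Definition corr phi psi Z : C := cint (corr_ker phi psi Z).

Lemma corr_ker_tf phi psi Z : tf phi -> tf psi -> tf (corr_ker phi psi Z).
Proof.
move=> h1 h2; have h3 : smooth setT (fun Y => (psi (Z + Y))^*%C).
  apply: smoothJ; apply: smooth_ext (smooth_shift Z h2.1) => Y; by rewrite addrC.
apply: tf_ext (tfM (tfM h1 h3) (smooth_phase_r Z)) => Y.
by rewrite /corr_ker (mulrC (phi Y)).
Qed.

Lemma corr_ker_cdom phi psi Z : tf phi -> tf psi -> cdom (corr_ker phi psi Z).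
Proof. by move=> h1 h2; apply/tc_cdom/tf_tc/corr_ker_tf. Qed.

(** Differentiating the phase of [corr_ker] multiplies [phi] by a linear form, so the
   derivatives of correlations are again correlations. *)
Definition mulell j phi Y : C := - ell j Y * phi Y.

Lemma mulell_tf j phi : tf phi -> tf (mulell j phi).
Proof.
move=> h; apply: tf_ext (tfM h (smoothM (smooth_cst (-1)) (smooth_ell j))) => Y.
by rewrite /mulell; ring.
Qed.

Lemma cdrv_corr_ker j phi psi Z Y : tf psi ->
  cdrv j (fun Z => corr_ker phi psi Z Y) Z
    (corr_ker phi (pd j psi) Z Y + corr_ker (mulell j phi) psi Z Y).
Proof.
move=> hpsi; have h1 : cdrv j (fun Z => (psi (Z + Y))^*%C) Z (pd j psi (Z + Y))^*%C.
  by apply: cdrvJ; apply: cdrv_shift; exact: (smooth_drv j hpsi.1).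
have := cdrvM (cdrvM h1 (cdrv_cst j Z (phi Y))) (cdrv_phase j Y Z).
by congr cdrv; rewrite /corr_ker /mulell; ring.
Qed.

(** The Lipschitz constant in [Z] is integrable in [Y]: this gives continuity of [corr]
   and, applied to the derivatives of the kernel, [cdrv_corr]. *)
Lemma corr_ker_lipschitz phi psi : tf phi -> tf psi -> exists2 L : R, 0 <= L &
  forall Z Z' Y, cmod (corr_ker phi psi Z Y - corr_ker phi psi Z' Y) <=
    L * `|Z - Z'| * cmod (phi Y).
Proof.
move=> hphi hpsi; have [_ [M hM]] := hphi.
have [B B0 hB] := tf_bounded hpsi.
have [B' B'0 hB'] : exists2 B : R, 0 <= B & forall j x, cmod (pd j psi x) <= B.
  by apply: common_bound => j; exact: tf_bounded (tf_pd j hpsi).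
pose K : R := B' + 4 * d%:R * `|M| * B.
have K0 : 0 <= K by rewrite addr_ge0 ?mulr_ge0.
exists (2 * K * (d + d)%:R); first by rewrite !mulr_ge0.
move=> Z Z' Y; have [YM|MY] := leP `|Y| `|M|; last first.
  have Y0 : phi Y = 0 by apply: hM; exact: le_lt_trans (ler_norm _) MY.
  by rewrite /corr_ker Y0 cmod0 !mulr0 !mul0r subrr cmod0.
pose H Z := (psi (Z + Y))^*%C * phase Y Z.
have -> : corr_ker phi psi Z Y - corr_ker phi psi Z' Y = phi Y * (H Z - H Z').
  by rewrite /corr_ker /H; ring.
rewrite cmodM mulrC; apply: ler_wpM2r; first exact: cmod_ge0.
apply: lipschitz_of_bounded_partials => j X.
exists ((pd j psi (X + Y))^*%C * phase Y X + (psi (X + Y))^*%C * (- ell j Y * phase Y X)); split.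
  apply: cdrvM (cdrv_phase j Y X); apply: cdrvJ; apply: cdrv_shift.
  exact: (smooth_drv j hpsi.1).
apply: le_trans (cmodD _ _) _; apply: lerD.
  by rewrite cmodM cmod_phase mulr1 cmodJ; exact: hB'.
rewrite !cmodM cmod_phase mulr1 cmodJ cmodN mulrC.
apply: ler_pM; rewrite ?cmod_ge0//.
rewrite cmod_ell; have := symp_bound Y (ev j); rewrite norm_ev mulr1 => h.
have D0 : 0 <= d%:R :> R by [].
move: (d%:R : R) (`|symplectic Y (ev j)|) h D0 => D s h D0; nra.
Qed.

Lemma corr_lipschitz phi psi : tf phi -> tf psi -> exists2 L : R, 0 <= L &
  forall Z Z', cmod (corr phi psi Z - corr phi psi Z') <= L * `|Z - Z'|.
Proof.
move=> h1 h2; have [L L0 hL] := corr_ker_lipschitz h1 h2.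
have hr := tc_cmod (tf_tc h1).
exists (2 * (L * rint (fun Y => cmod (phi Y)))).
  by rewrite !mulr_ge0// rint_ge0// => x; exact: cmod_ge0.
move=> Z Z'; rewrite -cintB; try exact: corr_ker_cdom.
have -> : 2 * (L * rint (fun Y => cmod (phi Y))) * `|Z - Z'| =
    2 * rint (fun Y => L * `|Z - Z'| * cmod (phi Y)) by rewrite rintZ//; ring.
apply: cint_bound => //; last exact: rdomZ.
by apply: cdomB; exact: corr_ker_cdom.
Qed.

Lemma cdrv_corr j phi psi Z : tf phi -> tf psi ->
  cdrv j (corr phi psi) Z (corr phi (pd j psi) Z + corr (mulell j phi) psi Z).
Proof.
move=> h1 h2; have h1' := mulell_tf j h1; have h2' := tf_pd j h2.
have [L1 L10 hL1] := corr_ker_lipschitz h1 h2'.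
have [L2 L20 hL2] := corr_ker_lipschitz h1' h2.
pose b Y : R := L1 * cmod (phi Y) + L2 * cmod (mulell j phi Y).
have bd : rdom b by apply: rdomD; apply: rdomZ; apply: tc_cmod; exact: tf_tc.
have b0 Y : 0 <= b Y by rewrite addr_ge0 ?mulr_ge0 ?cmod_ge0.
have rb0 : 0 <= rint b by exact: rint_ge0.
apply/cdrv_dist => e e0; exists (e / (4 * rint b + 1)).
  by rewrite divr_gt0// ltr_wpDl// mulr_ge0.
move=> t td.
have k1 := corr_ker_cdom; have k2 := fun X => cdomD (k1 _ _ X h1 h2') (k1 _ _ X h1' h2).
rewrite -cintD; [|exact: k1|exact: k1].
rewrite -cintB; [|exact: k1|exact: k1].
rewrite -cintZ//; rewrite -cintB; [|by apply: cdomB; exact: k1|exact: cdomZ].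
apply: (@le_trans _ _ (2 * rint (fun Y => 2 * t ^+ 2 * b Y))).
  apply: cint_bound; [|exact: rdomZ|].
    by apply: cdomB; [apply: cdomB; exact: k1|exact: cdomZ].
  move=> Y.
  pose D (t : R) := corr_ker phi (pd j psi) (Z + t *: ev j) Y +
                    corr_ker (mulell j phi) psi (Z + t *: ev j) Y.
  have -> : corr_ker phi (pd j psi) Z Y + corr_ker (mulell j phi) psi Z Y = D 0.
    by rewrite /D scale0r addr0.
  rewrite [leRHS]mulrAC.
  apply: (@taylor_bound j (fun Z => corr_ker phi psi Z Y) D Z (b Y)).
    by move=> s; exact: cdrv_corr_ker.
  move=> s; rewrite /D scale0r addr0.
  have -> : forall p q p' q' : C, p + q - (p' + q') = (p - p') + (q - q') by move=> *; ring.
  apply: le_trans (cmodD _ _) _.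
  have := hL1 (Z + s *: ev j) Z Y; have := hL2 (Z + s *: ev j) Z Y.
  rewrite (addrC Z) addrK normrZ norm_ev mulr1 => H2 H1.
  apply: le_trans (lerD H1 H2) _; rewrite /b.
  have E (p q u v z : R) : p * z * u + q * z * v = (p * u + q * v) * z by ring.
  by rewrite E.
rewrite rintZ// -(real_normK (num_real t)).
have : `|t| * (4 * rint b + 1) < e by rewrite -ltr_pdivlMr// ltr_wpDl// mulr_ge0.
move: (normr_ge0 t) rb0; move: `|t| (rint b) => s r s0 r0 h; nra.
Qed.

Lemma corr_tf phi psi : tf phi -> tf psi -> tf (corr phi psi).
Proof.
move=> h1 h2; split; last first.
  have [_ [M hM]] := h1; have [_ [N hN]] := h2; exists (M + N) => Z ZM.
  rewrite /corr -(@cint0 R (d + d)); congr cint; apply/funext => Y; rewrite /corr_ker.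
  have [YM|MY] := leP `|Y| M; last by rewrite hM ?mulr0 ?mul0r.
  rewrite hN ?conjR ?mul0r//.
  by have := ler_normB (Z + Y) Y; rewrite addrK => ?; lra.
move=> k; elim: k phi psi h1 h2 => [|k IH] phi psi h1 h2;
  have cc X : ccont (corr phi psi) X; try (
    have [L L0 hL] := corr_lipschitz h1 h2;
    apply/ccont_dist => e e0; exists (e / (L + 1)); [by rewrite divr_gt0// ltr_wpDl|];
    move=> Y YX; apply: le_lt_trans (hL Y X) _;
    move: YX; rewrite ltr_pdivlMr ?ltr_wpDl//; move: (normr_ge0 (Y - X));
    move: `|Y - X| => s s0 hs; nra).
  by split.
apply: (ck_intro openT) => // j.
exists (fun Z => corr phi (pd j psi) Z + corr (mulell j phi) psi Z); split.
  by move=> X _; exact: cdrv_corr.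
by apply: (ckD openT); apply: IH => //; [exact: tf_pd|exact: mulell_tf].
Qed.

End correlation.

(** * The positive form on test functions *)

Section positive_form.
Context {R : realType} {d : nat}.
Local Notation C := R[i].
Local Notation V := 'rV[R]_(d + d).
Implicit Types (F phi psi : V -> C) (X Y Z W : V) (j : 'I_(d + d)).

Lemma corr_linl (c : C) phi phi' psi Z : tf phi -> tf phi' -> tf psi ->
  corr (fun x => c * phi x + phi' x) psi Z = c * corr phi psi Z + corr phi' psi Z.
Proof.
move=> h1 h2 h3; have k := corr_ker_cdom Z.
rewrite /corr -cintZ; last exact: k.
rewrite -cintD; [|by apply: cdomZ; exact: k|exact: k].
by congr cint; apply/funext => Y; rewrite /corr_ker; ring.
Qed.

Lemma corr_linr (c : C) phi psi psi' Z : tf phi -> tf psi -> tf psi' ->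
  corr phi (fun x => c * psi x + psi' x) Z = c^*%C * corr phi psi Z + corr phi psi' Z.
Proof.
move=> h1 h2 h3; have k := corr_ker_cdom Z.
rewrite /corr -cintZ; last exact: k.
rewrite -cintD; [|by apply: cdomZ; exact: k|exact: k].
by congr cint; apply/funext => Y; rewrite /corr_ker conjD conjM; ring.
Qed.

Definition testf := {phi : V -> C | tf phi}.

(** The test function represented by a formal combination; positivity of the kernel
   [form] is positivity on the diagonal. *)
Definition comb (c : seq (C * testf)) : V -> C :=
  fun x => \sum_(p <- c) p.1 * sval p.2 x.

Lemma comb_cons p c : comb (p :: c) = fun x => p.1 * sval p.2 x + comb c x.
Proof. by apply/funext => x; rewrite /comb big_cons. Qed.

Lemma comb_tf c : tf (comb c).
Proof. by apply: tf_sum => -[z [phi hphi]] /=; exact: tfZ. Qed.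

Section form.
Variable a : (V -> C) -> C.
Hypothesis ta : tempered a.

Lemma a_lin (c : C) phi psi : tf phi -> tf psi ->
  a (fun x => c * phi x + psi x) = c * a phi + a psi.
Proof. by move=> h1 h2; apply: ta.1; exact: tf_schwartz. Qed.

Lemma a0 : a (fun=> 0) = 0.
Proof.
rewrite -[RHS](addNr (a (fun=> 0))) -(mulN1r (a (fun=> 0))) -a_lin; [|exact: tf0|exact: tf0].
by congr a; apply/funext => x; rewrite mulr0 addr0.
Qed.

Lemma aZ (c : C) phi : tf phi -> a (fun x => c * phi x) = c * a phi.
Proof.
move=> h; have := a_lin c h tf0; rewrite a0 addr0 => <-.
by congr a; apply/funext => x; rewrite addr0.
Qed.

Lemma a_sum (I : Type) (r : seq I) (F : I -> V -> C) : (forall i, tf (F i)) ->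
  a (fun x => \sum_(i <- r) F i x) = \sum_(i <- r) a (F i).
Proof.
move=> h; elim: r => [|i r IH].
  by rewrite [RHS]big_nil -[RHS]a0; congr a; apply/funext => x; rewrite big_nil.
rewrite [RHS]big_cons -IH -[a (F i)]mul1r -a_lin//; last exact: tf_sum.
by congr a; apply/funext => x; rewrite big_cons mul1r.
Qed.

Definition form phi psi : C := a (corr phi psi).

Lemma form_linl (c : C) phi phi' psi : tf phi -> tf phi' -> tf psi ->
  form (fun x => c * phi x + phi' x) psi = c * form phi psi + form phi' psi.
Proof.
move=> h1 h2 h3; rewrite -a_lin; [|exact: corr_tf|exact: corr_tf].
by congr a; apply/funext => Z; exact: corr_linl.
Qed.

Lemma form_linr (c : C) phi psi psi' : tf phi -> tf psi -> tf psi' ->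
  form phi (fun x => c * psi x + psi' x) = c^*%C * form phi psi + form phi psi'.
Proof.
move=> h1 h2 h3; rewrite -a_lin; [|exact: corr_tf|exact: corr_tf].
by congr a; apply/funext => Z; exact: corr_linr.
Qed.

Lemma form0l psi : tf psi -> form (fun=> 0) psi = 0.
Proof.
move=> h; rewrite -[RHS](addNr (form (fun=> 0) psi)) -(mulN1r (form _ _)) -form_linl//; try exact: tf0.
by congr form; apply/funext => x; rewrite mulr0 addr0.
Qed.

Lemma form0r phi : tf phi -> form phi (fun=> 0) = 0.
Proof.
move=> h; rewrite -[RHS](addNr (form phi (fun=> 0))) -(mulN1r (form _ _)) -conjN1.
rewrite -form_linr//; try exact: tf0.
by congr form; apply/funext => x; rewrite mulr0 addr0.
Qed.

Lemma kform_form c c' :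
  kform (fun i j : testf => form (sval i) (sval j)) c c' = form (comb c) (comb c').
Proof.
rewrite /kform; elim: c => [|p c IH].
  rewrite big_nil (_ : comb [::] = fun=> 0); last by apply/funext => x; rewrite /comb big_nil.
  by rewrite form0l//; exact: comb_tf.
have hp := svalP p.2.
rewrite big_cons IH comb_cons form_linl//; [|exact: comb_tf|exact: comb_tf].
congr (_ + _); elim: c' {IH} => [|q c' IH].
  rewrite big_nil (_ : comb [::] = fun=> 0); last by apply/funext => x; rewrite /comb big_nil.
  by rewrite form0r// mulr0.
have hq := svalP q.2.
rewrite big_cons IH comb_cons form_linr//; last exact: comb_tf.
by ring.
Qed.

Hypothesis pa : forall phi, schwartz phi -> 0 <= sesq (tconv_dist a phi) phi.

(** Reflecting the integration variable and conjugating identifies the twisted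
   convolution in the hypothesis with [corr phi phi], up to the positive constant
   [(2 / pi) ^ (d / 2)]. *)
Lemma form_ge0 phi : tf phi -> 0 <= form phi phi.
Proof.
move=> h; have := pa (tf_schwartz h).
rewrite /sesq /tconv_dist /sesq.
set c := ((2 / pi) `^ (d%:R / 2) : R).
have c0 : 0 < c by rewrite powR_gt0// divr_gt0// pi_gt0.
set G := (X in a X).
have -> : G = (fun Z => c%:C * corr phi phi Z).
  apply/funext => Z; rewrite /G /tconv cintegral_cint -/c conjM conjR; congr (_ * _).
  have h1 := corr_ker_cdom Z h h.
  have h2 : cdom (fun Y => (corr_ker phi phi Z (- Y))).
    have E (g : V -> R) : rdom g -> rdom (fun Y => g (- Y)).
      move=> /(rdom_affine 0 (or_intror erefl)).
      by congr rdom; apply/funext => Y; rewrite scaleN1r addr0.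
    by case: h1 => h3 h4; split; [exact: E h3|exact: E h4].
  have E : (cint (fun Y => (corr_ker phi phi Z (- Y))^*%C))^*%C = corr phi phi Z.
    by rewrite cintJ// cint_opp// conjcK.
  rewrite -E; congr (conjc (cint _)).
  by apply/funext => Y; rewrite /corr_ker !conjM !conjcK /phase sympNr mulrN -expiJ conjcK.
rewrite aZ; last exact: corr_tf.
rewrite -/(form phi phi) => /ge0c[h1 h2]; apply/ge0c.
move: h1 h2; rewrite ReM ImM ReR ImR mul0r addr0 mul0r subr0.
move: (form phi phi) => z h1 h2; split; last by move: h2; rewrite pmulr_rge0.
by move/eqP: h1; rewrite mulf_eq0 gt_eqF//= => /eqP.
Qed.

Lemma form_psd : psd predT (fun i j : testf => form (sval i) (sval j)).
Proof. by move=> c _; rewrite kform_form; apply: form_ge0; exact: comb_tf. Qed.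

End form.

(** Twisted translations are the unitary operators which leave all correlations
   unchanged, see [corr_tshift]. *)
Definition tshift W phi Y : C := phi (Y - W) * phase W Y.

Lemma tshift_tf W phi : tf phi -> tf (tshift W phi).
Proof. by move=> h; apply: tfM; [exact: tf_shift|exact: smooth_phase]. Qed.

Lemma tshift0 phi : tshift 0 phi = phi.
Proof.
apply/funext => Y; rewrite /tshift /phase subr0.
have -> : symplectic Y 0 = 0 :> R by have := sympZr 0 Y 0; rewrite scale0r mul0r.
by rewrite mulr0 expi0 mulr1.
Qed.

Lemma corr_tshift W phi psi : tf phi -> tf psi -> corr (tshift W phi) (tshift W psi) = corr phi psi.
Proof.
move=> h1 h2; apply/funext => Z; rewrite /corr.
rewrite -[RHS](cint_shift (- W) (corr_ker_cdom Z h1 h2)); congr cint.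
apply/funext => Y; rewrite /corr_ker /tshift conjM addrA.
have -> : phase (Y - W) Z = (phase W (Z + Y))^*%C * phase W Y * phase Y Z.
  rewrite /phase expiJ -!expiD; congr expi.
  rewrite !sympE; ring.
by ring.
Qed.

(** Twisted translations compose up to a phase: a projective representation. *)
Lemma tshift_comp W W' phi :
  tshift W' phi = fun Y => expi (2 * symplectic W W') * tshift W (tshift (W' - W) phi) Y.
Proof.
apply/funext => Y; rewrite /tshift -addrA -opprD subrKC.
rewrite mulrCA -!mulrA; congr (_ * _).
rewrite /phase -!expiD; congr expi; rewrite !sympE !sympxx; ring.
Qed.

End positive_form.

(** * Localization of the form *)

Section localization.
Context {R : realType} {d : nat}.
Local Notation C := R[i].
Local Notation V := 'rV[R]_(d + d).
Implicit Types (F phi psi : V -> C) (X Y Z W : V) (j : 'I_(d + d)).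

Lemma open_far W (M : R) : open [set Z : V | M < `|Z - W|].
Proof.
apply: (@open_comp _ _ (fun Z : V => `|Z - W|) [set r : R | M < r]); last exact: open_gt.
move=> Z _; apply: (@continuous_comp _ _ _ (fun Z : V => Z - W) (fun Z : V => `|Z|)).
  by apply: continuousB; [exact: (fun _ => id)|exact: cst_continuous].
exact: norm_continuous.
Qed.

Lemma compact_cball_at W (M : R) : compact [set Z : V | `|Z - W| <= M].
Proof.
have -> : [set Z : V | `|Z - W| <= M] = (fun Z => Z + W) @` [set Z : V | `|Z| <= M].
  apply/seteqP; split => [Z /= h|_ [Z /= h <-]] /=; last by rewrite addrK.
  by exists (Z - W) => //; rewrite subrK.
apply: continuous_compact; last exact: compact_cball.
apply: continuous_subspaceT => Z.
by apply: continuousD; [exact: (fun _ => id)|exact: cst_continuous].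
Qed.

(** The left-hand side contains the phase of [corr chi1 (tshift W chi2)], which equals
   [1] at [Z = W] and [Y = 0]. *)
Lemma phase_bound (r : R) W Z Y : 0 <= r -> r <= 1 -> `|Y| <= r -> `|Z - W| <= 2 * r ->
  cmod ((phase W (Z + Y))^*%C * phase Y Z - 1) <= 16 * d%:R * (2 * `|W| + 1) * r.
Proof.
move=> r0 r1 Yr Zr; rewrite /phase expiJ -expiD.
have D0 : 0 <= d%:R :> R by [].
have -> : - (2 * symplectic (Z + Y) W) + 2 * symplectic Z Y =
   2 * (2 * symplectic W Y + symplectic (Z - W) Y - symplectic (Z - W) W).
  rewrite !sympE (sympC W Y) !sympxx; ring.
apply: le_trans (cmod_expiB1 _) _; rewrite normrM gtr0_norm//.
have h1 := symp_bound W Y; have h2 := symp_bound (Z - W) Y; have h3 := symp_bound (Z - W) W.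
have := ler_normD (2 * symplectic W Y + symplectic (Z - W) Y) (- symplectic (Z - W) W).
have := ler_normD (2 * symplectic W Y) (symplectic (Z - W) Y).
rewrite normrN normrM (gtr0_norm (ltr0n R 2)) => k1 k2.
have W0 := normr_ge0 W; have Y0 := normr_ge0 Y; have ZW0 := normr_ge0 (Z - W).
have m1 : 2 * d%:R * `|W| * `|Y| <= 2 * d%:R * `|W| * r.
  by apply: ler_wpM2l => //; rewrite !mulr_ge0.
have m2 : 2 * d%:R * `|Z - W| * `|Y| <= 2 * d%:R * (2 * r) * 1.
  by apply: ler_pM; rewrite ?mulr_ge0//; [apply: ler_wpM2l; rewrite ?mulr_ge0|exact: le_trans r1].
have m3 : 2 * d%:R * `|Z - W| * `|W| <= 2 * d%:R * (2 * r) * `|W|.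
  by apply: ler_wpM2r => //; apply: ler_wpM2l; rewrite ?mulr_ge0.
have m4 : 0 <= d%:R * r by rewrite mulr_ge0.
have m5 : 0 <= d%:R * r * `|W| by rewrite !mulr_ge0.
move: (d%:R : R) (`|W|) (`|Y|) (`|Z - W|) D0 h1 h2 h3 k1 k2 m1 m2 m3 m4 m5 => D w y z.
move=> D0 h1 h2 h3 k1 k2 m1 m2 m3 m4 m5; nra.
Qed.

Definition norm1 phi : R := rint (fun x => cmod (phi x)).

Lemma norm1_ge0 phi : 0 <= norm1 phi.
Proof. by apply: rint_ge0 => x; exact: cmod_ge0. Qed.

Lemma tc_weak (F : V -> C) W (M : R) (U : set V) : open U ->
  (forall Z, U Z -> ccont F Z) -> (forall Z, M < `|Z - W| -> F Z = 0) ->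
  (forall Z, `|Z - W| <= M -> U Z) -> tc F.
Proof.
move=> Uo FU F0 MU; split; last first.
  exists (M + `|W|) => Z ZM; apply: F0; have := ler_normD (Z - W) W.
  by rewrite subrK => ?; lra.
move=> Z; have [ZM|MZ] := leP `|Z - W| M; first exact/FU/MU.
apply: (@ccont_near _ _ (fun=> 0)); last exact: ccont_cst.
exact: (open_near (@open_far W M) MZ (fun Y h => esym (F0 Y h))).
Qed.

(** The correlation of [chi1] and [tshift W chi2] is supported near [W], where [a] is
   the function [f] and [f] and the phase are nearly constant; the integral of the
   correlation without its phase is the product of the integrals. *)
Lemma local_form (U : set V) (a : (V -> C) -> C) (f : V -> C) W (delta : R) :
  open U -> (forall Z, U Z -> ccont f Z) -> coincides_on U a f -> U W -> 0 < delta ->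
  exists2 r : R, 0 < r & forall chi1 chi2, tf chi1 -> tf chi2 ->
    (forall Z, r < `|Z| -> chi1 Z = 0) -> (forall Z, r < `|Z| -> chi2 Z = 0) ->
    cmod (form a chi1 (tshift W chi2) - f W * (cint chi1 * (cint chi2)^*%C)) <=
      delta * (norm1 chi1 * norm1 chi2).
Proof.
move=> Uo fc af UW d0.
have /nbhs_ballP[r1 /= r10 hr1] : nbhs W U by exact: open_nbhs_nbhs.
have d8 : 0 < delta / 8 by rewrite divr_gt0.
have /ccont_dist/(_ _ d8)[r2 r20 hr2] := fc _ UW.
pose K : R := cmod (f W) * (16 * d%:R * (2 * `|W| + 1)).
have K0 : 0 <= K by rewrite !mulr_ge0 ?cmod_ge0// addr_ge0// mulr_ge0.
have K1 : 0 < K + 1 by rewrite ltr_wpDl.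
pose r : R := Num.min (Num.min 1 (r1 / 3)) (Num.min (r2 / 3) (delta / 8 / (K + 1))).
have r0 : 0 < r by rewrite !lt_min ltr01 !divr_gt0.
have rle1 : r <= 1 by rewrite !ge_min lexx.
have rler1 : r <= r1 / 3 by rewrite !ge_min lexx !orbT.
have rler2 : r <= r2 / 3 by rewrite !ge_min lexx !orbT.
have rlek : r <= delta / 8 / (K + 1) by rewrite !ge_min lexx !orbT.
exists r => // chi1 chi2 t1 t2 s1 s2.
pose G := corr chi1 (tshift W chi2).
have Gt : tf G by apply: corr_tf => //; exact: tshift_tf.
have ker0 Z Y : chi1 Y != 0 -> chi2 (Z + Y - W) != 0 -> `|Y| <= r /\ `|Z - W| <= 2 * r.
  move=> c1 c2; have Yr : `|Y| <= r by rewrite leNgt; apply: contraNN c1 => /s1 ->.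
  have Zr : `|Z + Y - W| <= r by rewrite leNgt; apply: contraNN c2 => /s2 ->.
  split => //; have := ler_normB (Z + Y - W) Y.
  have -> : Z + Y - W - Y = Z - W by rewrite addrAC addrK.
  by lra.
have G0 Z : 2 * r < `|Z - W| -> G Z = 0.
  move=> Zr; rewrite /G /corr -(@cint0 R (d + d)); congr cint; apply/funext => Y.
  rewrite /corr_ker /tshift; have [->|c1] := eqVneq (chi1 Y) 0; first by rewrite mulr0 mul0r.
  have [->|c2] := eqVneq (chi2 (Z + Y - W)) 0; first by rewrite mul0r conjR !mul0r.
  by have [_ h] := ker0 _ _ c1 c2; move: Zr; rewrite ltNge h.
have near_U Z : `|Z - W| <= 2 * r -> U Z.
  by move=> h; apply: hr1; rewrite -ball_normE /ball_ /= distrC; lra.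
have Gtest : test_fun U G.
  split; first by apply/(smooth_onP openT); case: Gt.
  exists [set Z : V | `|Z - W| <= 2 * r]; split => //; first exact: compact_cball_at.
  by move=> Z /= /negP; rewrite -ltNge; exact: G0.
rewrite /form -/G (af _ Gtest) cintegral_cint.
pose A Y := (chi2 (Y - W))^*%C.
have At : tc A by apply/tf_tc/tfJ/tf_shift.
have [Qd QE] := cint_conv At (tf_tc t1).
have AE : cint A = (cint chi2)^*%C.
  by rewrite cintJ; [rewrite cint_shift//; exact: tc_cdom (tf_tc t2)|exact/tc_cdom/tf_tc/tf_shift].
have fGt : tc (fun Z => f Z * G Z).
  apply: (@tc_weak _ W (2 * r) U) => //.
    by move=> Z UZ; apply: ccontM; [exact: fc|exact: smooth_cont Gt.1 _].
  by move=> Z /G0 ->; rewrite mulr0.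
have -> : f W * (cint chi1 * (cint chi2)^*%C) =
    cint (fun Z => f W * cint (fun Y => A (Z + Y) * chi1 Y)).
  by rewrite cintZ// QE AE (mulrC (cint chi1)).
rewrite -cintB; [|exact: tc_cdom|exact: cdomZ].
have n1 := tc_cmod (tf_tc t1).
have n2 : rdom (fun Y => cmod (A Y)) := tc_cmod At.
have q1 Z : tc (fun Y => A (Z + Y) * chi1 Y).
  have h := tfM t1 (smoothJ (smooth_shift (Z - W) t2.1)).
  apply: tf_tc; apply: tf_ext h => Y; rewrite /A mulrC; congr ((chi2 _)^*%C * _).
  by rewrite addrCA addrA.
have q2 Z : rdom (fun Y => cmod (A (Z + Y)) * cmod (chi1 Y)).
  have := tc_cmod (q1 Z); congr rdom; apply/funext => Y; exact: cmodM.
have [qd qE] := rint_conv n2 n1 q2.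
have nA : rint (fun Y => cmod (A Y)) = norm1 chi2.
  rewrite /norm1 -(rint_shift (- W) (tc_cmod (tf_tc t2))); congr rint; apply/funext => Y; exact: cmodJ.
apply: (@le_trans _ _ (2 * rint (fun Z => delta / 2 *
    rint (fun Y => cmod (A (Z + Y)) * cmod (chi1 Y))))); last first.
  rewrite rintZ// qE nA -/(norm1 chi1) (mulrC (norm1 chi1)) mulrA (mulrC 2) divfK//.
apply: cint_bound; [by apply: cdomB; [exact: tc_cdom|exact: cdomZ]|exact: rdomZ|].
move=> Z; rewrite /G /corr.
pose D Y := (f Z * ((phase W (Z + Y))^*%C * phase Y Z) - f W) * (A (Z + Y) * chi1 Y).
have kt := corr_ker_cdom Z t1 (tshift_tf W t2).
have DE : (fun Y => f Z * corr_ker chi1 (tshift W chi2) Z Y - f W * (A (Z + Y) * chi1 Y)) = D.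
  apply/funext => Y; rewrite /D /corr_ker /tshift /A conjM.
  have E (p q s t u v : C) : p * (q * s * t * u) - v * (q * t) = (p * (s * u) - v) * (q * t) by ring.
  exact: E.
rewrite -cintZ// -(cintZ (f W)); last exact: tc_cdom (q1 Z).
rewrite -cintB; [|exact: cdomZ|by apply: cdomZ; exact: tc_cdom (q1 Z)].
rewrite DE; apply: (@le_trans _ _ (2 * rint (fun Y => delta / 4 * (cmod (A (Z + Y)) * cmod (chi1 Y))))).
  apply: cint_bound; [|exact: rdomZ|].
    by rewrite -DE; apply: cdomB; apply: cdomZ => //; exact: tc_cdom (q1 Z).
  move=> Y; rewrite /D cmodM cmodM.
  have [->|c1] := eqVneq (chi1 Y) 0; first by rewrite cmod0 !mulr0.
  have [Z0|c2] := eqVneq (chi2 (Z + Y - W)) 0.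
    by rewrite /A Z0 conjR cmod0 mul0r !mulr0.
  have [Yr Zr] := ker0 _ _ c1 c2.
  apply: ler_wpM2r; first by rewrite mulr_ge0 ?cmod_ge0.
  have P1 : cmod ((phase W (Z + Y))^*%C * phase Y Z) = 1 by rewrite cmodM cmodJ !cmod_phase mulr1.
  have E (p q t : C) : p * q - t = (p - t) * q + t * (q - 1) by ring.
  rewrite E; apply: le_trans (cmodD _ _) _; rewrite (cmodM (f Z - f W)) P1 mulr1 (cmodM (f W)).
  have h1 : cmod (f Z - f W) < delta / 8 by apply: hr2; lra.
  have h2 := phase_bound (ltW r0) rle1 Yr Zr.
  have h3 : cmod (f W) * cmod ((phase W (Z + Y))^*%C * phase Y Z - 1) <= K * r.
    by rewrite /K -mulrA; apply: ler_wpM2l => //; exact: cmod_ge0.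
  have h4 : K * r <= delta / 8.
    apply: (@le_trans _ _ ((K + 1) * r)); first by apply: ler_wpM2r; [exact: ltW|lra].
    by rewrite mulrC -ler_pdivlMr.
  move: (cmod (f Z - f W)) (cmod (f W) * _) (K * r) h1 h3 h4 => p q t h1 h3 h4; lra.
rewrite rintZ//.
have E (t p : R) : 2 * (t / 4 * p) = t / 2 * p by field.
by rewrite E.
Qed.

End localization.

(** * Mollifiers *)

Section mollifier.
Context {R : realType} {d : nat}.
Local Notation C := R[i].
Local Notation V := 'rV[R]_(d + d).
Implicit Types (F phi psi m : V -> C) (X Y Z W : V) (j : 'I_(d + d)).

Definition moll (N : nat) X : C :=
  ((rint (fun Y : V => cutr 1 N.+1%:R Y))^-1 * cutr 1 N.+1%:R X)%:C.

Lemma cutr1_eq0 N X : N.+1%:R^-1 < `|X| -> cutr 1 N.+1%:R X = 0 :> R.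
Proof.
by move=> h; apply: cutr_eq0 => //; rewrite mulrC -ltr_pdivrMr// div1r.
Qed.

Lemma cutr_tf N : tf (fun X : V => (cutr 1 N.+1%:R X)%:C).
Proof.
by split; [exact: smooth_cut|exists N.+1%:R^-1 => X /cutr1_eq0 ->].
Qed.

Lemma cutr_rdom N : rdom (fun X : V => cutr 1 N.+1%:R X).
Proof. by have [] := tc_cdom (tf_tc (cutr_tf N)). Qed.

Lemma cutr_int_gt0 N : 0 < rint (fun X : V => cutr 1 N.+1%:R X).
Proof.
apply: rint_gt0; [exact: cutr_rdom|move=> X; exact: cutr_ge0| |].
  by have [h _] := (tf_tc (cutr_tf N)).1 0.
by rewrite cutr_eq1// normr0 mulr0 subrr.
Qed.

Lemma moll_tf N : tf (moll N).
Proof.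
apply: tf_ext (tfZ ((rint (fun Y : V => cutr 1 N.+1%:R Y))^-1)%:C (cutr_tf N)) => X.
by rewrite /moll rmorphM.
Qed.

Lemma moll_support N X : N.+1%:R^-1 < `|X| -> moll N X = 0.
Proof. by move=> /cutr1_eq0 h; rewrite /moll h mulr0. Qed.

Lemma norm1_moll N : norm1 (moll N) = 1.
Proof.
have I0 := cutr_int_gt0 N.
rewrite -[RHS](mulVf (lt0r_neq0 I0)) -rintZ; last exact: cutr_rdom.
congr rint; apply/funext => X; rewrite /moll cmodR ger0_norm//.
by rewrite mulr_ge0 ?cutr_ge0// invr_ge0 ltW.
Qed.

Lemma cint_moll N : cint (moll N) = 1.
Proof.
have I0 := cutr_int_gt0 N.
rewrite /cint /=; apply: cext => /=; last exact: rint0.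
rewrite -[RHS](mulVf (lt0r_neq0 I0)) -rintZ//; exact: cutr_rdom.
Qed.

(** The mollifier evaluates the rest of the integrand at [Y = 0]; the Lipschitz
   constants of [m], of [psi] and of the phase give the rate [1 / N]. The multiplier [m]
   is there because differentiating [corr] multiplies its first argument by a linear
   form. *)
Lemma corr_moll_base m psi k : tf m -> tf psi -> exists2 c : R, 0 <= c & forall N Z,
  N.+1%:R * (1 + `|Z|) ^+ k *
    cmod (corr (fun Y => m Y * moll N Y) psi Z - m 0 * (psi Z)^*%C) <= c.
Proof.
move=> tm tp.
have [Bm Bm0 hBm] := tf_bounded tm; have [Bp Bp0 hBp] := tf_bounded tp.
have [Lm Lm0 hLm] := tf_lipschitz tm; have [Lp Lp0 hLp] := tf_lipschitz tp.
have [_ [M hM]] := tp.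
pose K : R := Lp * Bm + Bp * Lm + Bp * Bm * (8 * d%:R * (`|M| + 1)).
have K0 : 0 <= K by rewrite !addr_ge0// !mulr_ge0// addr_ge0.
exists ((2 + `|M|) ^+ k * (2 * K)).
  by rewrite mulr_ge0 ?mulr_ge0// exprn_ge0// addr_ge0.
move=> N Z; have mt := moll_tf N.
have kt : tf (fun Y => m Y * moll N Y) by apply: tfM => //; case: mt.
pose D Y := ((psi (Z + Y))^*%C * m Y * phase Y Z - m 0 * (psi Z)^*%C) * moll N Y.
have kd := corr_ker_cdom Z kt tp.
have DE : corr (fun Y => m Y * moll N Y) psi Z - m 0 * (psi Z)^*%C = cint D.
  have mE : m 0 * (psi Z)^*%C = cint (fun Y => m 0 * (psi Z)^*%C * moll N Y).
    by rewrite cintZ ?cint_moll ?mulr1//; exact: tc_cdom (tf_tc mt).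
  rewrite {1}mE /corr -cintB//; last by apply: cdomZ; exact: tc_cdom (tf_tc mt).
  by congr cint; apply/funext => Y; rewrite /corr_ker /D; ring.
have Dd : cdom D.
  have := cdomB kd (cdomZ (m 0 * (psi Z)^*%C) (tc_cdom (tf_tc mt))).
  by congr cdom; apply/funext => Y; rewrite /corr_ker /D; ring.
have N0 : 0 < N.+1%:R :> R by [].
have Ni : N.+1%:R^-1 <= 1 :> R by rewrite invf_le1// ler1n.
rewrite DE; have [ZM|MZ] := ltP (`|M| + 1) `|Z|.
  have D0 : D = fun=> 0.
    apply/funext => Y; rewrite /D; have [YN|NY] := ltP N.+1%:R^-1 `|Y|.
      by rewrite moll_support// mulr0.
    rewrite (hM Z); last by have := ler_norm M; lra.
    rewrite (hM (Z + Y)); first by rewrite conjR !mul0r mulr0 subrr mul0r.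
    have := ler_normB (Z + Y) Y; rewrite addrK; have := le_trans NY Ni; have := ler_norm M.
    by move: ZM; clear; move: `|M| `|Z| `|Y| `|Z + Y| => p q u v; lra.
  by rewrite D0 cint0 cmod0 mulr0 mulr_ge0 ?mulr_ge0// exprn_ge0// addr_ge0.
have nd := tc_cmod (tf_tc mt).
have hD : cmod (cint D) <= 2 * (K / N.+1%:R).
  have -> : 2 * (K / N.+1%:R) = 2 * rint (fun Y => K / N.+1%:R * cmod (moll N Y)).
    by rewrite rintZ// -/(norm1 _) norm1_moll mulr1.
  apply: cint_bound => //; first exact: rdomZ.
  move=> Y; rewrite /D cmodM; have [YN|NY] := ltP N.+1%:R^-1 `|Y|.
    by rewrite moll_support// cmod0 !mulr0.
  apply: ler_wpM2r; first exact: cmod_ge0.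
  have E (p q p' m' u : C) : p * m' * u - q * p' =
      (p - p') * m' * u + p' * (m' - q) * u + p' * q * (u - 1) by ring.
  rewrite E; apply: le_trans (cmodD _ _) _.
  have h1 : cmod (((psi (Z + Y))^*%C - (psi Z)^*%C) * m Y * phase Y Z) <= Lp * Bm * `|Y|.
    rewrite -conjN -conjD !cmodM cmod_phase mulr1 cmodJ mulrAC; apply: ler_pM; rewrite ?cmod_ge0//.
    by have := hLp (Z + Y) Z; rewrite (addrC Z) addrK.
  have h2 : cmod ((psi Z)^*%C * (m Y - m 0) * phase Y Z) <= Bp * Lm * `|Y|.
    rewrite !cmodM cmod_phase mulr1 cmodJ -mulrA; apply: ler_pM; rewrite ?cmod_ge0//.
    by have := hLm Y 0; rewrite subr0.
  have h3 : cmod ((psi Z)^*%C * m 0 * (phase Y Z - 1)) <= Bp * Bm * (8 * d%:R * (`|M| + 1)) * `|Y|.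
    rewrite !cmodM cmodJ -(mulrA (Bp * Bm)); apply: ler_pM; rewrite ?mulr_ge0 ?cmod_ge0//.
      by apply: ler_pM; rewrite ?cmod_ge0.
    apply: le_trans (cmod_expiB1 _) _; rewrite normrM gtr0_norm//.
    have hs := symp_bound Z Y.
    have hz : 2 * d%:R * `|Z| * `|Y| <= 2 * d%:R * (`|M| + 1) * `|Y|.
      by apply: ler_wpM2r => //; apply: ler_wpM2l => //; rewrite mulr_ge0.
    by move: (`|symplectic Z Y|) hs hz => s hs hz; lra.
  apply: (@le_trans _ _ (K * `|Y|)); last by apply: ler_wpM2l.
  rewrite /K (mulrDl (_ + _)) (mulrDl (Lp * Bm)); apply: lerD h3; apply: le_trans (cmodD _ _) _; exact: lerD.
have hz : (1 + `|Z|) ^+ k <= (2 + `|M|) ^+ k.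
  by apply: lerXn2r; rewrite ?nnegrE ?addr_ge0//; lra.
rewrite mulrAC; apply: (@le_trans _ _ (2 * K * (1 + `|Z|) ^+ k)).
  apply: ler_wpM2r; first by rewrite exprn_ge0// addr_ge0.
  rewrite mulrC -ler_pdivlMr//; apply: le_trans hD _; by rewrite mulrA.
by rewrite mulrC; apply: ler_wpM2r => //; rewrite mulr_ge0.
Qed.

Lemma corr_moll m psi k : tf m -> tf psi ->
  udecay (fun N Z => N.+1%:R * (1 + `|Z|) ^+ k)
     (fun N Z => corr (fun Y => m Y * moll N Y) psi Z - m 0 * (psi Z)^*%C).
Proof.
move=> tm tp.
have kt m' N : tf m' -> tf (fun Y => m' Y * moll N Y).
  by move=> h; apply: tfM => //; case: (moll_tf N).
have ct m' p' N : tf m' -> tf p' -> tf (corr (fun Y => m' Y * moll N Y) p').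
  by move=> h1 h2; apply: corr_tf => //; exact: kt.
have Ds m' p' N : tf m' -> tf p' ->
    smooth setT (fun Z => corr (fun Y => m' Y * moll N Y) p' Z - m' 0 * (p' Z)^*%C).
  by move=> h1 h2; apply: smoothB; [case: (ct m' p' N h1 h2)|case: (tfZ (m' 0) (tfJ h2))].
split => [N|b]; first exact: Ds.
elim/last_ind: b m psi tm tp => [|b j IH] m psi tm tp; first exact: corr_moll_base.
have [c1 c10 hc1] := IH _ _ tm (tf_pd j tp).
have [c2 c20 hc2] := IH _ _ (mulell_tf j tm) tp.
exists (c1 + c2); first exact: addr_ge0.
move=> N Z; rewrite pds_rcons.
pose A N Z := corr (fun Y => m Y * moll N Y) (pd j psi) Z - m 0 * (pd j psi Z)^*%C.
pose B N Z := corr (fun Y => mulell j m Y * moll N Y) psi Z - mulell j m 0 * (psi Z)^*%C.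
have E X : [set: V] X -> pd j (fun Z => corr (fun Y => m Y * moll N Y) psi Z - m 0 * (psi Z)^*%C) X =
    A N X + B N X.
  move=> _; apply: cdrv_pd.
  have h1 := cdrv_corr j X (kt m N tm) tp.
  have h2 := cdrvZ (m 0) (cdrvJ (smooth_drv j tp.1 (I : [set: V] X))).
  have := cdrvB h1 h2; congr cdrv.
  have m0 : mulell j m 0 = 0 by rewrite /mulell ell0 oppr0 mul0r.
  have mE : mulell j (fun Y => m Y * moll N Y) = fun Y => mulell j m Y * moll N Y.
    by apply/funext => Y; rewrite /mulell mulrA.
  by rewrite /A /B m0 mE mul0r subr0 addrAC.
rewrite (pds_ext openT b E)// pdsD; [|exact: Ds _ _ _ tm (tf_pd j tp)|exact: Ds _ _ _ (mulell_tf j tm) tp].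
apply: (@le_trans _ _ (N.+1%:R * (1 + `|Z|) ^+ k * (cmod (pds b (A N) Z) + cmod (pds b (B N) Z)))).
  by apply: ler_wpM2l; [rewrite mulr_ge0// exprn_ge0// addr_ge0|exact: cmodD].
by rewrite mulrDr; apply: lerD; [exact: hc1|exact: hc2].
Qed.

(** Correlation with a mollifier tends to conjugation in the Schwartz space, so the
   limit of the mollifiers represents the distribution itself in the form. *)
Lemma form_moll (a : (V -> C) -> C) psi : tempered a -> tf psi -> forall e : R, 0 < e ->
  exists N0, forall N, (N0 <= N)%N -> cmod (form a (moll N) psi - a (fun X => (psi X)^*%C)) < e.
Proof.
move=> ta tp; apply: (tempered_lim ta).
- by apply/tf_schwartz/tfJ.
- by move=> N; apply/tf_schwartz/corr_tf => //; exact: moll_tf.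
(* The cut-off [cutN 0] is [1] on the supports of all mollifiers. *)
move=> k; have := @corr_moll (cutN 0) psi k (cutN_tf 0) tp.
apply: udecay_ext => // N Z; rewrite cutN_eq1 ?normr0// mul1r; congr (_ - _).
congr corr; apply/funext => Y; have [YN|NY] := ltP N.+1%:R^-1 `|Y|.
  by rewrite moll_support// mulr0.
rewrite cutN_eq1 ?mul1r//; apply: le_trans NY _.
by rewrite invf_le1// ler1n.
Qed.

End mollifier.

(** * The density *)

Section density.
Context {R : realType} {d : nat}.
Local Notation C := R[i].
Local Notation V := 'rV[R]_(d + d).
Implicit Types (F phi psi chi : V -> C) (X Y Z W : V) (j : 'I_(d + d)).

Lemma gelfand_shilov_schwartz (s : R) phi : gelfand_shilov s phi -> schwartz phi.
Proof.
move=> [ps [h [h0 hfin]]]; split => // al be.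
set S := (X in (ereal_sup X < +oo)%E) in hfin.
pose D : R := (mi_fact al * mi_fact be)%:R `^ s * h ^+ (mi_size al + mi_size be).
have F0 : 0 < (mi_fact al * mi_fact be)%:R :> R.
  by rewrite ltr0n muln_gt0; apply/andP; split; apply: prodn_gt0 => i; exact: fact_gt0.
have D0 : 0 < D by rewrite mulr_gt0 ?powR_gt0// exprn_gt0.
have [c c0 hc] : exists2 c : R, 0 <= c & forall x,
    cmod ((mi_monom al x)%:C * mderiv be phi x) / D <= c.
  exists `|fine (ereal_sup S)| => [//|x].
  rewrite -lee_fin; apply: (@le_trans _ _ (ereal_sup S)).
    apply: (@le_trans _ _ (ereal_sup
         [set (Normc.normc ((mi_monom al x)%:C * mderiv be phi x) / D)%:E | x in [set: V]])).
      by apply: ereal_sup_ubound; exists x.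
    by apply: ereal_sup_ubound; exists (al, be).
  move: hfin; case: (ereal_sup S) => [z| |]//= _; rewrite ?leNye// lee_fin.
  exact: ler_norm.
apply: (@le_lt_trans _ _ (c * D)%:E); last exact: ltry.
apply: ge_ereal_sup => _ [x _ <-]; rewrite lee_fin -ler_pdivrMr//; exact: hc.
Qed.

Lemma jlim_nat (h : nat -> nat -> C) (l : C) :
  (forall e : R, 0 < e -> exists N0, forall t s, (N0 <= t)%N -> (N0 <= s)%N -> cmod (h t s - l) < e) ->
  jlim \oo h l.
Proof.
move=> H e /H[N0 h0]; exists [set N | (N0 <= N)%N]; split; last by move=> t s; exact: h0.
exact: nbhs_infty_ge.
Qed.

Lemma jlim_natP (h : nat -> nat -> C) (l : C) : jlim \oo h l ->
  forall e : R, 0 < e -> exists N0, forall t s, (N0 <= t)%N -> (N0 <= s)%N -> cmod (h t s - l) < e.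
Proof.
move=> H e /H[A [[N0 _ hN] hA]]; exists N0 => t s tN sN; apply: hA; exact: hN.
Qed.

Lemma cint_le_norm1 chi : tf chi -> cmod (cint chi) <= 2 * norm1 chi.
Proof.
move=> h; apply: cint_bound; [exact: tc_cdom (tf_tc h)|exact: tc_cmod (tf_tc h)|by []].
Qed.

Variables (a : (V -> C) -> C) (f : V -> C) (U : set V).
Hypothesis ta : tempered a.
Hypothesis pa : forall phi, schwartz phi -> 0 <= sesq (tconv_dist a phi) phi.
Hypothesis Uo : open U.
Hypothesis U0 : U 0.
Hypothesis fs : smooth U f.
Hypothesis af : coincides_on U a f.

Let fc Z : U Z -> ccont f Z. Proof. by move=> UZ; exact: smooth_cont fs UZ. Qed.

Lemma form_moll_moll W : U W ->
  jlim \oo (fun t s => form a (moll t) (tshift W (moll s))) (f W).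
Proof.
move=> UW; apply: jlim_nat => e e0; have e2 : 0 < e / 2 by rewrite divr_gt0.
have [r r0 hr] := local_form Uo fc af UW e2.
exists (Num.truncn r^-1) => t s ht hs.
have small N : (Num.truncn r^-1 <= N)%N -> forall Z : V, r < `|Z| -> moll N Z = 0.
  move=> hN Z rZ; apply: moll_support; apply: le_lt_trans rZ.
  rewrite -[leRHS]invrK lef_pV2 ?posrE ?invr_gt0//; apply/ltW.
  by apply: lt_le_trans (truncnS_gt _) _; rewrite ler_nat ltnS.
have := hr _ _ (moll_tf t) (moll_tf s) (small _ ht) (small _ hs).
rewrite !cint_moll !norm1_moll conjR !mulr1 => h.
by apply: le_lt_trans h _; lra.
Qed.

(** The index [inl W] stands for the limit of the mollifiers translated to [W], and
   [inr psi] for the test function [psi]. By invariance the Cauchy property needs to be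
   checked at [W = 0] only, where [a] is a continuous function. *)
Lemma limit_kernel : exists g : V -> C, exists K : V + @testf R d -> V + @testf R d -> C,
  [/\ psd predT K, forall W W', K (inl W) (inl W') = twist g W W',
      forall W, jlim \oo (fun t s => form a (moll t) (tshift W (moll s))) (g W),
      forall p : @testf R d, K (inl 0) (inr p) = a (fun X => (sval p X)^*%C) &
      forall (p : @testf R d) W,
        jlim \oo (fun t s => form a (sval p) (tshift W (moll s))) (K (inr p) (inl W)) /\
        K (inr p) (inr p) = form a (sval p) (sval p)].
Proof.
pose Kf (i j : @testf R d) := form a (sval i) (sval j).
pose q (x : V + @testf R d) (N : nat) : seq (C * @testf R d) :=
  match x with
  | inl W => [:: (1, exist _ (tshift W (moll N)) (tshift_tf W (moll_tf N)))]
  | inr psi => [:: (1, psi)]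
  end.
pose v (x : V + @testf R d) (N : nat) : V -> C :=
  match x with inl W => tshift W (moll N) | inr psi => sval psi end.
have qE x y t s : kform Kf (q x t) (q y s) = form a (v x t) (v y s).
  by case: x => x; case: y => y; rewrite kform1 conjR !mul1r.
have [||K [Kpsd Klim]] := @psd_limit _ _ _ nat \oo _ predT Kf predT q (form_psd ta pa).
- by move=> [W|psi] t.
- move=> [W|psi] _.
    exists (f 0); apply: jlim_ext (form_moll_moll U0) => t s; rewrite qE /= tshift0.
    by rewrite /form corr_tshift//; exact: moll_tf.
  by exists (form a (sval psi) (sval psi)); apply: jlim_ext (jlim_cst _) => t s; rewrite qE.
have {}Klim x y : jlim \oo (fun t s => form a (v x t) (v y s)) (K x y).
  by apply: jlim_ext (Klim x y isT isT) => t s; rewrite qE.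
exists (fun W => K (inl 0) (inl W)), K; split => //.
- move=> W W'; apply: jlim_unique (Klim (inl W) (inl W')) _.
  apply: jlim_ext (jlimM (jlim_cst (expi (2 * symplectic W' W))) (Klim (inl 0) (inl (W' - W)))) => t s /=; rewrite tshift0.
  have h1 : tf (moll t : V -> C) := moll_tf t; have h2 := tshift_tf (W' - W) (moll_tf s).
  have -> : tshift W' (moll s) = fun Y => expi (2 * symplectic W W') * tshift W (tshift (W' - W) (moll s)) Y + 0.
    by rewrite (tshift_comp W); apply/funext => Y; rewrite addr0.
  rewrite form_linr//; [|exact: tshift_tf|exact: tshift_tf|exact: tf0].
  rewrite form0r ?addr0//; last exact: tshift_tf.
  by rewrite expiJ (sympC W') mulrN /form corr_tshift.
- by move=> W; apply: jlim_ext (Klim (inl 0) (inl W)) => t s /=; rewrite tshift0.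
- move=> psi; apply: jlim_unique (Klim (inl 0) (inr psi)) _.
  apply: jlim_nat => e e0; have [N0 hN] := form_moll ta (svalP psi) e0.
  by exists N0 => t s ht _ /=; rewrite tshift0; exact: hN.
- move=> psi W; split; first exact: Klim (inr psi) (inl W).
  by apply: jlim_unique (Klim (inr psi) (inr psi)) _; exact: jlim_cst.
Qed.

Section representation.
Variables (g : V -> C) (K : V + @testf R d -> V + @testf R d -> C).
Hypothesis Kpsd : psd predT K.
Hypothesis K_twist : forall W W', K (inl W) (inl W') = twist g W W'.
Hypothesis g_lim : forall W, jlim \oo (fun t s => form a (moll t) (tshift W (moll s))) (g W).
Hypothesis K_a : forall p : @testf R d, K (inl 0) (inr p) = a (fun X => (sval p X)^*%C).
Hypothesis K_form : forall (p : @testf R d) W,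
  jlim \oo (fun t s => form a (sval p) (tshift W (moll s))) (K (inr p) (inl W)) /\
  K (inr p) (inr p) = form a (sval p) (sval p).

Lemma density_eq W : U W -> g W = f W.
Proof. by move=> UW; apply: jlim_unique (g_lim W) (form_moll_moll UW). Qed.

Lemma density_psd : psd predT (twist g).
Proof. by apply: (psd_pullback (f := inl) Kpsd) => // W W' _ _; rewrite K_twist. Qed.

Lemma K_diag W : K (inl W) (inl W) = f 0.
Proof.
by rewrite K_twist /twist subrr sympxx mulr0 expi0 mul1r density_eq.
Qed.

(** In the Hilbert seminorm of the kernel, [tshift W chi] is close to [cint chi] times the
   point [inl W]: by invariance this is a computation at the origin, where
   [local_form] applies. Cauchy-Schwarz against the point [inl 0] turns it into a
   statement about [a] and [g]. *)
Lemma concentrated (tau : R) : 0 < tau -> exists2 r : R, 0 < r & forall W chi, tf chi ->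
  (forall Z, r < `|Z| -> chi Z = 0) ->
  cmod (a (fun X => (tshift W chi X)^*%C) - (cint chi)^*%C * g W) <= tau * norm1 chi.
Proof.
move=> tau0; pose G0 := cmod (f 0).
have G00 : 0 <= G0 := cmod_ge0 _.
(* The squared distance is an error [e1] of size [delta * n ^ 2] plus two errors
   [eta * e2] of size [2 * delta * n ^ 2]; the squared norm of [inl 0] is [f 0]. *)
pose delta : R := tau ^+ 2 / (5 * (G0 + 1)).
have d0 : 0 < delta by rewrite divr_gt0 ?exprn_gt0 ?mulr_gt0// ltr_wpDl.
have [r r0 hr] := local_form Uo fc af U0 d0.
exists r => // W chi tc sc.
pose p : @testf R d := exist _ (tshift W chi) (tshift_tf W tc).
have [eta etaE] : {eta : C | eta = cint chi} by exists (cint chi).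
pose n := norm1 chi.
have n0 : 0 <= n := norm1_ge0 chi.
have en : cmod eta <= 2 * n by rewrite etaE; exact: cint_le_norm1.
pose e1 := form a chi chi - f 0 * (eta * eta^*%C).
have e1n : cmod e1 <= delta * (n * n).
  by have := hr _ _ tc tc sc sc; rewrite tshift0 -etaE.
pose m := K (inr p) (inl W); pose e2 := m - f 0 * eta.
have e2n : cmod e2 <= delta * n.
  apply: le_epsilon => e e_gt0.
  have [N0 hN] := jlim_natP (K_form p W).1 e_gt0.
  pose N := maxn N0 (Num.truncn r^-1).
  have := hN N N (leq_maxl _ _) (leq_maxl _ _) => /= h1.
  have sN (Z : V) : r < `|Z| -> moll N Z = 0.
    move=> rZ; apply: moll_support; apply: le_lt_trans rZ.
    rewrite -[leRHS]invrK lef_pV2 ?posrE ?invr_gt0//; apply/ltW.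
    by apply: lt_le_trans (truncnS_gt _) _; rewrite ler_nat ltnS leq_maxr.
  have := hr _ _ tc (moll_tf N) sc sN.
  rewrite tshift0 cint_moll norm1_moll conjR !mulr1 -etaE => h2.
  have E : form a (tshift W chi) (tshift W (moll N)) = form a chi (moll N).
    by rewrite /form corr_tshift//; exact: moll_tf.
  rewrite E in h1.
  have -> : e2 = (form a chi (moll N) - f 0 * eta) - (form a chi (moll N) - m).
    by rewrite /e2; ring.
  apply: le_trans (cmodB _ _) _; apply: lerD; [exact: h2|exact: ltW].
have mJ : K (inl W) (inr p) = m^*%C by exact: (psd_herm Kpsd).
have f0J : (f 0)^*%C = f 0 by rewrite -(K_diag W) -(psd_herm Kpsd).
pose c1 : seq (C * (V + @testf R d)) := [:: (1, inr p); (- eta, inl W)].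
pose c2 : seq (C * (V + @testf R d)) := [:: (1, inl 0)].
have k11 : kform K c1 c1 = e1 - eta^*%C * e2 - eta * e2^*%C.
  have E (k mm mj ff e ej : C) :
      1 * 1 * k + (1 * - ej * mm + 0) + (- e * 1 * mj + (- e * - ej * ff + 0) + 0) =
      (k - ff * (e * ej)) - ej * (mm - ff * e) - e * (mj - ff * ej) by ring.
  rewrite /kform !big_cons !big_nil; cbn [fst snd]; rewrite conjc1 conjN.
  rewrite -/m mJ K_diag (K_form p W).2 /= {1}/form (corr_tshift W tc tc) -/(form a chi chi).
  have e2J : e2^*%C = m^*%C - f 0 * eta^*%C by rewrite /e2 conjD conjN conjM f0J.
  by rewrite e2J /e1 /e2; exact: E.
have k21 : kform K c2 c1 = a (fun X => (tshift W chi X)^*%C) - eta^*%C * g W.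
  rewrite /kform !big_cons !big_nil; cbn [fst snd]; rewrite conjc1 conjN K_a K_twist /twist /=.
  have -> : symplectic W 0 = 0 :> R by have := sympZr 0 W 0; rewrite scale0r mul0r.
  by rewrite mulr0 expi0 subr0; ring.
have k22 : kform K c2 c2 = f 0 by rewrite kform1 conjR K_diag !mul1r.
have bound : complex.Re (kform K c1 c1) <= 5 * delta * (n * n).
  apply: le_trans (ler_norm _) _; apply: le_trans (cmod_Re _) _; rewrite k11.
  apply: le_trans (cmodB _ _) _; apply: le_trans (lerD (cmodB _ _) (lexx _)) _.
  rewrite !cmodM !cmodJ.
  have h : cmod eta * cmod e2 <= 2 * n * (delta * n) by apply: ler_pM => //; exact: cmod_ge0.
  move: (cmod eta * cmod e2) (cmod e1) h e1n => u v h e1n.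
  have -> : 5 * delta * (n * n) = delta * (n * n) + 2 * n * (delta * n) + 2 * n * (delta * n) by ring.
  by apply: lerD => //; apply: lerD.
have cs := psd_cauchy_schwarz Kpsd (c1 := c2) (c2 := c1) isT isT.
rewrite -etaE; rewrite k21 k22 in cs.
have nn : 0 <= tau * n by rewrite mulr_ge0// ltW.
rewrite -[leLHS]ger0_norm ?cmod_ge0// -[leRHS]ger0_norm// -ler_sqr ?nnegrE// !real_normK ?num_real//.
apply: le_trans cs _.
have g1 : complex.Re (f 0) <= G0 := le_trans (ler_norm _) (cmod_Re _).
have [_ k0] : complex.Im (kform K c1 c1) = 0 /\ 0 <= complex.Re (kform K c1 c1) by apply/ge0c/Kpsd.
apply: (@le_trans _ _ (G0 * (5 * delta * (n * n)))).
  apply: le_trans (ler_wpM2r k0 g1) _; exact: ler_wpM2l.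
have -> : G0 * (5 * delta * (n * n)) = (tau * n) ^+ 2 * (G0 / (G0 + 1)).
  by rewrite /delta; field; rewrite gt_eqF// ltr_wpDl.
by apply: ler_piMr; [exact: exprn_ge0|rewrite ler_pdivrMr ?mul1r ?lerDl// ltr_wpDl].
Qed.

End representation.

End density.

(** * Integration against the density *)

Section integral_representation.
Context {R : realType} {d : nat}.
Local Notation C := R[i].
Local Notation V := 'rV[R]_(d + d).
Implicit Types (phi psi chi : V -> C) (X Y Z W : V) (j : 'I_(d + d)).

Variables (a : (V -> C) -> C) (g : V -> C).
Hypothesis ta : tempered a.
Hypothesis gS : schwartz g.
Hypothesis conc : forall tau : R, 0 < tau -> exists2 r : R, 0 < r & forall W chi, tf chi ->
  (forall Z, r < `|Z| -> chi Z = 0) ->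
  cmod (a (fun X => (tshift W chi X)^*%C) - (cint chi)^*%C * g W) <= tau * norm1 chi.

Let gs : smooth setT g. Proof. exact: schwartz_smooth. Qed.

Lemma density_bounds : exists B L : R, [/\ 0 <= B, 0 <= L, forall X, cmod (g X) <= B &
  forall X Y, cmod (g X - g Y) <= L * `|X - Y|].
Proof.
have [B B0 hB] := schwartz_decay gS [::] 0.
have [B' B0' hB'] : exists2 B : R, 0 <= B & forall j X, cmod (pd j g X) <= B.
  apply: common_bound => j; have [c c0 hc] := schwartz_decay gS [:: j] 0.
  by exists c => // X; have := hc X; rewrite expr0 mul1r.
exists B, (2 * B' * (d + d)%:R); split => //; first by rewrite !mulr_ge0.
  by move=> X; have := hB X; rewrite expr0 mul1r.
exact: smooth_lipschitz.
Qed.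

Lemma tf_mulg psi : tf psi -> tf (fun X => g X * psi X).
Proof. by move=> h; apply: tf_ext (tfM h gs) => X; exact: mulrC. Qed.

(** Every test function is the conjugate of a twisted translate of another. *)
Lemma concentrated_pairing (tau : R) : 0 < tau -> exists2 r : R, 0 < r & forall W psi, tf psi ->
  (forall Z, r < `|Z - W| -> psi Z = 0) ->
  cmod (a psi - g W * cint (fun Y => psi Y * phase W Y)) <= tau * norm1 psi.
Proof.
move=> /conc[r r0 hr]; exists r => // W psi tp sp.
have phW Y : phase W (Y + W) = phase W Y by rewrite /phase sympDl sympxx addr0.
pose chi Y := (psi (Y + W))^*%C * (phase W Y)^*%C.
have tc : tf chi by apply: tfM; [apply/tfJ/tf_shift|apply/smoothJ/smooth_phase].
have sc Z : r < `|Z| -> chi Z = 0.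
  by move=> rZ; rewrite /chi sp ?addrK// conjR mul0r.
have pE : (fun X => (tshift W chi X)^*%C) = psi.
  apply/funext => X; rewrite /tshift /chi subrK.
  have -> : phase W (X - W) = phase W X by rewrite -{2}(subrK W X) phW.
  rewrite conjM conjM !conjcK -mulrA (_ : phase W X * _ = 1) ?mulr1//.
  by rewrite mulcJ cmod_phase expr1n.
have nE : norm1 chi = norm1 psi.
  rewrite /norm1 -(rint_shift W (tc_cmod (tf_tc tp))); congr rint; apply/funext => Y.
  by rewrite /chi cmodM !cmodJ cmod_phase mulr1.
have iE : (cint chi)^*%C = cint (fun Y => psi Y * phase W Y).
  have h : tf (fun Y => psi Y * phase W Y) by apply: tfM => //; exact: smooth_phase.
  rewrite -cintJ; last exact: tc_cdom (tf_tc tc).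
  rewrite -(cint_shift W (tc_cdom (tf_tc h))); congr cint; apply/funext => Y.
  by rewrite /chi conjM !conjcK phW.
by have := hr W _ tc sc; rewrite pE nE iE mulrC.
Qed.

(** On a small ball both [g] and the phase are close to their values at the centre. The
   error is relative to [norm1 psi], so it can be summed over a partition of unity
   however fine; [M] bounds the variation of the phase. *)
Lemma small_support (M e : R) : 0 < e -> exists2 r : R, 0 < r & forall (rho : R) W psi,
  0 < rho -> rho <= r -> `|W| <= M -> tf psi -> (forall Z, rho < `|Z - W| -> psi Z = 0) ->
  cmod (a psi - cint (fun X => g X * psi X)) <= e * norm1 psi.
Proof.
move=> e0; have e2 : 0 < e / 2 by rewrite divr_gt0.
have [r1 r10 hr1] := concentrated_pairing e2.
have [B [L [B0 L0 hB hL]]] := density_bounds.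
pose K : R := 2 * (L + B * (8 * d%:R * `|M|)).
have K0 : 0 <= K by rewrite !(mulr_ge0, addr_ge0).
have K1 : 0 < K + 1 by rewrite ltr_wpDl.
exists (Num.min r1 (e / 2 / (K + 1))); first by rewrite lt_min r10 divr_gt0.
move=> rho W psi rho0; rewrite le_min => /andP[rr1 rrK] WM tp sp.
have h1 := hr1 W psi tp (fun Z hZ => sp Z (le_lt_trans rr1 hZ)).
have tph : tf (fun Y => psi Y * phase W Y) by apply: tfM => //; exact: smooth_phase.
have tgp := tf_mulg tp.
have h2 : cmod (cint (fun X => g X * psi X) - g W * cint (fun Y => psi Y * phase W Y)) <=
    K * rho * norm1 psi.
  rewrite -cintZ; last exact: tc_cdom (tf_tc tph).
  rewrite -cintB; [|exact: tc_cdom (tf_tc tgp)|exact: cdomZ (tc_cdom (tf_tc tph))].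
  have -> : K * rho * norm1 psi =
      2 * rint (fun Y => (L + B * (8 * d%:R * `|M|)) * rho * cmod (psi Y)).
    by rewrite rintZ ?/norm1 /K ?mulrA//; exact: tc_cmod (tf_tc tp).
  apply: cint_bound.
  - by apply: cdomB; [exact: tc_cdom (tf_tc tgp)|exact: cdomZ (tc_cdom (tf_tc tph))].
  - by apply: rdomZ; exact: tc_cmod (tf_tc tp).
  move=> Y; have [rY|Yr] := ltP rho `|Y - W|; first by rewrite sp// mul0r !mulr0 subrr cmod0 mulr0.
  have -> : g Y * psi Y - g W * (psi Y * phase W Y) =
      ((g Y - g W) + g W * (1 - phase W Y)) * psi Y by ring.
  rewrite cmodM; apply: ler_wpM2r; first exact: cmod_ge0.
  apply: le_trans (cmodD _ _) _; rewrite mulrDl; apply: lerD.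
    by apply: le_trans (hL _ _) _; exact: ler_wpM2l.
  rewrite cmodM -mulrA; apply: ler_pM; rewrite ?cmod_ge0//.
  have -> : phase W Y = phase W (Y - W) by rewrite /phase sympDl sympNl sympxx subr0.
  rewrite cmodBC; apply: le_trans (cmod_expiB1 _) _; rewrite normrM gtr0_norm//.
  have hs := symp_bound (Y - W) W.
  have hz : 2 * d%:R * `|Y - W| * `|W| <= 2 * d%:R * rho * `|M|.
    apply: ler_pM; rewrite ?mulr_ge0//; last exact: le_trans WM (ler_norm _).
    by apply: ler_wpM2l => //; rewrite mulr_ge0.
  move: (`|symplectic (Y - W) W|) hs hz => s hs hz.
  have -> : 8 * d%:R * `|M| * rho = 4 * (2 * d%:R * rho * `|M|) by ring.
  by lra.
have hK : K * rho <= e / 2.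
  apply: (@le_trans _ _ ((K + 1) * rho)).
    by apply: ler_wpM2r; [exact: ltW|rewrite lerDl].
  by rewrite mulrC -ler_pdivlMr.
have n0 := norm1_ge0 psi.
have h3 : K * rho * norm1 psi <= e / 2 * norm1 psi by apply: ler_wpM2r.
have -> : a psi - cint (fun X => g X * psi X) =
   (a psi - g W * cint (fun Y => psi Y * phase W Y)) -
   (cint (fun X => g X * psi X) - g W * cint (fun Y => psi Y * phase W Y)) by ring.
apply: le_trans (cmodB _ _) _; apply: le_trans (lerD h1 (le_trans h2 h3)) _.
by rewrite -mulrDl -splitr.
Qed.

(** The pieces of [psi] under a partition of unity into small boxes have total mass
   [norm1 psi], so the defects add up to at most [e * norm1 psi]. *)
Lemma test_representation psi : tf psi -> a psi = cint (fun X => g X * psi X).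
Proof.
move=> tp; have [_ [M0 hM0]] := tp; pose M := `|M0|.
have M_ge0 : 0 <= M by exact: normr_ge0.
have hM X : M < `|X| -> psi X = 0 by move=> h; apply: hM0; exact: le_lt_trans (ler_norm _) h.
have n0 := norm1_ge0 psi.
suff H (e : R) : 0 < e -> cmod (a psi - cint (fun X => g X * psi X)) <= e * norm1 psi.
  apply/eqP; rewrite -subr_eq0; apply/eqP/cmod_eq0/le_anti; rewrite cmod_ge0 andbT.
  apply: le_epsilon => e e0; rewrite add0r.
  have n1 : 0 < norm1 psi + 1 by rewrite ltr_wpDl.
  apply: le_trans (H (e / (norm1 psi + 1)) _) _; first by rewrite divr_gt0.
  rewrite mulrAC -mulrA; apply: ler_piMr; first exact: ltW.
  by rewrite ler_pdivrMr// mul1r lerDl.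
move=> e0; have [r r0 hr] := small_support (M + 1) e0.
pose rho : R := Num.min 1 r; have rho0 : 0 < rho by rewrite lt_min ltr01.
have rho1 : rho <= 1 by rewrite ge_min lexx.
have rhor : rho <= r by rewrite ge_min lexx orbT.
pose L := rho^-1; have L0 : 0 < L by rewrite invr_gt0.
have LV : L^-1 = rho by rewrite invrK.
pose m := (Num.truncn (L * M)).+2.
have hm : L * M <= m%:R - 1.
  by rewrite /m -(natr1 (Num.truncn (L * M)).+1) addrK; apply: ltW; exact: truncnS_gt.
pose P (f : {ffun 'I_(d + d) -> 'I_(m + m)}) X : C := psi X * (boxes L f X)%:C.
have tP f : tf (P f) by apply: tfM => //; exact: smooth_boxes.
have sumP X : psi X = \sum_f P f X.
  rewrite /P -mulr_sumr; have [MX|XM] := ltP M `|X|; first by rewrite hM// mul0r.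
  rewrite -rmorph_sum (boxes_sum (ltW L0)) ?mulr1//.
  by apply: le_trans hm; apply: ler_wpM2l => //; exact: ltW.
have small f : cmod (a (P f) - cint (fun X => g X * P f X)) <= e * norm1 (P f).
  have sP Z : rho < `|Z - box_center L f| -> P f Z = 0.
    by rewrite -LV => h; rewrite /P boxes_support// mulr0.
  have [WM|MW] := leP `|box_center L f| (M + 1); first exact: hr rho0 rhor WM (tP f) sP.
  have P0 : P f = fun=> 0.
    apply/funext => Z; have [MZ|ZM] := ltP M `|Z|; first by rewrite /P hM// mul0r.
    apply: sP; have := ler_normB Z (Z - box_center L f).
    have -> : Z - (Z - box_center L f) = box_center L f by rewrite opprB subrKC.
    by move=> ?; lra.
  rewrite P0 (a0 ta).
  have -> : (fun X => g X * 0) = fun=> 0 by apply/funext => X; rewrite mulr0.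
  by rewrite cint0 subrr cmod0 mulr_ge0// ?norm1_ge0// ltW.
have aE : a psi = \sum_f a (P f).
  by rewrite -(a_sum ta)//; congr a; apply/funext.
have cE : cint (fun X => g X * psi X) = \sum_f cint (fun X => g X * P f X).
  have [_ <-] := @cint_sum R _ _ (index_enum {ffun 'I_(d + d) -> 'I_(m + m)})
    (fun f X => g X * P f X) (fun f => tc_cdom (tf_tc (tf_mulg (tP f)))).
  by congr cint; apply/funext => X; rewrite sumP mulr_sumr.
have nE : \sum_f norm1 (P f) = norm1 psi.
  have h := @cint_sum R _ _ (index_enum {ffun 'I_(d + d) -> 'I_(m + m)})
    (fun f X => (cmod (P f X))%:C).
  have hd f : cdom (fun X => (cmod (P f X))%:C).
    split; first exact: tc_cmod (tf_tc (tP f)).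
    by have [] := cdom0 (R := R) (n := d + d).
  have [_ E] := h hd; have := congr1 (@complex.Re R) E.
  rewrite {1}/cint [LHS]/= => E'.
  have -> : norm1 psi = rint (fun X => complex.Re (\sum_f (cmod (P f X))%:C)).
    rewrite /norm1; congr rint; apply/funext => X.
    rewrite -rmorph_sum /=.
    have [MX|XM] := ltP M `|X|.
      rewrite hM// cmod0 big1// => f _; by rewrite /P hM// mul0r cmod0.
    under eq_bigr do rewrite /P cmodM cmodR ger0_norm ?boxes_ge0//.
    rewrite -mulr_sumr (boxes_sum (ltW L0)) ?mulr1//.
    by apply: le_trans hm; apply: ler_wpM2l => //; exact: ltW.
  rewrite E'; elim/big_rec2 : _ => [//|f y1 y2 _ ->].
  by rewrite ReD.
rewrite aE cE -sumrB -nE mulr_sumr.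
by apply: le_trans (cmod_sum _ _ _) _; apply: ler_sum => f _; exact: small.
Qed.

(** Both sides are continuous along the cut-offs of [psi]: the left one because [a] is
   tempered, the right one because [g] is bounded. *)
Lemma schwartz_representation psi : schwartz psi -> a psi = cint (fun X => g X * psi X).
Proof.
move=> hpsi; have ps := schwartz_smooth hpsi.
have tN N : tf (fun X => psi X * cutN N X).
  by apply: tf_ext (tfM (cutN_tf N) ps) => X; exact: mulrC.
have [B [_ [B0 _ hB _]]] := density_bounds.
have gd (phi : V -> C) (c : R) : 0 <= c -> smooth setT phi ->
    (forall X, (1 + `|X|) ^+ (2 * (d + d)) * cmod (phi X) <= c) ->
    cdom (fun X => g X * phi X) /\ cmod (cint (fun X => g X * phi X)) <=
      B * c * (2 * rint (fun X : V => weight X)).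
  move=> c0 phs hphi; apply: cdom_of_decay => [X| |X].
  - by apply: ccontM; [exact: smooth_cont gs _|exact: smooth_cont phs _].
  - exact: mulr_ge0.
  rewrite cmodM mulrCA; apply: ler_pM => //; first exact: cmod_ge0.
  by rewrite mulr_ge0 ?cmod_ge0// exprn_ge0// addr_ge0.
have [c c0 hc] := schwartz_decay hpsi [::] (2 * (d + d)).
have [psid _] := gd psi c c0 ps hc.
have [_ /(_ [::])[c1 c10 hc1]] := cutN_decay hpsi (2 * (d + d)).
pose A := B * c1 * (2 * rint (fun X : V => weight X)).
have A0 : 0 <= A.
  by rewrite !mulr_ge0// rint_ge0// => X; exact/ltW/weight_gt0.
have close N : cmod (cint (fun X => g X * (psi X * cutN N X)) - cint (fun X => g X * psi X)) <=
    A / N.+1%:R.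
  have [|||h1 h2] := gd (fun X => psi X * cutN N X - psi X) (c1 / N.+1%:R).
  - by rewrite divr_ge0.
  - by apply: smoothB => //; case: (tN N).
  - by move=> X; rewrite ler_pdivlMr// mulrC mulrA; exact: hc1.
  rewrite -cintB//; last exact: tc_cdom (tf_tc (tf_mulg (tN N))).
  have -> : (fun X => g X * (psi X * cutN N X) - g X * psi X) =
     (fun X => g X * (psi X * cutN N X - psi X)) by apply/funext => X; rewrite mulrBr.
  have E (x y z w : R) : x * (y / z) * w = x * y * w / z by ring.
  by rewrite /A -E.
apply/eqP; rewrite -subr_eq0; apply/eqP/cmod_eq0/le_anti; rewrite cmod_ge0 andbT.
apply: le_epsilon => e e0; rewrite add0r; have e2 : 0 < e / 2 by rewrite divr_gt0.
have [N0 hN0] := tempered_lim ta hpsi (fun N => tf_schwartz (tN N)) (cutN_decay hpsi) e2.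
pose N := maxn N0 (Num.truncn (A / (e / 2))).
have h1 := hN0 N (leq_maxl _ _); have h2 := close N.
have h3 : A / N.+1%:R <= e / 2.
  rewrite ler_pdivrMr// mulrC -ler_pdivrMr//; apply/ltW.
  by apply: lt_le_trans (truncnS_gt _) _; rewrite ler_nat ltnS leq_maxr.
rewrite (test_representation (tN N)) in h1.
have -> : a psi - cint (fun X => g X * psi X) =
  (cint (fun X => g X * (psi X * cutN N X)) - cint (fun X => g X * psi X)) -
  (cint (fun X => g X * (psi X * cutN N X)) - a psi) by ring.
apply: le_trans (cmodB _ _) _; rewrite (splitr e).
by apply: lerD; [exact: le_trans h2 h3|exact: ltW].
Qed.

End integral_representation.

Theorem theorem4p1 (R : realType) (d : nat) (s : R)
    (Omega : set 'rV[R]_(d + d))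
    (a : ('rV[R]_(d + d) -> R[i]) -> R[i]) (f : 'rV[R]_(d + d) -> R[i]) :
  2^-1 <= s ->
  nbhs (0 : 'rV[R]_(d + d)) Omega ->
  tempered_plus a ->
  smooth_repr_on Omega a f ->
  (exists h : R, 0 < h /\
     (ereal_sup
        [set ereal_sup
           [set (Normc.normc (mderiv beta f X) /
                 ((mi_fact beta)%:R `^ s * h ^+ mi_size beta))%:E
             | X in Omega]
         | beta in [set: {ffun 'I_(d + d) -> nat}]] < +oo)%E) ->
  in_gelfand_shilov s a.
Proof.
move=> s_half nO [ta pa] [U [Uo OU fU af]] [h [h0 hfin]].
have O0 : Omega 0 := nbhs_singleton nO.
have U0 : U 0 := OU _ O0.
have fs : smooth U f by apply/(smooth_onP Uo).
have s0 : 0 <= s by lra.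
have [g [K [Kpsd Ktw glim Ka Kform]]] := limit_kernel ta pa Uo U0 fs af.
have gf W : U W -> g W = f W by exact: (density_eq Uo fs af glim).
have [C0 C00 hC0] := derivative_bounds s0 h0 Uo U0 O0 fs hfin.
have gsU : smooth U g by move=> k; apply: (ck_ext Uo) (fs k) => X /gf.
have g0 u : cmod (pds u g 0) <= C0 * h ^+ size u * ((size u)`!%:R `^ s).
  by rewrite (pds_ext Uo u gf U0).
have gpsd : psd predT (twist g) := density_psd Kpsd Ktw.
have gGS := gelfand_shilov_of_psd Uo U0 gsU gpsd s_half h0 C00 g0.
exists g; split => // phi; apply: (schwartz_representation ta (gelfand_shilov_schwartz gGS)).
by move=> tau; exact: (concentrated Uo U0 fs af Kpsd Ktw glim Ka Kform).
Qed.
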